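(* Let $d\ge 2$ be an integer and $R>0$. For any real $\tau>d-1$, any real $\ell>2d+1$ and any pair of real constants $T_0>0$, $\varepsilon>0$, there exist 1. a Hamiltonian $H\in C^\ell(\mathbb{T}^d\times B_R)$ of the form $H(\theta,I)=\omega\cdot I+f(\theta,I)$ with $f(\theta,I)=\mathcal{O}(I^2)$ and $\omega\in\Omega^d_\tau$; 2. a sequence of initial conditions $(\theta_n,I_n)_{n\ge 0}$ in $\mathbb{T}^d\times B_R$ with $\rho_n:=\|I_n\|_\infty>0$ and $\rho_n\to 0$; 3. an associated sequence of times $$t_n:=\frac{T_0}{\rho_n^{\,1+\frac{\ell-1}{\tau+1}+\varepsilon}};$$ 4. a pair of constants $C_1,c>0$; such that, for every $n\ge 0$ and every $(\theta,I)$ in the ball of radius $r:=\frac{|\rho_n|}{4}e^{-c|t_n|}$ around $(\theta_n,I_n)$, the Hamiltonian flow $\Phi^t_H$ starting at $(\theta,I)$ satisfies $$\left\|\Pi_I\Phi^t_H(\theta,I)\right\|_\infty<\frac32\rho_n\qquad\text{for all } |t|<\frac{C_1}{\rho_n^{\,1+\frac{\ell-1}{\tau+1}}\,|\ln\rho_n|^{\ell-1}}$$ and $$\sup_{t\in[0,t_n]}\left\|\Pi_I\Phi^t_H(\theta,I)\right\|_\infty\ge 2\rho_n.$$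
   Context: $\mathbb{T}^d=\mathbb{R}^d/\mathbb{Z}^d$; $\|\cdot\|_\infty$ is the sup-norm on $\mathbb{R}^d$; for $r>0$, $B_r=\{I\in\mathbb{R}^d:\|I\|_\infty<r\}$; $\Pi_I(\theta,I)=I$ is the projection onto the action variables. Balls in $\mathbb{T}^d\times\mathbb{R}^d$ are taken with respect to the distance induced by the sup-norm. Hölder spaces: for real $\ell$, put $q=[\ell]$ (integer part) and $\mu=\ell-q$. For a domain $D$, $C^\ell(D)$ is the space of functions $f$ on $D$, $q$ times continuously differentiable, with finite norm $$\|f\|_{C^\ell(D)}=\sup_{|\alpha|\le q}\ \sup_{x\in D}|\partial^\alpha f(x)|+\sup_{|\alpha|=q}\ \sup_{x,y\in D,\ 0<|x-y|<1}\frac{|\partial^\alpha f(x)-\partial^\alpha f(y)|}{|x-y|^\mu},$$ where $\alpha$ ranges over multi-indices. Functions on $\mathbb{T}^d\times B_R$ are identified with functions on $\mathbb{R}^d\times B_R$ that are $\mathbb{Z}^d$-periodic in $\theta$. The notation $f(\theta,I)=\mathcal{O}(I^2)$ means that the Taylor expansion of $f$ in $I$ at $I=0$ starts at order two, i.e. $f(\theta,0)=0$ and $\partial_I f(\theta,0)=0$ for all $\theta\in\mathbb{T}^d$. Thus $\mathbb{T}^d\times\{0\}$ is an invariant torus with frequency $\omega$. Diophantine vectors: for $\gamma>0$, $\Omega^d_{\tau,\gamma}$ is the set of $\omega\in\mathbb{R}^d$ such that $|\omega\cdot k|\ge\gamma/|k|^\tau$ for all $k\in\mathbb{Z}^d\setminus\{0\}$,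 where $|k|=|k_1|+\dots+|k_d|$; and $\Omega^d_\tau=\bigcup_{\gamma>0}\Omega^d_{\tau,\gamma}$. $\Phi^t_H(\theta,I)$ denotes the solution at time $t$, starting at $(\theta,I)$ at time $0$, of Hamilton's equations $\dot\theta=\partial_I H$, $\dot I=-\partial_\theta H$ on $\mathbb{T}^d\times B_R$, for any $t$ for which it is defined. *)

(* Defs.v *)
From HB Require Import structures.
From mathcomp Require Import all_boot all_order all_algebra.
From mathcomp Require Import all_classical all_reals all_analysis.

Set Implicit Arguments.
Unset Strict Implicit.
Unset Printing Implicit Defensive.

Import Order.TTheory GRing.Theory Num.Theory.
Import numFieldNormedType.Exports.

Local Open Scope classical_set_scope.
Local Open Scope ring_scope.

(* Everything lives on the universal cover: a point (theta, I) of T^d x R^d is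
   represented by a pair of row vectors, and functions on T^d x B_r by
   functions of (theta, I) that are Z^d-periodic in theta.  The norm of
   'rV[R]_m is the sup-norm.  Functions are total in Rocq, but only their
   values on the open set R^d x B_r matter below. *)

Section Holder.
Variables (R : realType) (m : nat).
Implicit Types (f : 'rV[R]_m -> R) (D : set 'rV[R]_m) (a : {ffun 'I_m -> nat}).

Definition partial (i : 'I_m) f (x : 'rV[R]_m) : R := 'D_(delta_mx 0 i) f x.

Definition gradient f (x : 'rV[R]_m) : 'rV[R]_m := \row_i partial i f x.

Definition mlength a : nat := (\sum_i a i)%N.

Definition mpartial a f : 'rV[R]_m -> R :=
  foldr (fun i g => iter (a i) (partial i) g) f (enum 'I_m).

(* For open [D]. *)
Fixpoint continuously_differentiable (k : nat) D f : Prop :=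
  match k with
  | 0%N => forall x, D x -> {for x, continuous f}
  | k'.+1 => (forall x, D x -> differentiable f x) /\
             (forall i, continuously_differentiable k' D (partial i f))
  end.

Definition holder_norm (l : R) D f : \bar R :=
  let q := Num.truncn l in
  let mu := l - q%:R in
  let sup_part :=
    ereal_sup [set ereal_sup [set `|mpartial a f x|%:E | x in D]
              | a in [set a | (mlength a <= q)%N]] in
  let holder_part :=
    ereal_sup [set ereal_sup
        [set (`|mpartial a f xy.1 - mpartial a f xy.2|
              / `|xy.1 - xy.2| `^ mu)%:E
        | xy in [set xy : 'rV[R]_m * 'rV[R]_m |
                   [/\ D xy.1, D xy.2 & 0 < `|xy.1 - xy.2| < 1]]]
      | a in [set a | mlength a = q]] in
  (sup_part + holder_part)%E.

Definition holder (l : R) D f : Prop :=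
  continuously_differentiable (Num.truncn l) D f /\
  (holder_norm l D f < +oo)%E.

End Holder.

Section Torus.
Variables (R : realType) (d : nat).
Local Notation V := 'rV[R]_d.

Definition dot (u v : V) : R := \sum_i u 0 i * v 0 i.

Definition of_int (k : 'rV[int]_d) : V := map_mx intr k.

Definition periodic (r : R) (F : V -> V -> R) : Prop :=
  forall theta I (k : 'rV[int]_d), `|I| < r ->
    F (theta + of_int k) I = F theta I.

Definition holder_torus_ball (l r : R) (F : V -> V -> R) : Prop :=
  periodic r F /\
  holder l [set x : 'rV[R]_(d + d) | `|rsubmx x| < r]
    (fun x => F (lsubmx x) (rsubmx x)).

Definition O_I2 (f : V -> V -> R) : Prop :=
  forall theta, f theta 0 = 0 /\ gradient (f theta) 0 = 0.

Definition torus_dist (theta theta' : V) : R :=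
  inf [set `|theta - theta' + of_int k| | k in [set: 'rV[int]_d]].

Definition phase_dist (p p' : V * V) : R :=
  Num.max (torus_dist p.1 p'.1) `|p.2 - p'.2|.

Definition diophantine_const (tau gamma : R) (omega : V) : Prop :=
  forall k : 'rV[int]_d, k != 0 ->
    gamma / (\sum_i `|of_int k 0 i|) `^ tau <= `|dot omega (of_int k)|.

Definition diophantine (tau : R) (omega : V) : Prop :=
  exists2 gamma : R, 0 < gamma & diophantine_const tau gamma omega.

(* [z] solves Hamilton's equations on the open interval ]a, b[ and stays in the
   domain there. *)
Definition hamiltonian_solution (r : R) (H : V -> V -> R) (a b : R)
    (z : R -> V * V) : Prop :=
  forall s, a < s < b ->
    [/\ `|(z s).2| < r,
        is_derive s 1 (fun u => (z u).1) (gradient (H (z s).1) (z s).2) &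
        is_derive s 1 (fun u => (z u).2)
          (- gradient (fun theta => H theta (z s).2) (z s).1)].

Definition flow_rel (r : R) (H : V -> V -> R) (t : R) (p q : V * V) : Prop :=
  exists a b z, [/\ a < 0 < b, a < t < b, hamiltonian_solution r H a b z,
                    z 0 = p & z t = q].

Definition flow_defined r H t p : Prop := exists q, flow_rel r H t p q.

(* Meaningful when [flow_defined r H t p]; for [H] of class C^2 the value is
   then unique.  Otherwise the junk value [p]. *)
Definition flow r H t (p : V * V) : V * V := xget p [set q | flow_rel r H t p q].

End Torus.

(* Main.v *)
Require Import Defs.
From HB Require Import structures.
From mathcomp Require Import all_boot all_order all_algebra.
From mathcomp Require Import all_classical all_reals all_analysis.
From mathcomp Require Import zify ring lra.

Set Implicit Arguments.
Unset Strict Implicit.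
Unset Printing Implicit Defensive.

Import Order.TTheory GRing.Theory Num.Theory.
Import numFieldNormedType.Exports.

Local Open Scope classical_set_scope.
Local Open Scope ring_scope.

(* Write [x = omega . I] and [b = 1 + kap * I_1], the second coordinate of [I]
   being [I_1].  The Hamiltonian is the root [a = H(theta, I)] close to [x / b]
   of [x = a * b - a ^ 2 * phi(theta)], where
   [phi = \sum_n e_n * sin (2 pi k_n . theta)].  On the energy level [a] the
   angles move on straight lines, in the constant direction
   [omega - a * kap * delta_1], whereas the velocity of [I] is
   proportional to [- a ^ 2 * grad phi].
   Here [omega = (1, alpha, ...)] and [k_n = (- p_n, q_n, 0, ...)], where
   [p_n / q_n] are the convergents of [alpha] and [q_(n+1)] is of order
   [q_n ^ tau]; the other coordinates of [omega] are chosen one at a time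
   outside a set of small measure.  On the level [eta_n] at which [k_n] is
   orthogonal to the direction of the angles, the modes [m <> n] have a bounded
   primitive and only make the action oscillate, while the mode [n] makes it
   drift linearly, at a speed fixed by the choice of [e_n]; the decay of [e_n]
   that this leaves is the one that makes [phi], hence [H], of class [C^l].  On
   nearby levels the phase [k_n . theta] grows too slowly to stop the drift. *)

(** The obstacle is that the drift has to last for the whole time [t_n], whereas in general a moving
    action changes the frequency and detunes the resonance. The implicit definition of the energy
    avoids this. Differentiating [x = a * b - a ^ 2 * phi] shows that both components of the
    Hamiltonian vector field carry the same factor [1 / (b - 2 * a * phi)]; once it is removed by a
    change of time, what remains depends on [I] only through the conserved value [a], and the
    equations are solved by quadrature. The coordinate [I_1] in [b] makes the direction of the
    angles depend on [a]: [k_n] is orthogonal to it for [a = (q_n * alpha - p_n) / (kap * q_n)],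
    which is the value [eta_n]. Positive levels thus require convergents that approach [alpha] from
    one side. The terms [a * kap * I_1] and [a ^ 2 * phi] are both of second order in [I]. All
    smallness conditions, on [phi] relative to [rad], [omega] and [kap] and on the levels [eta_n],
    are met together by keeping only the modes from a large index [N] on, since the levels and the
    sum of the amplitudes are then at most a constant times [4 ^- N]. *)

(** * Differential calculus for curves and functions of several variables *)

Lemma is_diff_eps (R : realType) (V W : normedModType R) (f : V -> W) x
    (L : {linear V -> W}) : continuous L ->
  (forall e : R, 0 < e ->
     \forall h \near 0, `|f (h + x) - f x - L h| <= e * `|h|) ->
  is_diff x f L.
Proof.
move=> Lc fL; have fE : f \o shift x = cst (f x) + L +o_ 0 id.
  apply/eqaddoP => e e0; have := fL e e0; apply: filterS => h.
  by rewrite !fctE /= opprD addrA.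
have dL := diff_unique Lc fE.
split => //; apply/diff_locallyP; rewrite dL; split => //.
Qed.

Lemma near_eq_is_diff (R : realType) (V W : normedModType R) (f g : V -> W) x :
  (\near x, f x = g x) -> differentiable f x -> differentiable g x.
Proof.
move=> fg /diff_locallyP[dc df]; suff [] : is_diff x g ('d f x) by [].
apply: is_diff_eps => // e e0.
have /eqaddoP/(_ _ e0) := df.
have : \forall h \near 0, f (h + x) = g (h + x).
  by move: fg; rewrite (near_shift 0 x) subr0.
apply: filterS2 => h fgh.
by rewrite !fctE /= opprD addrA fgh (nbhs_singleton fg).
Qed.

Lemma is_derive_comp (R : realType) (V W : normedModType R) (f : V -> W)
    (z : R -> V) (t : R) (dz : V) :
  is_derive t 1 z dz -> differentiable f (z t) ->
  is_derive t 1 (fun s => f (z s)) ('D_dz f (z t)).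
Proof.
move=> [zd zv] df; have dz' : differentiable z t by apply/derivable1_diffP.
have dfz : differentiable (f \o z) t by exact: differentiable_comp.
split; first exact/derivable1_diffP.
rewrite -[LHS]/('D_1 (f \o z) t) deriveE// diff_comp//= deriveE//.
by rewrite -zv deriveE.
Qed.

Lemma derive_partial (R : realType) m (f : 'rV[R]_m -> R) (x v : 'rV[R]_m) :
  differentiable f x -> 'D_v f x = \sum_i v 0 i * partial i f x.
Proof.
move=> df; rewrite deriveE// [in LHS](row_sum_delta v) linear_sum.
by apply: eq_bigr => i _; rewrite linearZ /partial deriveE.
Qed.

Lemma entry_le_norm (R : realType) m (v : 'rV[R]_m) i : `|v 0 i| <= `|v|.
Proof.
rewrite [leRHS]/Num.Def.normr/= mx_normrE.
by apply: (le_bigmax _ (fun ij => `|v ij.1 ij.2|) (0, i)).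
Qed.

Lemma norm_le_entry (R : realType) m (v : 'rV[R]_m) (C : R) : 0 <= C ->
  (forall i, `|v 0 i| <= C) -> `|v| <= C.
Proof.
move=> C0 vC; rewrite [leLHS]/Num.Def.normr/= mx_normrE (bigmax_le _ C0)//=.
by move=> [i j] _ /=; rewrite ord1.
Qed.

Lemma is_derive_affine (R : realType) (V : normedModType R) (x v : V) (t : R) :
  is_derive t 1 (fun s : R => x + s *: v) v.
Proof.
have H : is_derive t 1 (fun s : R => s *: v) v.
  apply: DeriveDef; first exact/derivable1_diffP.
  by rewrite deriveE// diff_val/= scale1r.
have := is_deriveD (is_derive_cst x t 1) H; rewrite add0r.
by [].
Qed.

Lemma norm_increment_le (R : realType) (g dg : R -> R) (a b C : R) :
  (forall t, Num.min a b <= t <= Num.max a b -> is_derive t 1 g (dg t)) ->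
  (forall t, Num.min a b <= t <= Num.max a b -> `|dg t| <= C) ->
  `|g b - g a| <= C * `|b - a|.
Proof.
wlog ab : a b / a <= b.
  move=> H; have /orP[ab|ba] := le_total a b; first exact: (H _ _ ab).
  by rewrite minC maxC => h1 h2; rewrite distrC (distrC b); exact: H.
rewrite (min_idPl ab) (max_idPr ab) => dgP gC.
have [||t tab ->] := @MVT_segment R g dg a b ab.
- by move=> t /itvP tab; apply: dgP; rewrite !tab.
- apply: derivable_within_continuous => t tab.
  have [] // := dgP t _.
- by rewrite normrM ler_wpM2r// gC.
Qed.

Lemma is_derive_coord (R : realType) m (x v : 'rV[R]_m) i :
  is_derive x v (fun y : 'rV[R]_m => y 0 i) (v 0 i).
Proof.
have H : derivable (@id 'rV[R]_m) x v by exact: derivable_id.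
split; first by have /derivable_mxP/(_ 0 i) := H.
by have := derive_mx H; rewrite derive_id => /matrixP/(_ 0 i); rewrite mxE.
Qed.

(** Restricting to a line turns a directional derivative into a one-variable one, to which the chain
    rule with [Num.sqrt] applies. *)
Lemma is_derive_line (R : realType) (V W : normedModType R) (f : V -> W) x v df :
  is_derive x v f df <-> is_derive (0 : R) 1 (fun h : R => f (h *: v + x)) df.
Proof.
pose g (h : R) := f (h *: v + x).
have E0 : (fun h : R => h^-1 *: ((f \o shift x) (h *: v) - f x)) =
    (fun h : R => h^-1 *: ((g \o shift (0 : R)) (h *: 1) - g 0)).
  by apply/funext => h /=; rewrite /g addr0 scale0r add0r [_%:A]mulr1.
have E : 'D_v f x = 'D_1 g 0 by rewrite /derive E0.
have E' : derivable f x v = derivable g 0 1 by rewrite /derivable E0.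
rewrite -/g; split=> -[d <-]; split; rewrite ?E//; [by rewrite -E'|by rewrite E'].
Qed.

Lemma is_derive_sqrt (R : realType) (V : normedModType R) (f : V -> R) x v df :
  0 < f x -> is_derive x v f df ->
  is_derive x v (fun y => Num.sqrt (f y)) ((2 * Num.sqrt (f x))^-1 * df).
Proof.
move=> fx0 /is_derive_line dfx; apply/is_derive_line.
apply: (@is_derive1_comp _ Num.sqrt (fun h : R => f (h *: v + x))) => //.
by rewrite scale0r add0r; exact: is_derive1_sqrt.
Qed.

Lemma differentiable_sqrt (R : realType) (V : normedModType R) (f : V -> R) x :
  0 < f x -> differentiable f x -> differentiable (fun y => Num.sqrt (f y)) x.
Proof.
move=> fx0 fd; apply: (@differentiable_comp _ _ _ _ f Num.sqrt) => //.
by apply/derivable1_diffP; have [] := is_derive1_sqrt fx0.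
Qed.

Lemma is_derive_entry (R : realType) m (z : R -> 'rV[R]_m) (t : R) dz i :
  is_derive t 1 z dz -> is_derive t 1 (fun s => z s 0 i) (dz 0 i).
Proof.
move=> dzP; have [_ cE] := is_derive_coord (z t) dz i.
have dc : differentiable (fun y : 'rV[R]_m => y 0 i) (z t).
  exact: differentiable_coord.
by have := is_derive_comp dzP dc; rewrite cE.
Qed.

Lemma exists_primitive (R : realType) (g : R -> R) (S : R) :
  (forall t, `|t| <= S -> {for t, continuous g}) -> 0 < S -> exists G : R -> R, G 0 = 0 /\
    forall t : R, `|t| < S -> is_derive t 1 G (g t).
Proof.
move=> gc S0; pose mu := @lebesgue_measure R.
pose F x := (\int[mu]_(t in [set` `[(- S), x]]) (g t))%R.
exists (fun x => F x - F 0); split; first by rewrite subrr.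
move=> t; rewrite ltr_norml => /andP[t1 t2].
have gi : mu.-integrable `[(- S), S] (EFin \o g).
  apply: continuous_compact_integrable; first exact: segment_compact.
  apply: continuous_in_subspaceT => r; rewrite inE/= in_itv/= => rS.
  by apply: gc; rewrite ler_norml.
have gt : {for t, continuous g} by apply: gc; rewrite ler_norml !ltW.
have [Fd Fv] := continuous_FTC1_closed t2 gi t1 gt.
have dF : is_derive t 1 F (g t) by split; [exact: Fd|rewrite -derive1E].
by have := is_deriveB dF (is_derive_cst (F 0) t 1); rewrite subr0.
Qed.

Lemma is_derive_scale_comp (R : realType) (V : normedModType R) (f : R -> V)
    (g : R -> R) (t c : R) (df : V) :
  is_derive (g t) 1 f df -> is_derive t 1 g c ->
  is_derive t 1 (fun r => f (g r)) (c *: df).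
Proof.
move=> [fd fv] gP; have fdd : differentiable f (g t) by exact/derivable1_diffP.
have := is_derive_comp gP fdd; congr is_derive.
by rewrite deriveE// -fv deriveE// -linearZ/= [_ *: 1]mulr1.
Qed.

(** Serves to pass from the auxiliary time of the explicit orbits to physical time. [xget] picks a
    preimage, which strict monotonicity of [T] makes unique. *)
Lemma exists_inverse (R : realType) (T dT : R -> R) (S : R) : 0 < S ->
  (forall t : R, `|t| <= S -> is_derive t 1 T (dT t)) ->
  (forall t : R, `|t| <= S -> 0 < dT t) ->
  exists g : R -> R, forall r : R, T (- S) < r < T S ->
    [/\ `|g r| < S, T (g r) = r & is_derive r 1 g (dT (g r))^-1].
Proof.
move=> S0 TP dT0.
have Tc (t : R) : `|t| <= S -> {for t, continuous T}.
  move=> /TP[d _]; exact/differentiable_continuous/derivable1_diffP.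
have Tinc (x y : R) : - S <= x -> x < y -> y <= S -> T x < T y.
  move=> Sx xy yS.
  have inS (t : R) : x <= t <= y -> `|t| <= S.
    by move=> /andP[t1 t2]; rewrite ler_norml; apply/andP; split; lra.
  have [||t] := @MVT _ T dT x y xy.
  - by move=> t; rewrite in_itv/= => /andP[t1 t2]; apply/TP/inS; rewrite !ltW.
  - apply: derivable_within_continuous => t; rewrite in_itv/= => txy.
    by have [] := TP t (inS _ txy).
  rewrite in_itv/= => /andP[t1 t2] E; rewrite -subr_gt0 E mulr_gt0 ?subr_gt0//.
  by apply/dT0/inS; rewrite !ltW.
pose g (r : R) := xget 0 [set t | `|t| <= S /\ T t = r].
have SS : - S <= S by lra.
have gP (r : R) : T (- S) <= r <= T S -> `|g r| <= S /\ T (g r) = r.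
  move=> rT.
  have TSS : T (- S) <= T S by apply: ltW; apply: Tinc => //; lra.
  have Tw : {within `[- S, S], continuous T}.
    apply: continuous_in_subspaceT => t; rewrite inE/= in_itv/= => tS.
    by apply: Tc; rewrite ler_norml.
  have [|t] := IVT (v := r) SS Tw; first by rewrite (min_idPl TSS) (max_idPr TSS).
  rewrite in_itv/= => tS tr.
  have : [set t | `|t| <= S /\ T t = r] (g r).
    by apply: xgetPex; exists t; split => //; rewrite ler_norml.
  by [].
exists g => r /andP[r1 r2].
have /gP[gS Tg] : T (- S) <= r <= T S by rewrite !ltW.
have gSlt : `|g r| < S.
  rewrite lt_neqAle gS andbT; apply/negP => /eqP E.
  move: r1 r2; rewrite -Tg; have [g0|g0] := leP 0 (g r).
    by rewrite -(ger0_norm g0) E ltxx.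
  have -> : g r = - S by rewrite -E ltr0_norm// opprK.
  by rewrite ltxx.
split => //; rewrite -{1}Tg.
have nS : \forall t \near g r, `|t| < S.
  have : ball 0 S (g r) by rewrite -ball_normE /= sub0r normrN.
  move=> H; have : nbhs (g r) (ball (0 : R) S).
    by apply: open_nbhs_nbhs; split => //; exact: ball_open.
  by apply: filterS => t; rewrite -ball_normE /= sub0r normrN.
apply: is_derive_inverse.
- apply: filterS nS => t tS; have tS' := tS.
  move: tS'; rewrite ltr_norml => /andP[t1 t2].
  have /gP[g1 g2] : T (- S) <= T t <= T S.
    by apply/andP; split; apply: ltW; apply: Tinc => //; lra.
  move: g1; rewrite ler_norml => /andP[g3 g4].
  have [h|h|//] := ltgtP (g (T t)) t.
    by have := Tinc _ _ g3 h (ltW t2); rewrite g2 ltxx.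
  by have := Tinc _ _ (ltW t1) h g4; rewrite g2 ltxx.
- by apply: filterS nS => t tS; apply: Tc; exact: ltW.
- exact: TP.
- by rewrite gt_eqF// dT0.
Qed.

Lemma is_derive_row (R : realType) m (z : R -> 'rV[R]_m) (t : R)
    (dz : 'rV[R]_m) :
  (forall i, is_derive t 1 (fun s => z s 0 i) (dz 0 i)) -> is_derive t 1 z dz.
Proof.
move=> zP; have zd : derivable z t 1.
  by apply/derivable_mxP => i j; rewrite ord1; have [] := zP j.
split => //; rewrite derive_mx//; apply/rowP => i; rewrite mxE.
by have [] := zP i.
Qed.

Lemma is_derive_dot (R : realType) m (v : 'rV[R]_m) (z : R -> 'rV[R]_m) (t : R)
    dz :
  is_derive t 1 z dz -> is_derive t 1 (fun s => dot v (z s)) (dot v dz).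
Proof.
move=> zP; have H i := is_deriveZ (v 0 i) (is_derive_entry i zP).
have := is_derive_sum H; congr is_derive.
by apply/funext => y; rewrite fct_sumE.
Qed.

(** * Hoelder classes *)

Section HolderClass.
Variables (R : realType) (m : nat) (D : set 'rV[R]_m) (mu : R).
Hypothesis D_open : open D.
Hypothesis D_convex : forall x y (t : R), D x -> D y -> 0 <= t <= 1 ->
  D (x + t *: (y - x)).
Hypotheses (mu_gt0 : 0 < mu) (mu_le1 : mu <= 1).
Implicit Types f g : 'rV[R]_m -> R.

Definition bounded_on_dom f := exists C : R, forall x, D x -> `|f x| <= C.

Definition locally_holder f := exists C : R, forall x y, D x -> D y ->
  `|x - y| < 1 -> `|f x - f y| <= C * `|x - y| `^ mu.

(** Recursive in the order, like [continuously_differentiable], so that closure under products,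
    inverses and square roots goes by induction. The exponent [mu] is positive and may exceed the
    fractional part of [l]: for an integer [l] that part is 0 and would not give continuity of the
    top derivatives. *)
Fixpoint holder_class k f : Prop :=
  match k with
  | 0%N => bounded_on_dom f /\ locally_holder f
  | k'.+1 => [/\ forall x, D x -> differentiable f x, bounded_on_dom f &
                 forall i, holder_class k' (partial i f)]
  end.

Lemma near_dom x (P : 'rV[R]_m -> Prop) :
  D x -> (forall y, D y -> P y) -> \forall y \near x, P y.
Proof.
move=> Dx DP; have : nbhs x D by exact: open_nbhs_nbhs.
by apply: filterS.
Qed.

Lemma eq_partial_dom i f g : (forall x, D x -> f x = g x) ->
  forall x, D x -> partial i f x = partial i g x.
Proof. by move=> fg x Dx; apply: near_eq_derive; exact: near_dom. Qed.

Lemma eq_differentiable_dom f g x : (forall x, D x -> f x = g x) -> D x ->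
  differentiable f x -> differentiable g x.
Proof. by move=> fg Dx; apply: near_eq_is_diff; exact: near_dom. Qed.

Lemma eq_holder_class k f g : (forall x, D x -> f x = g x) ->
  holder_class k f -> holder_class k g.
Proof.
have bndE f1 g1 : (forall x, D x -> f1 x = g1 x) ->
    bounded_on_dom f1 -> bounded_on_dom g1.
  by move=> fg [C fC]; exists C => x Dx; rewrite -fg// fC.
elim: k f g => [|k IH] f g fg /=.
  move=> [fb [C fC]]; split; first exact: bndE fg fb.
  by exists C => x y Dx Dy xy; rewrite -!fg// fC.
move=> [fd fb fp]; split; first by move=> x Dx; apply: eq_differentiable_dom (fd _ Dx).
  exact: bndE fg fb.
by move=> i; apply: IH (fp i) => x Dx; exact: eq_partial_dom.
Qed.

(** Mean value theorem along the segment supplied by [D_convex]; at distances below 1, [|x - y|] is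
    at most [|x - y| ^ mu]. *)
Lemma bounded_partial_locally_holder f :
  (forall x, D x -> differentiable f x) ->
  (forall i, bounded_on_dom (partial i f)) -> locally_holder f.
Proof.
move=> fd /choice[C fC].
exists (\sum_i `|C i|) => x y Dx Dy xy.
have Dt (t : R) : 0 <= t <= 1 -> D (x + t *: (y - x)) by exact: D_convex.
have := @norm_increment_le R (fun t => f (x + t *: (y - x)))
  (fun t => 'D_(y - x) f (x + t *: (y - x))) 0 1 ((\sum_i `|C i|) * `|y - x|).
rewrite (min_idPl ler01) (max_idPr ler01) scale1r scale0r addr0 subrKC subr0.
rewrite normr1 mulr1 [`|f x - f y|]distrC [`|x - y|]distrC => h; apply: le_trans (h _ _) _.
- move=> t t01; apply: is_derive_comp; last exact/fd/Dt.
  exact: is_derive_affine.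
- move=> t t01; rewrite derive_partial; last exact/fd/Dt.
  apply: le_trans (ler_norm_sum _ _ _) _; rewrite mulr_suml.
  apply: ler_sum => i _; rewrite normrM [leLHS]mulrC ler_pM//.
    by apply: le_trans (fC _ _ _) (ler_norm _); exact: Dt.
  exact: entry_le_norm.
apply: ler_wpM2l; first by apply: sumr_ge0.
have [->|xy0] := eqVneq `|y - x| 0; first exact: powR_ge0.
by apply: ger1_powR => //; rewrite lt0r xy0 normr_ge0/= distrC ltW.
Qed.

Lemma holder_classW k f : holder_class k.+1 f -> holder_class k f.
Proof.
elim: k f => [|k IH] f.
  move=> [fd fb fp]; split => //; apply: bounded_partial_locally_holder => // i.
  by have [] := fp i.
by move=> [fd fb fp]; split => // i; exact/IH/fp.
Qed.

Lemma bounded_on_domD f g : bounded_on_dom f -> bounded_on_dom g ->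
  bounded_on_dom (fun x => f x + g x).
Proof.
move=> [C fC] [C' gC]; exists (C + C') => x Dx.
by apply: le_trans (ler_normD _ _) _; rewrite lerD ?fC ?gC.
Qed.

Lemma bounded_on_domM f g : bounded_on_dom f -> bounded_on_dom g ->
  bounded_on_dom (fun x => f x * g x).
Proof.
move=> [C fC] [C' gC]; exists (C * C') => x Dx.
by rewrite normrM ler_pM ?fC ?gC.
Qed.

Lemma holder_class_cst k (c : R) : holder_class k (fun=> c).
Proof.
elim: k c => [|k IH] c /=.
  split; first by exists `|c| => x _.
  by exists 0 => x y _ _ _; rewrite subrr normr0 mul0r.
split => [x _||i]; [exact: differentiable_cst|by exists `|c| => x _|].
by apply: eq_holder_class (IH 0) => x _; rewrite /partial derive_cst.
Qed.

Lemma holder_classD k f g : holder_class k f -> holder_class k g ->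
  holder_class k (fun x => f x + g x).
Proof.
elim: k f g => [|k IH] f g /=.
  move=> [fb [C fC]] [gb [C' gC]]; split; first exact: bounded_on_domD.
  exists (C + C') => x y Dx Dy xy; rewrite opprD addrACA.
  by apply: le_trans (ler_normD _ _) _; rewrite mulrDl lerD ?fC ?gC.
move=> [fd fb fp] [gd gb gp]; split.
- by move=> x Dx; apply: differentiableD; [exact: fd|exact: gd].
- exact: bounded_on_domD.
move=> i; apply: eq_holder_class (IH _ _ (fp i) (gp i)) => x Dx.
rewrite /partial -[RHS]/('D__ (f \+ g) x) deriveD//; apply: diff_derivable;
  [exact: fd|exact: gd].
Qed.

Lemma holder_classM k f g : holder_class k f -> holder_class k g ->
  holder_class k (fun x => f x * g x).
Proof.
elim: k f g => [|k IH] f g.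
  move=> [fb [C fC]] [gb [C' gC]]; split; first exact: bounded_on_domM.
  have [[Cf fCf] [Cg gCg]] := (fb, gb).
  exists (Cf * C' + C * Cg) => x y Dx Dy xy.
  have -> : f x * g x - f y * g y = f x * (g x - g y) + (f x - f y) * g y by ring.
  apply: le_trans (ler_normD _ _) _; rewrite [leRHS]mulrDl lerD// normrM.
    by rewrite -mulrA ler_pM ?fCf ?gC.
  by rewrite mulrAC ler_pM ?gCg ?fC.
move=> fk gk; have [fd fb fp] := fk; have [gd gb gp] := gk; split.
- by move=> x Dx; apply: differentiableM; [exact: fd|exact: gd].
- exact: bounded_on_domM.
move=> i; apply: eq_holder_class (holder_classD (IH _ _ (holder_classW fk) (gp i))
  (IH _ _ (fp i) (holder_classW gk))) => x Dx.
rewrite /partial -[RHS]/('D__ (f \* g) x) deriveM; last 2 first.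
- by apply: diff_derivable; exact: fd.
- by apply: diff_derivable; exact: gd.
by congr (_ + _); rewrite [LHS]mulrC.
Qed.

Lemma holder_classV k f (c : R) : 0 < c -> (forall x, D x -> c <= f x) ->
  holder_class k f -> holder_class k (fun x => (f x)^-1).
Proof.
move=> c0 cf.
have f0 x : D x -> 0 < f x by move=> /cf; exact: lt_le_trans.
have bV : bounded_on_dom (fun x => (f x)^-1).
  exists c^-1 => x Dx; rewrite normfV gtr0_norm ?f0//.
  by rewrite lef_pV2 ?posrE ?f0// cf.
elim: k => [|k IH] fk; first split => //.
  have [_ [C fC]] := fk; exists (C * c^-1 ^+ 2) => x y Dx Dy xy.
  have -> : (f x)^-1 - (f y)^-1 = - ((f x - f y) * ((f x)^-1 * (f y)^-1)).
    by field; rewrite !gt_eqF ?f0.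
  rewrite normrN normrM mulrAC ler_pM ?fC// normrM !normfV expr2.
  by rewrite ler_pM// gtr0_norm ?f0// lef_pV2 ?posrE ?f0// cf.
have [fd fb fp] := fk; have Vk := IH (holder_classW fk).
split => //.
  by move=> x Dx; apply: differentiableV; rewrite ?gt_eqF ?f0//; exact: fd.
move=> i; apply: eq_holder_class (holder_classM (holder_class_cst k (-1))
  (holder_classM (holder_classM Vk Vk) (fp i))) => x Dx.
rewrite /partial deriveV; last 2 first.
- by rewrite gt_eqF ?f0.
- by apply: diff_derivable; exact: fd.
by rewrite mulN1r -invfM -expr2 -mulNr.
Qed.

(** The derivative [f' / (2 * sqrt f)] involves [sqrt f] at one order less, which is the induction
    hypothesis. At order 0 the difference of the roots is rationalised. *)
Lemma holder_class_sqrt k f (c : R) : 0 < c -> (forall x, D x -> c <= f x) ->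
  holder_class k f -> holder_class k (fun x => Num.sqrt (f x)).
Proof.
move=> c0 cf.
have f0 x : D x -> 0 < f x by move=> /cf; exact: lt_le_trans.
have sc x : D x -> Num.sqrt c <= Num.sqrt (f x).
  by move=> Dx; apply: ler_wsqrtr; exact: cf.
have sc0 : 0 < Num.sqrt c by rewrite sqrtr_gt0.
have bS : bounded_on_dom f -> bounded_on_dom (fun x => Num.sqrt (f x)).
  move=> [C fC]; exists (Num.sqrt C) => x Dx.
  have fxC : f x <= C by apply: le_trans (fC _ Dx); exact: ler_norm.
  by rewrite ger0_norm ?sqrtr_ge0//; apply: ler_wsqrtr.
elim: k => [|k IH] fk.
  have [fb [C fC]] := fk; split; first exact: bS.
  exists (C * (Num.sqrt c)^-1) => x y Dx Dy xy.
  have sp z : D z -> 0 < Num.sqrt (f z) by move=> Dz; rewrite sqrtr_gt0 f0.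
  have -> : Num.sqrt (f x) - Num.sqrt (f y) =
      (f x - f y) * (Num.sqrt (f x) + Num.sqrt (f y))^-1.
    rewrite -{2}(sqr_sqrtr (ltW (f0 _ Dx))) -{2}(sqr_sqrtr (ltW (f0 _ Dy))).
    by field; rewrite gt_eqF// addr_gt0 ?sp.
  rewrite normrM mulrAC ler_pM ?fC// normfV gtr0_norm ?addr_gt0 ?sp//.
  rewrite lef_pV2 ?posrE ?addr_gt0 ?sp//.
  by apply: le_trans (sc _ Dx) _; rewrite lerDl sqrtr_ge0.
have [fd fb fp] := fk; have Sk := IH (holder_classW fk).
split; first 2 last.
- move=> i; apply: eq_holder_class (holder_classM (fp i)
    (holder_classV (mulr_gt0 (ltr0n _ 2) sc0) _
      (holder_classM (holder_class_cst k 2%:R) Sk))) => [x Dx|x Dx].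
    have fdi : is_derive x 'e_i f (partial i f x).
      by apply/derivableP/diff_derivable/fd.
    have [_ E] := is_derive_sqrt (f0 _ Dx) fdi; rewrite [RHS]E; exact: mulrC.
  by rewrite ler_wpM2l ?sc.
- by move=> x Dx; apply: differentiable_sqrt; [exact: f0|exact: fd].
- exact: bS.
Qed.

Lemma holder_class_coord k i : bounded_on_dom (fun x : 'rV[R]_m => x 0 i) ->
  holder_class k (fun x => x 0 i).
Proof.
move=> xb; apply: holder_classW; split => //.
  by move=> x _; exact: differentiable_coord.
move=> j; have -> : partial j (fun x : 'rV[R]_m => x 0 i) = fun=> (delta_mx 0 j : 'rV[R]_m) 0 i.
  by apply/funext => x; rewrite /partial; have [] := is_derive_coord x (delta_mx 0 j) i.
exact: holder_class_cst.
Qed.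

Lemma holder_class_sum k n (F : 'I_n -> 'rV[R]_m -> R) :
  (forall i, holder_class k (F i)) -> holder_class k (fun x => \sum_i F i x).
Proof.
elim: n F => [|n IH] F FH.
  apply: eq_holder_class (holder_class_cst k 0) => x _.
  by rewrite big_ord0.
apply: eq_holder_class (holder_classD (FH ord0) (IH (fun i => F (lift ord0 i)) _)).
  by move=> x _; rewrite big_ord_recl.
by move=> i; exact: FH.
Qed.

Lemma holder_class_continuously_differentiable k f :
  holder_class k f -> continuously_differentiable k D f.
Proof.
elim: k f => [|k IH] f.
  move=> [_ [C fC]] x Dx; suff : f y @[y --> x] --> f x by [].
  apply/(@cvgrPdist_le _ _ _ _ (nbhs_filter x)) => e e0.
  pose C' := `|C| + 1; have C0 : 0 < C' by rewrite ltr_wpDl.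
  pose del := Num.min 1 ((e / C') `^ mu^-1).
  have del0 : 0 < del by rewrite lt_min ltr01 powR_gt0// divr_gt0.
  have Dn : nbhs x D by exact: open_nbhs_nbhs.
  near=> y.
  have Dy : D y by near: y.
  have xy : `|x - y| < del.
    suff : ball x del y by rewrite -ball_normE.
    by near: y; exact: nbhsx_ballx.
  move: xy; rewrite lt_min => /andP[xy1 xy].
  apply: le_trans (fC _ _ Dx Dy xy1) _.
  apply: (@le_trans _ _ (C' * `|x - y| `^ mu)).
    by rewrite ler_wpM2r ?powR_ge0// ler_wpDr// ler_norm.
  rewrite -ler_pdivlMl// mulrC.
  have -> : e / C' = ((e / C') `^ mu^-1) `^ mu.
    by rewrite -powRrM mulVf ?gt_eqF// powRr1// ltW// divr_gt0.
  by rewrite ge0_ler_powR ?nnegrE ?powR_ge0// ltW.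
move=> [fd fb fp]; split => // i; exact/IH/fp.
Unshelve. all: by end_near. Qed.

(** A single constant for all derivatives, because the suprema of [holder_norm] range over all
    multi-indices at once. *)
Fixpoint holder_bound k (C : R) f : Prop :=
  match k with
  | 0%N => (forall x, D x -> `|f x| <= C) /\
      (forall x y, D x -> D y -> `|x - y| < 1 ->
         `|f x - f y| <= C * `|x - y| `^ mu)
  | k'.+1 => (forall x, D x -> `|f x| <= C) /\
             (forall i, holder_bound k' C (partial i f))
  end.

Lemma holder_bound_le k (C C' : R) f : C <= C' ->
  holder_bound k C f -> holder_bound k C' f.
Proof.
move=> CC; elim: k f => [|k IH] f [fb fH]; split => //.
- by move=> x /fb /le_trans; apply.
- move=> x y Dx Dy /(fH _ _ Dx Dy) /le_trans; apply.
  by rewrite ler_wpM2r// powR_ge0.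
- by move=> x /fb /le_trans; apply.
- by move=> i; exact/IH/fH.
Qed.

Lemma holder_class_bound k f : holder_class k f -> exists C, holder_bound k C f.
Proof.
elim: k f => [|k IH] f.
  move=> [[C fC] [C' fC']]; exists (Num.max C C'); split => [x|x y].
    by move=> /fC fx; rewrite le_max fx.
  move=> Dx Dy /(fC' _ _ Dx Dy)/le_trans; apply.
  by rewrite ler_wpM2r ?powR_ge0// le_max lexx orbT.
move=> [fd [C fC] fp].
have /choice[Cp fCp] : forall i, exists C, holder_bound k C (partial i f).
  by move=> i; exact/IH/fp.
exists (\big[Num.max/C]_i Cp i); split => [x|i].
  by move=> /fC /le_trans; apply; exact: bigmax_ge_id.
by apply: holder_bound_le (fCp i); exact: le_bigmax.
Qed.

Lemma holder_bound_mpartial k (C : R) (a : {ffun 'I_m -> nat}) f :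
  (mlength a <= k)%N -> holder_bound k C f ->
  holder_bound (k - mlength a) C (mpartial a f).
Proof.
rewrite /mlength /mpartial -big_enum/=.
elim: (enum 'I_m) => [|i s IH]; first by rewrite big_nil subn0.
rewrite big_cons => ak fk /=.
have {}IH := IH (leq_trans (leq_addl _ _) ak) fk.
have : (a i <= k - \sum_(j <- s) a j)%N by rewrite leq_subRL ?(leq_trans (leq_addl _ _) ak)// addnC.
rewrite addnC subnDA; move: IH; move: (k - _)%N => j.
move: (foldr _ _ _) => g.
elim: (a i) j => [|n IHn] j gj nj; first by rewrite subn0.
have := IHn _ gj (ltnW nj).
have -> : (j - n = (j - n.+1).+1)%N by rewrite subnSK.
by move=> [_ /(_ i)].
Qed.

(** At distances below 1 a larger Hoelder exponent gives the stronger estimate, so it suffices that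
    [mu] dominates the fractional part of [l]. *)
Lemma holder_class_holder (l : R) f : 0 <= l - (Num.truncn l)%:R <= mu ->
  holder_class (Num.truncn l) f -> holder l D f.
Proof.
move=> /andP[l0 lmu] fk; split; first exact: holder_class_continuously_differentiable.
have [C fC] := holder_class_bound fk.
rewrite /holder_norm; apply: lte_add_pinfty.
  apply: (@le_lt_trans _ _ C%:E); last exact: ltry.
  apply: ge_ereal_sup => _ [a /= aq <-]; apply: ge_ereal_sup => _ [x Dx <-].
  rewrite lee_fin; have := holder_bound_mpartial aq fC.
  by case: (_ - _)%N => [|n] [+ _]; apply.
apply: (@le_lt_trans _ _ C%:E); last exact: ltry.
apply: ge_ereal_sup => _ [a /= aq <-]; apply: ge_ereal_sup => _ [[x y] /= [Dx Dy /andP[xy0 xy1]] <-].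
rewrite lee_fin ler_pdivrMr ?powR_gt0//.
have aq' : (mlength a <= Num.truncn l)%N by rewrite aq.
have := holder_bound_mpartial aq' fC; rewrite aq subnn => -[fb /(_ _ _ Dx Dy xy1)].
move=> /le_trans; apply; rewrite ler_wpM2l//.
  by apply: le_trans (fb _ Dx).
by rewrite ger_powR// xy0 ltW.
Qed.

End HolderClass.

Lemma linear_rV_continuous (R : realType) m (L : {linear 'rV[R]_m -> R}) :
  continuous L.
Proof.
move=> x; suff : L y @[y --> x] --> L x by [].
pose C : R := \sum_i `|L (delta_mx 0 i)| + 1.
have C0 : 0 < C by rewrite ltr_wpDl// sumr_ge0.
apply/(@cvgrPdist_le _ _ _ _ (nbhs_filter x)) => e e0; near=> y.
have xy : `|x - y| < e / C.
  suff : ball x (e / C) y by rewrite -ball_normE.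
  by near: y; apply: nbhsx_ballx; exact: divr_gt0.
apply: (@le_trans _ _ (C * `|x - y|)); last first.
  by rewrite mulrC -ler_pdivlMr// ltW.
rewrite -linearB [X in L X](row_sum_delta (x - y)) linear_sum.
apply: le_trans (ler_norm_sum _ _ _) _.
apply: (@le_trans _ _ ((\sum_i `|L (delta_mx 0 i)|) * `|x - y|)).
  rewrite mulr_suml; apply: ler_sum => i _.
  by rewrite linearZ normrM mulrC ler_wpM2l// entry_le_norm.
by rewrite ler_wpM2r// lerDl.
Unshelve. all: by end_near. Qed.

(** * Trigonometric series *)

Section Series.
Variable R : realType.
Implicit Types u v : nat -> R.

Definition tsum u : R := limn (series u).
Definition abs_summable u := cvgn (series (fun n => `|u n|)).

Lemma abs_summable_cvg u : abs_summable u -> cvgn (series u).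
Proof. by move=> su; apply: normed_cvg. Qed.

Lemma abs_summable_le u v : (forall n, `|u n| <= v n) -> cvgn (series v) ->
  abs_summable u.
Proof.
move=> uv sv; apply: series_le_cvg sv => // n.
by apply: le_trans (uv n).
Qed.

Lemma tsum_le u v : (forall n, `|u n| <= v n) -> cvgn (series v) ->
  `|tsum u| <= tsum v.
Proof.
move=> uv sv; have su := abs_summable_le uv sv.
apply: le_trans (lim_series_norm su) _.
exact: lim_series_le.
Qed.

Lemma tsumD u v : abs_summable u -> abs_summable v ->
  tsum (fun n => u n + v n) = tsum u + tsum v.
Proof.
by move=> /abs_summable_cvg su /abs_summable_cvg sv; exact: lim_seriesD.
Qed.

Lemma tsumB u v : abs_summable u -> abs_summable v ->
  tsum (fun n => u n - v n) = tsum u - tsum v.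
Proof.
by move=> /abs_summable_cvg su /abs_summable_cvg sv; exact: lim_seriesB.
Qed.

Lemma tsumZ (k : R) u : abs_summable u -> tsum (fun n => k * u n) = k * tsum u.
Proof. by move=> /abs_summable_cvg su; exact: (lim_seriesZ k su). Qed.

Lemma abs_summableD u v : abs_summable u -> abs_summable v ->
  abs_summable (fun n => u n + v n).
Proof.
move=> su sv; apply: (abs_summable_le _ (is_cvg_seriesD su sv)) => n.
exact: ler_normD.
Qed.

Lemma abs_summableZ (k : R) u : abs_summable u ->
  abs_summable (fun n => k * u n).
Proof.
move=> su; apply: (abs_summable_le _ (is_cvg_seriesZ (k := `|k|) su)) => n.
by rewrite normrM.
Qed.

Lemma abs_summable_sum m (F : 'I_m -> nat -> R) :
  (forall i, abs_summable (F i)) ->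
  abs_summable (fun n => \sum_i F i n).
Proof.
elim: m F => [|m IH] F FH.
  rewrite (_ : (fun n => _) = fun n => 0 * 0).
    apply: abs_summableZ; rewrite /abs_summable normr0.
    apply/cvg_ex; exists 0; rewrite (_ : series _ = fun=> 0); first exact: cvg_cst.
    by apply/funext => n; rewrite /series/= big1.
  by apply/funext => n; rewrite big_ord0 mul0r.
rewrite (_ : (fun n => _) =
  fun n => F ord0 n + \sum_i F (lift ord0 i) n); last first.
  by apply/funext => n; rewrite big_ord_recl.
by apply: abs_summableD => //; apply: IH.
Qed.

Lemma tsum_sum m (F : 'I_m -> nat -> R) : (forall i, abs_summable (F i)) ->
  tsum (fun n => \sum_i F i n) = \sum_i tsum (F i).
Proof.
elim: m F => [|m IH] F FH.
  rewrite big_ord0 /tsum (_ : series _ = fun=> 0) ?lim_cst//.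
  by apply/funext => n; rewrite /series/= big1// => i _; rewrite big_ord0.
rewrite (_ : (fun n => _) =
  fun n => F ord0 n + \sum_i F (lift ord0 i) n); last first.
  by apply/funext => n; rewrite big_ord_recl.
by rewrite tsumD ?big_ord_recl ?IH//; exact: abs_summable_sum.
Qed.

Lemma tsum_single (n : nat) (X : R) :
  tsum (fun m => if m == n then X else 0) = X.
Proof.
apply: lim_near_cst => //; near=> N.
have nN : (n < N)%N by near: N; exact: nbhs_infty_gt.
rewrite /series/= (bigD1_seq n)/= ?mem_index_iota ?iota_uniq// eqxx big1 ?addr0//.
by move=> m /negbTE ->.
Unshelve. all: by end_near. Qed.

End Series.

(** * Hoelder estimates for sine and cosine *)

Section SinCos.
Variable R : realType.
Implicit Types x y : R.

Lemma sin_lipschitz x y : `|sin y - sin x| <= `|y - x|.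
Proof.
rewrite -[leRHS]mul1r; apply: (@norm_increment_le _ sin cos) => t _.
by rewrite ler_norml cos_geN1 cos_le1.
Qed.

Lemma cos_lipschitz x y : `|cos y - cos x| <= `|y - x|.
Proof.
by have := sin_lipschitz (x + pi / 2) (y + pi / 2); rewrite !sinDpihalf opprD addrACA subrr addr0.
Qed.

(** Interpolates between the two bounds: 2 is the useful one for [a >= 1], and [a] for [a < 1]. *)
Lemma norm_le_holder (s a z : R) : 0 <= s <= 1 -> 0 <= a ->
  `|z| <= 2 -> `|z| <= a -> `|z| <= 2 * a `^ s.
Proof.
move=> /andP[s0 s1] a0 z2 za.
have [a1|a1] := leP 1 a.
  apply: le_trans z2 _; rewrite ler_peMr//.
  have := ge0_ler_powR s0; move/(_ 1 a); rewrite !nnegrE powR1 ler01 a0 => h.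
  exact: h.
apply: le_trans za _; apply: (@le_trans _ _ (a `^ s)).
  have [->|a_neq0] := eqVneq a 0; first exact: powR_ge0.
  by apply: ger1_powR => //; rewrite lt0r a_neq0 a0/= ltW.
by rewrite ler_peMl ?powR_ge0// ler1n.
Qed.

Lemma sin_holder (s x y : R) : 0 <= s <= 1 ->
  `|sin y - sin x| <= 2 * `|y - x| `^ s.
Proof.
move=> s01; apply: norm_le_holder => //; last exact: sin_lipschitz.
apply: le_trans (ler_normB _ _) _; rewrite -[2]/(1 + 1) lerD//.
  by rewrite ler_norml sin_geN1 sin_le1.
by rewrite ler_norml sin_geN1 sin_le1.
Qed.

(** Mean value theorem for [sin t - cos x * t], whose derivative [cos t - cos x] is controlled by
    [sin_holder] after a shift by [pi / 2]. *)
Lemma sin_taylor (s x y : R) : 0 <= s <= 1 ->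
  `|sin y - sin x - cos x * (y - x)| <= 2 * `|y - x| `^ (1 + s).
Proof.
move=> s01; have /andP[s0 s1] := s01.
have -> : sin y - sin x - cos x * (y - x) =
    (sin y - cos x * y) - (sin x - cos x * x) by ring.
have -> : `|y - x| `^ (1 + s) = `|y - x| `^ s * `|y - x|.
  have [->|yx] := eqVneq `|y - x| 0.
    by rewrite mulr0 powR0// gt_eqF// ltr_wpDr.
  by rewrite (addrC 1 s) powRD ?yx ?implybT ?powRr1.
rewrite mulrA; apply: (@norm_increment_le _ (fun t => sin t - cos x * t)
  (fun t => cos t - cos x)) => t txy.
  have dt : is_derive t 1 (fun t => cos x * t) (cos x).
    by apply: is_derive_eq; exact: mulr1.
  exact: (is_deriveB (is_derive_sin t) dt).
have tx : `|t - x| <= `|y - x|.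
  move: txy; case: (leP x y) => [xy|/ltW xy] /andP[t1 t2].
    by rewrite !ger0_norm ?subr_ge0// lerB.
  by rewrite !ler0_norm ?subr_le0// lerN2 lerB.
apply: (@le_trans _ _ (2 * `|t - x| `^ s)).
  have := @sin_holder s (x + pi / 2) (t + pi / 2) s01.
  by rewrite !sinDpihalf opprD addrACA subrr addr0.
by rewrite ler_wpM2l// ge0_ler_powR.
Qed.

End SinCos.

(** * Term-by-term differentiation of trigonometric series *)

Section TrigSeries.
Variables (R : realType) (m : nat) (K : nat -> 'rV[R]_m) (B : nat -> R) (s : R).
Hypotheses (s_gt0 : 0 < s) (s_le1 : s <= 1).
Hypotheses (B_ge1 : forall n, 1 <= B n)
  (KB : forall n, \sum_i `|K n 0 i| <= B n).
Implicit Types (c : nat -> R) (b : R) (x y h : 'rV[R]_m).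

(** The phase [b] makes the family stable under differentiation: a cosine is a sine with phase
    [b + pi / 2]. *)
Definition trig_series c b x : R := tsum (fun n => c n * sin (dot (K n) x + b)).

Lemma dotD (u x y : 'rV[R]_m) : dot u (x + y) = dot u x + dot u y.
Proof.
by rewrite /dot -big_split; apply: eq_bigr => i _; rewrite mxE mulrDr.
Qed.

Lemma dotB (u x y : 'rV[R]_m) : dot u (x - y) = dot u x - dot u y.
Proof. by rewrite -{2}(subrK y x) [dot u (x - y + y)]dotD addrK. Qed.

Lemma dot_le n x : `|dot (K n) x| <= B n * `|x|.
Proof.
apply: le_trans (ler_norm_sum _ _ _) _.
apply: (@le_trans _ _ ((\sum_i `|K n 0 i|) * `|x|)); last by rewrite ler_wpM2r.
rewrite mulr_suml; apply: ler_sum => i _.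
by rewrite normrM ler_wpM2l// entry_le_norm.
Qed.

Lemma norm_mul_sin (a t : R) : `|a * sin t| <= `|a|.
Proof. by rewrite normrM ler_piMr// ler_norml sin_geN1 sin_le1. Qed.

Lemma trig_term_summable c b x : abs_summable c ->
  abs_summable (fun n => c n * sin (dot (K n) x + b)).
Proof.
by move=> sc; apply: (@abs_summable_le _ _ (fun n => `|c n|)) => // n;
  exact: norm_mul_sin.
Qed.

Lemma trig_bounded c b x : abs_summable c ->
  `|trig_series c b x| <= tsum (fun n => `|c n|).
Proof. by move=> sc; apply: tsum_le => // n; exact: norm_mul_sin. Qed.

(** Smoothness of order [p] read on the coefficients: each derivative multiplies the [n]-th one by
    at most [B n]. *)
Definition moment_summable (p : R) c := abs_summable (fun n => c n * B n `^ p).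

Lemma moment_summable_le p p' c : p' <= p -> moment_summable p c ->
  moment_summable p' c.
Proof.
move=> pp; apply: abs_summable_le => n.
by rewrite !normrM ler_wpM2l// !ger0_norm ?powR_ge0// ler_powR.
Qed.

Lemma moment_summable0 p c : 0 <= p -> moment_summable p c -> abs_summable c.
Proof.
move=> p0 /(moment_summable_le p0).
by rewrite /moment_summable; under eq_fun do rewrite powRr0 mulr1.
Qed.

Lemma moment_summable_deriv p c i : moment_summable (1 + p) c ->
  moment_summable p (fun n => c n * K n 0 i).
Proof.
apply: abs_summable_le => n; rewrite !normrM -mulrA ler_wpM2l//.
have B0 : 0 < B n by exact: lt_le_trans (B_ge1 n).
rewrite powRD; last by rewrite (gt_eqF B0) implybT.
rewrite powRr1 ?(ltW B0)// normrM ler_wpM2r//.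
rewrite (gtr0_norm B0); apply: le_trans (KB n).
by rewrite (bigD1 i)//= lerDl sumr_ge0.
Qed.

Lemma trig_holder c b x y : moment_summable s c ->
  `|trig_series c b x - trig_series c b y| <=
    2 * tsum (fun n => `|c n * B n `^ s|) * `|x - y| `^ s.
Proof.
move=> sc; have sc0 := moment_summable0 (ltW s_gt0) sc.
rewrite -tsumB; try exact: trig_term_summable.
have sc' : abs_summable (fun n => `|c n * B n `^ s|).
  by rewrite /abs_summable; under eq_fun do rewrite normr_id.
rewrite mulrAC -tsumZ//.
apply: tsum_le => [n|]; last exact/abs_summable_cvg/abs_summableZ.
rewrite -mulrBr 2!normrM.
apply: (@le_trans _ _ (`|c n| * (2 * `|dot (K n) x + b - (dot (K n) y + b)| `^ s))).
  by rewrite ler_wpM2l//; apply: sin_holder; rewrite ltW.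
rewrite opprD addrACA subrr addr0 -dotB.
rewrite mulrCA -[leRHS]mulrA ler_wpM2l// [leRHS]mulrCA ler_wpM2l//.
rewrite ger0_norm ?powR_ge0// [leRHS]mulrC -powRM//; last exact: le_trans (B_ge1 n).
rewrite ge0_ler_powR ?nnegrE ?(ltW s_gt0) ?dot_le//.
by rewrite mulr_ge0//; exact: le_trans (B_ge1 n).
Qed.

Lemma trig_gradE c b x h : (forall i, abs_summable (fun n => c n * K n 0 i)) ->
  abs_summable (fun n => c n * (cos (dot (K n) x + b) * dot (K n) h)) /\
  \sum_i h 0 i * trig_series (fun n => c n * K n 0 i) (b + pi / 2) x =
    tsum (fun n => c n * (cos (dot (K n) x + b) * dot (K n) h)).
Proof.
move=> sci.
have -> : (fun n => c n * (cos (dot (K n) x + b) * dot (K n) h)) =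
    (fun n => \sum_i h 0 i *
      (c n * K n 0 i * sin (dot (K n) x + (b + pi / 2)))).
  apply/funext => n; rewrite addrA sinDpihalf /dot !mulr_sumr.
  by apply: eq_bigr => i _; ring.
split; first by apply: abs_summable_sum => i; exact/abs_summableZ/trig_term_summable.
rewrite tsum_sum => [|i]; last exact/abs_summableZ/trig_term_summable.
by apply: eq_bigr => i _; rewrite tsumZ//; exact: trig_term_summable.
Qed.

(** Summing [sin_taylor] over the modes bounds the remainder of the whole series; as [1 + s > 1], it
    is small compared with [|h|], which yields differentiability of the sum. *)
Lemma trig_remainder c b x h : moment_summable (1 + s) c ->
  `|trig_series c b (h + x) - trig_series c b x -
    \sum_i h 0 i * trig_series (fun n => c n * K n 0 i) (b + pi / 2) x| <=
  2 * tsum (fun n => `|c n * B n `^ (1 + s)|) * `|h| `^ (1 + s).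
Proof.
move=> sc; have s1 : 0 <= 1 + s by rewrite addr_ge0// ltW.
have sc0 := moment_summable0 s1 sc.
have sci i : abs_summable (fun n => c n * K n 0 i).
  by apply: (@moment_summable0 s); [exact: ltW|exact: moment_summable_deriv].
have [scos ->] := trig_gradE b x h sci.
rewrite -tsumB; try exact: trig_term_summable.
rewrite -tsumB//; last first.
  rewrite /abs_summable; under eq_fun do rewrite -mulN1r.
  by apply: abs_summableD; [|apply: abs_summableZ]; exact: trig_term_summable.
have sc' : abs_summable (fun n => `|c n * B n `^ (1 + s)|).
  by rewrite /abs_summable; under eq_fun do rewrite normr_id.
rewrite mulrAC -tsumZ//.
apply: tsum_le => [n|]; last exact/abs_summable_cvg/abs_summableZ.
rewrite -!mulrBr 2!normrM.
have -> : dot (K n) h = dot (K n) (h + x) + b - (dot (K n) x + b).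
  by rewrite dotD; ring.
apply: (@le_trans _ _ (`|c n| * (2 * `|dot (K n) (h + x) + b - (dot (K n) x + b)| `^ (1 + s)))).
  by rewrite ler_wpM2l//; apply: sin_taylor; rewrite ltW.
rewrite opprD addrACA subrr addr0 -dotB addrK.
rewrite mulrCA -[leRHS]mulrA ler_wpM2l// [leRHS]mulrCA ler_wpM2l//.
rewrite [`|_ `^ _|]ger0_norm ?powR_ge0// [leRHS]mulrC -powRM//; last exact: le_trans (B_ge1 n).
rewrite ge0_ler_powR ?nnegrE ?dot_le//.
by rewrite mulr_ge0//; exact: le_trans (B_ge1 n).
Qed.

Lemma trig_is_diff c b x : moment_summable (1 + s) c ->
  differentiable (trig_series c b) x /\
  forall v, 'D_v (trig_series c b) x =
    \sum_i v 0 i * trig_series (fun n => c n * K n 0 i) (b + pi / 2) x.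
Proof.
move=> sc.
pose L h : R := \sum_i h 0 i * trig_series (fun n => c n * K n 0 i) (b + pi / 2) x.
have Llin : linear L.
  move=> k u v; rewrite /L scaler_sumr -big_split; apply: eq_bigr => i _ /=.
  by rewrite !mxE mulrDl -mulrA.
pose Lm := GRing.isLinear.Build _ _ _ _ L Llin.
pose LL : {linear 'rV[R]_m -> R} := HB.pack L Lm.
suff dL : is_diff x (trig_series c b) LL.
  split; first by case: dL.
  by move=> v; rewrite deriveE; case: dL => // _ ->.
apply: is_diff_eps; first exact: linear_rV_continuous.
move=> e e0; set M := 2 * tsum (fun n => `|c n * B n `^ (1 + s)|).
have M0 : 0 <= M.
  rewrite mulr_ge0// -(normr0 R).
  apply: (@le_trans _ _ `|tsum (fun n => c n * B n `^ (1 + s))|) => //.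
    by rewrite normr0.
  exact: tsum_le.
(* The solution of [(M + 1) * del ^ s = e]. *)
pose del := (e / (M + 1)) `^ s^-1.
have M1 : 0 < M + 1 by rewrite ltr_wpDl.
have del0 : 0 < del by rewrite powR_gt0// divr_gt0.
near=> h.
have hdel : `|h| < del.
  suff : ball 0 del h by rewrite -ball_normE /= sub0r normrN.
  by near: h; exact: nbhsx_ballx.
apply: le_trans (trig_remainder _ _ _ sc) _; rewrite -/M.
have [->|h0] := eqVneq `|h| 0.
  by rewrite powR0 ?mulr0// gt_eqF// ltr_wpDl.
rewrite powRD ?h0 ?implybT// powRr1// mulrCA mulrC ler_wpM2r//.
apply: (@le_trans _ _ ((M + 1) * del `^ s)).
  rewrite ler_pM ?powR_ge0 ?lerDl// ge0_ler_powR ?nnegrE ?(ltW s_gt0)//.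
  - exact: ltW.
rewrite /del -powRrM mulVf ?(gt_eqF s_gt0)// powRr1; last by rewrite divr_ge0 ?(ltW M1) ?ltW.
by rewrite mulrC divfK ?(gt_eqF M1).
Unshelve. all: by end_near. Qed.

Lemma partial_trig c b x i : moment_summable (1 + s) c ->
  partial i (trig_series c b) x =
    trig_series (fun n => c n * K n 0 i) (b + pi / 2) x.
Proof.
move=> sc; rewrite /partial; have [_ ->] := trig_is_diff b x sc.
rewrite (bigD1 i)//= big1 => [|j ji]; last by rewrite mxE/= (negbTE ji) mul0r.
by rewrite mxE !eqxx mul1r addr0.
Qed.

Lemma trig_holder_class (D : set 'rV[R]_m) k c b : open D ->
  (forall x y (t : R), D x -> D y -> 0 <= t <= 1 -> D (x + t *: (y - x))) ->
  moment_summable (k%:R + s) c -> holder_class D s k (trig_series c b).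
Proof.
move=> Dop Dconv; elim: k c b => [|k IH] c b.
  rewrite add0r => sc; split.
    exists (tsum (fun n => `|c n|)) => x _.
    by apply: trig_bounded; exact: (moment_summable0 (ltW s_gt0) sc).
  exists (2 * tsum (fun n => `|c n * B n `^ s|)) => x y _ _ _.
  exact: trig_holder.
rewrite -natr1 -addrAC => sc'.
have sc : moment_summable (1 + (k%:R + s)) c by rewrite addrC.
have sc1 : moment_summable (1 + s) c.
  by apply: moment_summable_le sc; rewrite lerD2l lerDr.
split.
- by move=> x _; have [] := trig_is_diff b x sc1.
- exists (tsum (fun n => `|c n|)) => x _.
  by apply: trig_bounded; apply: moment_summable0 sc; rewrite !addr_ge0// ltW.
move=> i; have := IH (fun n => c n * K n 0 i) (b + pi / 2) (moment_summable_deriv (i := i) sc).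
apply: (eq_holder_class Dop) => x _.
by rewrite partial_trig.
Qed.

End TrigSeries.

(** * Diophantine vectors *)

Section Convergents.
Variables (R : realType) (tau : R).
Hypothesis tau_gt1 : 1 < tau.

(** A partial quotient of order [q ^ (tau - 1)] makes the next denominator of order [q ^ tau].
    Adding 5 makes every denominator at least 4 times the previous one. *)
Let A (q : int) : int := ((Num.truncn ((q%:~R : R) `^ (tau - 1))) + 5)%N.

(** Continued fraction with minus signs. The determinant of consecutive convergents is then always 1
    instead of alternating in sign, so the fractions increase to [calpha] and every
    [q_n * calpha - p_n] is positive. *)
Fixpoint convergents n : (int * int) * (int * int) :=
  match n with
  | 0%N => ((0, 1), (1, 5))
  | n'.+1 => let: (u, v) := convergents n' in
             (v, (A v.2 * v.1 - u.1, A v.2 * v.2 - u.2))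
  end.

Definition cnum n := (convergents n).1.1.
Definition cden n := (convergents n).1.2.

Lemma convergentsE n :
  convergents n = ((cnum n, cden n), (cnum n.+1, cden n.+1)).
Proof. by rewrite /cnum /cden /=; case: (convergents n) => [[? ?] [? ?]]. Qed.

Lemma cnumSS n : cnum n.+2 = A (cden n.+1) * cnum n.+1 - cnum n.
Proof. by rewrite {1}/cnum /= convergentsE. Qed.

Lemma cdenSS n : cden n.+2 = A (cden n.+1) * cden n.+1 - cden n.
Proof. by rewrite {1}/cden /= convergentsE. Qed.

Lemma A_ge5 q : 5 <= A q.
Proof. by rewrite lez_nat leq_addl. Qed.

Lemma cden_gt0_ge4 n : 0 < cden n /\ 4 * cden n <= cden n.+1.
Proof.
elim: n => [|n [q0 q4]]; first by [].
have q1 : 0 < cden n.+1 by lia.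
split => //; rewrite cdenSS.
have : 5 * cden n.+1 <= A (cden n.+1) * cden n.+1.
  by rewrite ler_wpM2r ?A_ge5// ltW.
lia.
Qed.

Lemma cden_gt0 n : 0 < cden n. Proof. by have [] := cden_gt0_ge4 n. Qed.
Lemma cden_ge4 n : 4 * cden n <= cden n.+1.
Proof. by have [] := cden_gt0_ge4 n. Qed.

Lemma convergents_det n : cnum n.+1 * cden n - cnum n * cden n.+1 = 1.
Proof.
elim: n => [|n IH] //; rewrite cnumSS cdenSS -[RHS]IH; ring.
Qed.

Local Notation qR n := ((cden n)%:~R : R).
Local Notation pR n := ((cnum n)%:~R : R).

Lemma qR_ge1 n : 1 <= qR n.
Proof. by rewrite -[1]/(1%:~R) ler_int; have := cden_gt0 n; lia. Qed.

Lemma qR_gt0 n : 0 < qR n. Proof. exact: lt_le_trans (qR_ge1 n). Qed.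

Lemma qR_ge4 n : 4 * qR n <= qR n.+1.
Proof. by rewrite -[4]/(4%:~R) -intrM ler_int cden_ge4. Qed.

Lemma qR_powS n : qR n `^ tau = qR n `^ (tau - 1) * qR n.
Proof.
by rewrite -{3}(powRr1 (ltW (qR_gt0 n))) -powRD ?subrK// (gt_eqF (qR_gt0 n)) implybT.
Qed.

(** With [t = q ^ (tau - 1) >= 1], the partial quotient is at most [t + 5 <= 6 * t], whence the 6.
    It also exceeds [t + 4], and the excess absorbs the subtracted denominator. *)
Lemma qR_growth n : qR n `^ tau <= qR n.+1 <= 6 * qR n `^ tau.
Proof.
case: n => [|n].
  have -> : qR 0 = 1 by []. have -> : qR 1 = 5%:R by [].
  by rewrite powR1; lra.
rewrite cdenSS intrB intrM qR_powS.
have q1 := qR_ge1 n.+1; have q0 := qR_gt0 n; have q4 := qR_ge4 n.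
have P1 : 1 <= qR n.+1 `^ (tau - 1).
  have := @ler_powR R _ q1 0 (tau - 1).
  by rewrite powRr0; apply; rewrite subr_ge0 ltW.
have /andP[] := truncn_itv (le_trans ler01 P1).
rewrite /A; set t := Num.truncn _; set P := _ `^ _ in P1 *.
move=> tP Pt; rewrite -pmulrn natrD; move: Pt; rewrite -natr1 => Pt.
move: (qR n.+1) (qR n) q1 q0 q4 => a b a1 b0 ba.
by apply/andP; split; nra.
Qed.

Let r n := pR n / qR n.

Lemma ratio_step n : r n.+1 - r n = (qR n * qR n.+1)^-1.
Proof.
have := convergents_det n => /(congr1 (fun z => z%:~R : R)).
rewrite intrB !intrM => H; rewrite /r.
have -> : pR n.+1 / qR n.+1 - pR n / qR n =
    (pR n.+1 * qR n - pR n * qR n.+1) / (qR n * qR n.+1).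
  by field; rewrite !gt_eqF ?qR_gt0.
by rewrite H div1r.
Qed.

(** A step increases the ratio by [1 / (q_m * q_(m+1))], while the correction term becomes at least
    16 times smaller because the denominators grow by a factor 4 each; hence these upper bounds
    decrease. *)
Lemma ratio_upper n m : (n <= m)%N ->
  r m + 2 / (qR m * qR m.+1) <= r n + 2 / (qR n * qR n.+1).
Proof.
elim: m => [|m IH]; first by rewrite leqn0 => /eqP ->.
rewrite leq_eqVlt => /predU1P[->//|/IH]; apply: le_trans.
rewrite -lerBlDl addrAC ratio_step.
have q0 := qR_gt0 m; have q1 := qR_gt0 m.+1; have q2 := qR_gt0 m.+2.
have h1 := qR_ge4 m; have h2 := qR_ge4 m.+1.
suff : 2 / (qR m.+1 * qR m.+2) <= (qR m * qR m.+1)^-1.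
  set x := (qR m * qR m.+1)^-1; lra.
rewrite ler_pdivrMr ?mulr_gt0// mulrC ler_pdivlMr ?mulr_gt0//.
nra.
Qed.

Lemma ratio_lower n m : (n <= m)%N -> r n <= r m.
Proof.
elim: m => [|m IH]; first by rewrite leqn0 => /eqP ->.
rewrite leq_eqVlt => /predU1P[->//|/IH]; move/le_trans; apply.
by rewrite -subr_ge0 ratio_step invr_ge0 mulr_ge0// ltW ?qR_gt0.
Qed.

Definition calpha : R := sup (range r).

Lemma calpha_bounds n :
  r n.+1 <= calpha <= r n + 2 / (qR n * qR n.+1).
Proof.
have ub k : ubound (range r) (r k + 2 / (qR k * qR k.+1)).
  move=> _ [m _ <-]; have /orP[km|mk] := leq_total k m.
    apply: le_trans (ratio_upper km).
    by rewrite lerDl divr_ge0// mulr_ge0// ltW ?qR_gt0.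
  apply: le_trans (ratio_lower mk) _.
  by rewrite lerDl divr_ge0// mulr_ge0// ltW ?qR_gt0.
apply/andP; split.
  by apply: ub_le_sup; [exists (r 0 + 2 / (qR 0 * qR 1)); exact: ub|exists n.+1].
by apply: ge_sup => //; exists (r 0), 0%N.
Qed.

Lemma calpha_approx n :
  (qR n.+1)^-1 <= qR n * calpha - pR n <= 2 / qR n.+1.
Proof.
have /andP[lo up] := calpha_bounds n; have q0 := qR_gt0 n; have q1 := qR_gt0 n.+1.
have E : qR n * calpha - pR n = qR n * (calpha - r n).
  by rewrite /r; field; rewrite gt_eqF.
rewrite E; apply/andP; split.
  rewrite mulrC -ler_pdivrMr// -invfM [_ * qR n]mulrC -ratio_step; lra.
rewrite mulrC -ler_pdivlMr//; move: up; rewrite invfM mulrA.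
rewrite -lerBlDl => /le_trans; apply.
by rewrite mulrAC.
Qed.

Lemma calpha_lt1 : 0 < calpha < 1.
Proof.
have /andP[lo _] := calpha_bounds 0; have /andP[_ up] := calpha_bounds 1.
have q2 := qR_ge4 1; move: lo up; rewrite /r.
have -> : qR 1 = 5%:R by []. have -> : pR 1 = 1 by [].
have q25 : 20%:R <= qR 2 by move: q2; have -> : qR 1 = 5%:R by []; lra.
move=> lo up; apply/andP; split; first by lra.
apply: le_lt_trans up _.
have : 2 / (5 * qR 2) <= 1 / 5 by rewrite ler_pdivrMr ?mulr_gt0 ?qR_gt0//; lra.
lra.
Qed.

Lemma cnum_bounds n : 0 <= cnum n <= cden n.
Proof.
have /andP[a0 a1] := calpha_lt1.
have H0 m : r m <= calpha.
  by case/andP: (calpha_bounds m) => + _; apply: le_trans; exact: ratio_lower.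
apply/andP; split.
  have := ratio_lower (leq0n n); rewrite {1}/r /cnum /= mul0r.
  by rewrite /r pmulr_lge0 ?invr_gt0 ?qR_gt0// ler0z.
have := H0 n; rewrite /r ler_pdivrMr ?qR_gt0// => h.
rewrite -(ler_int R); apply: le_trans h _.
by rewrite ler_piMl ?ltW// qR_gt0.
Qed.

(* [p / q] differs from the convergent following [q], whose distance to
   [calpha] is much smaller than [1 / (q * cden n.+1)]. *)
Lemma calpha_badly_approximable (p q : int) : 0 < q ->
  (12 * (q%:~R : R) `^ tau)^-1 <= `|q%:~R * calpha - p%:~R|.
Proof.
move=> q0.
have cden_gt n : n%:Z < cden n.
  by elim: n => [|n IH] //; have := cden_ge4 n; lia.
have [n nq qn] : exists2 n, cden n <= q & q < cden n.+1.
  have ex : exists n, q < cden n.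
    by exists `|q|%N; have := cden_gt `|q|%N; lia.
  have [[|n] qn nmin] := ex_minnP ex; first by move: qn; rewrite /cden/=; lia.
  by exists n => //; rewrite leNgt; apply/negP => /nmin; rewrite ltnn.
(* Otherwise the determinant identity would make [cden n.+1] divide the smaller positive integer
   [q]. *)
have p0 : p * cden n.+1 - q * cnum n.+1 != 0.
  apply/eqP => pq; have det := convergents_det n.
  have qE : q = cden n.+1 * (p * cden n - q * cnum n).
    have {}pq : q * cnum n.+1 = p * cden n.+1 by lia.
    rewrite -[LHS]mulr1 -det mulrBr mulrA pq; ring.
  have q1 := cden_gt0 n.+1; move: q0 qn; rewrite qE.
  by rewrite pmulr_rgt0// gtr_pMr//; lia.
have q0R : 0 < q%:~R :> R by rewrite ltr0z.
have nqR : qR n <= q%:~R by rewrite ler_int.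
have qnR : (q%:~R : R) <= qR n.+1 by rewrite ler_int ltW.
have p1 : 1 <= `|p%:~R * qR n.+1 - q%:~R * pR n.+1 : R|.
  rewrite -!intrM -intrB -intr_norm -[1]/(1%:~R) ler_int.
  by rewrite -gtz0_ge1 normr_gt0.
have /andP[a1 a2] := calpha_approx n.+1.
have Q0 := qR_gt0 n; have Q1 := qR_gt0 n.+1; have Q2 := qR_gt0 n.+2.
have Q4 := qR_ge4 n.+1.
apply: (@le_trans _ _ (2 * qR n.+1)^-1).
  rewrite lef_pV2 ?posrE ?mulr_gt0 ?powR_gt0//.
  have /andP[_ up] := qR_growth n.
  have : qR n `^ tau <= q%:~R `^ tau.
    by rewrite ge0_ler_powR ?nnegrE// ltW// (lt_trans ltr01).
  lra.
have E : q%:~R * calpha - p%:~R =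
    (q%:~R * (qR n.+1 * calpha - pR n.+1) -
      (p%:~R * qR n.+1 - q%:~R * pR n.+1)) / qR n.+1.
  by field; rewrite gt_eqF.
rewrite E normrM normfV (gtr0_norm Q1) invfM ler_pM2r ?invr_gt0//.
rewrite distrC; apply: le_trans (lerB_dist _ _).
have : `|q%:~R * (qR n.+1 * calpha - pR n.+1)| <= 2^-1.
  rewrite normrM gtr0_norm// ger0_norm; last by apply: le_trans a1; rewrite invr_ge0 ltW.
  apply: (@le_trans _ _ (qR n.+1 * (2 / qR n.+2))).
    by rewrite ler_pM// ?(ltW q0R)//; apply: le_trans a1; rewrite invr_ge0 ltW.
  rewrite mulrA ler_pdivrMr//; lra.
have : (2^-1 : R) = 1 - 2^-1 by field.
move=> ->; lra.
Qed.

End Convergents.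

(** * Appending a coordinate to a Diophantine vector by a measure estimate *)

(** Telescoping form of the comparison of a sum with an integral. Divided by [n.+2 ^ (- s)], it
    follows from [exp y >= 1 + y] and [ln (1 - 1 / b) <= - 1 / b]. *)
Lemma powRN_step (R : realType) (s : R) (n : nat) : 0 < s ->
  s * n.+2%:R `^ (- (s + 1)) <= n.+1%:R `^ (- s) - n.+2%:R `^ (- s).
Proof.
move=> s0; set a : R := n.+1%:R; set b : R := n.+2%:R.
have a0 : 0 < a by rewrite ltr0n.
have b0 : 0 < b by rewrite ltr0n.
have bE : b = a + 1 by rewrite /a /b -natr1.
have -> : a `^ (- s) = b `^ (- s) * (b / a) `^ s.
  rewrite powRM ?invr_ge0 ?ltW// mulrA -powRD ?addNr ?powRr0 ?mul1r; last first.
    by rewrite (gt_eqF b0) implybT.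
  by rewrite -powR_inv1 ?ltW// -powRrM mulN1r.
have -> : b `^ (- (s + 1)) = b `^ (- s) * b^-1.
  by rewrite opprD powRD ?powR_inv1 ?ltW// (gt_eqF b0) implybT.
rewrite mulrCA -{3}[b `^ _]mulr1 -mulrBr ler_wpM2l ?powR_ge0//.
rewrite /powR gt_eqF ?divr_gt0// lerBrDr addrC.
apply: le_trans (expR_ge1Dx _); rewrite lerD2l ler_wpM2l ?(ltW s0)//.
have : ln (a / b) <= - b^-1.
  have -> : a / b = 1 + (- b^-1) by rewrite bE; field; rewrite gt_eqF// addr_gt0.
  apply: le_ln1Dx; rewrite ltrN2 invf_lt1// bE ltrDr//.
by rewrite -[a / b]invrK invf_div lnV ?posrE ?divr_gt0// lerN2.
Qed.

Lemma riemann_sum_le (R : realType) (sigma : R) : 1 < sigma ->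
  exists2 Z : R, 0 < Z & forall N, \sum_(n < N) n.+1%:R `^ (- sigma) <= Z.
Proof.
move=> s1; pose s := sigma - 1; have s0 : 0 < s by rewrite subr_gt0.
exists (1 + s^-1); first by rewrite addr_gt0 ?invr_gt0.
have H N : \sum_(n < N.+1) (n.+1%:R : R) `^ (- sigma) <=
    1 + (1 - N.+1%:R `^ (- s)) / s.
  elim: N => [|N IH].
    by rewrite big_ord1 !powR1 subrr mul0r addr0.
  rewrite big_ord_recr/=; apply: le_trans (lerD IH (lexx _)) _.
  rewrite -addrA lerD2l -lerBrDl -mulrBl ler_pdivlMr// mulrC.
  have -> : - sigma = - (s + 1) by rewrite /s subrK.
  apply: le_trans (powRN_step N s0) _; lra.
case=> [|N]; first by rewrite big_ord0 addr_ge0 ?invr_ge0 ?ltW.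
by apply: le_trans (H N) _; rewrite lerD2l ler_piMl ?invr_ge0 ?ltW//.
Qed.

(** The vector is the initial segment of length [j] of a sequence, so that appending a coordinate
    does not change its type. *)
Definition diophantine_seq (R : realType) (tau gamma : R) j (w : nat -> R) :=
  forall k : nat -> int, (exists2 i, (i < j)%N & k i != 0) ->
    gamma / (\sum_(i < j) `|(k i)%:~R|) `^ tau <=
      `|\sum_(i < j) w i * (k i)%:~R|.

Section DiophantineExtension.
Variables (R : realType) (tau sigma gamma0 Z : R) (j : nat) (w : nat -> R).
Hypotheses (gamma0_gt0 : 0 < gamma0) (Z_gt0 : 0 < Z).
Hypothesis Z_ge : forall N, \sum_(n < N) n.+1%:R `^ (- sigma) <= Z.

(** Here [m.+1] is the coefficient of the new coordinate, taken positive after a change of sign of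
    the whole integer vector; the centre is the value of that coordinate giving an exact
    resonance. *)
Let center (k : 'I_j -> int) (m : nat) : R :=
  - (\sum_(i < j) w i * (k i)%:~R) / m.+1%:R.
(** A product of one-variable weights, so that the sum of all radii factorises into sums bounded by
    [Z]. *)
Let radius (k : 'I_j -> int) (m : nat) : R :=
  gamma0 * (\prod_i (`|k i|%N.+1)%:R `^ (- sigma)) * m.+1%:R `^ (- sigma).
Let bad (N : nat) : set R := [set x | exists (k : 'I_j -> int) (m : nat),
  [/\ forall i, (`|k i| < N)%N, (m < N)%N & `|x - center k m| < radius k m]].

(** Encodes integers of absolute value below [N] by a finite type. Zero occurs twice, which only
    enlarges the upper bound; the sign accounts for the 2 in [(2 * Z) ^+ j]. *)
Let signed N (f : {ffun 'I_j -> bool * 'I_N}) (i : 'I_j) : int :=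
  (-1) ^+ (f i).1 * (f i).2%:Z.

Let abs_signed N (f : {ffun 'I_j -> bool * 'I_N}) i :
  `|signed f i|%N = (f i).2.
Proof. by rewrite /signed abszM abszX /= exp1n mul1n. Qed.

Let badE N : bad N =
  \big[setU/set0]_(p in [set: {ffun 'I_j -> bool * 'I_N} * 'I_N]%SET)
     ball (center (signed p.1) p.2) (radius (signed p.1) p.2).
Proof.
rewrite -bigcup_pred; apply/seteqP; split => x.
  move=> [k [m [kN mN xr]]].
  pose f := [ffun i => ((k i < 0)%R, Ordinal (kN i))].
  have fk : signed f = k.
    apply/funext => i; rewrite /signed ffunE /=.
    by case: ltP => h; rewrite ?expr1 ?expr0; lia.
  exists (f, Ordinal mN); first by rewrite /= inE.
  by rewrite -ball_normE /= fk distrC.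
move=> [[f m] _ /=]; rewrite -ball_normE /= distrC => xr.
exists (signed f), m; split => // i.
by rewrite abs_signed.
Qed.

Let measurable_bad N : measurable (bad N).
Proof.
rewrite badE; apply: bigsetU_measurable => p _; rewrite ball_itv; exact: measurable_itv.
Qed.

Let radius_ge0 k m : 0 <= radius k m.
Proof.
rewrite /radius !mulr_ge0 ?powR_ge0 ?(ltW gamma0_gt0)//.
by apply: prodr_ge0 => i _; exact: powR_ge0.
Qed.

Let bad_measure N :
  (lebesgue_measure (bad N) <= (2 * gamma0 * (2 * Z) ^+ j * Z)%:E)%E.
Proof.
pose rp (p : {ffun 'I_j -> bool * 'I_N} * 'I_N) :=
  2 * radius (signed p.1) p.2.
have : (lebesgue_measure (bad N) <= (\sum_(p in [set: _]%SET) rp p)%:E)%E.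
  rewrite badE.
  pose P (A : set R) (s : R) :=
    measurable A /\ (lebesgue_measure A <= s%:E)%E.
  suff [] : P (\big[setU/set0]_(p in [set: {ffun 'I_j -> bool * 'I_N} * 'I_N]%SET)
     ball (center (signed p.1) p.2) (radius (signed p.1) p.2))
     (\sum_(p in [set: _]%SET) rp p) by [].
  apply: (big_ind2 P).
  - by split => //; rewrite measure0.
  - move=> A s B t [mA As] [mB Bt]; split; first exact: measurableU.
    have H := @measureU2 _ _ _ lebesgue_measure A B mA mB.
    by apply: le_trans H _; rewrite EFinD leeD.
  - move=> p _; split; first by rewrite ball_itv; exact: measurable_itv.
    by rewrite lebesgue_measure_ball ?radius_ge0// /rp mulr_natl.
move=> /le_trans; apply; rewrite lee_fin.
rewrite (eq_bigl xpredT); last by move=> p; rewrite inE.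
rewrite -(pair_bigA _ (fun f m => rp (f, m)))/= /rp /radius.
have E (f : {ffun 'I_j -> bool * 'I_N}) :
    \sum_(m < N) 2 * (gamma0 * (\prod_i (`|signed f i|%N.+1)%:R `^ (- sigma)) *
      m.+1%:R `^ (- sigma)) =
    2 * gamma0 * (\sum_(m < N) m.+1%:R `^ (- sigma)) *
     (\prod_i ((f i).2.+1)%:R `^ (- sigma)).
  transitivity (2 * gamma0 * (\prod_i (`|signed f i|%N.+1)%:R `^ (- sigma)) *
      \sum_(m < N) m.+1%:R `^ (- sigma)).
    by rewrite mulr_sumr; apply: eq_bigr => m _; ring.
  rewrite mulrAC; congr (_ * _).
  by apply: eq_bigr => i _; rewrite abs_signed.
under eq_bigr do rewrite E.
rewrite -mulr_sumr -(bigA_distr_bigA (fun _ (b : bool * 'I_N) => b.2.+1%:R `^ (- sigma)))/=.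
rewrite prodr_const card_ord -[leRHS]mulrA [_ * Z]mulrC mulrA.
have S0 : 0 <= \sum_(m < N) m.+1%:R `^ (- sigma) by apply: sumr_ge0 => i _; exact: powR_ge0.
rewrite ler_pM ?exprn_ge0 ?mulr_ge0 ?(ltW gamma0_gt0)//.
- by apply: sumr_ge0 => i _; exact: powR_ge0.
- by rewrite ler_wpM2l ?Z_ge// mulr_ge0// ltW.
rewrite lerXn2r ?nnegrE ?mulr_ge0 ?(ltW Z_gt0)//.
  by apply: sumr_ge0 => i _; exact: powR_ge0.
rewrite -(pair_bigA _ (fun (b : bool) (m : 'I_N) => m.+1%:R `^ (- sigma)))/=.
by rewrite sumr_const card_bool -[leLHS]mulr_natl ler_wpM2l ?Z_ge.
Qed.

(** The sets [bad N] increase and have uniformly bounded measure, so their union has measure below 1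
    and cannot cover the unit interval. *)
Lemma exists_not_bad : 2 * gamma0 * (2 * Z) ^+ j * Z < 1 ->
  exists x, forall (k : 'I_j -> int) (m : nat),
    gamma0 * (\prod_i (`|k i|%N.+1)%:R `^ (- sigma)) * m.+1%:R `^ (- sigma) <=
    `|x + (\sum_(i < j) w i * (k i)%:~R) / m.+1%:R|.
Proof.
move=> small; apply: contrapT => allbad.
have cover : `[0, 1]%classic `<=` \bigcup_N bad N.
  move=> x _; apply: contrapT => xbad; apply: allbad; exists x => k m.
  rewrite leNgt; apply/negP => xr; apply: xbad.
  exists (maxn m (\max_i `|k i|)%N).+1 => //.
  exists k, m; split.
  - by move=> i; rewrite ltnS leq_max leq_bigmax orbT.
  - by rewrite ltnS leq_max leqnn.
  by rewrite /center mulNr opprK.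
have mono : {homo bad : n m / (n <= m)%N >-> (n <= m)%O}.
  move=> n m nm; apply/subsetPset => x [k [a [kN aN xr]]].
  exists k, a; split => //; last exact: leq_trans nm.
  by move=> i; exact: leq_trans nm.
have mU : measurable (\bigcup_N bad N) by exact: bigcup_measurable.
have cv := @nondecreasing_cvg_mu _ _ _ lebesgue_measure _ measurable_bad mU mono.
have : (lebesgue_measure (\bigcup_N bad N) <= (2 * gamma0 * (2 * Z) ^+ j * Z)%:E)%E.
  rewrite -(cvg_lim _ cv)//; apply: lime_le; first by apply/cvg_ex; eexists; exact: cv.
  by apply: nearW => N; exact: bad_measure.
apply/negP; rewrite -ltNge; apply: (@lt_le_trans _ _ 1%E); first by rewrite lte_fin.
apply: le_trans _ (le_measure lebesgue_measure _ _ cover); rewrite ?inE//.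
have E : lebesgue_measure (`[0, 1]%classic : set R) = 1%E.
  by rewrite lebesgue_measure_itv/= lte_fin ltr01 -EFinB subr0.
by rewrite -[leRHS]/(lebesgue_measure (`[0, 1]%classic : set R)) E.
Qed.

End DiophantineExtension.

Lemma diophantine_extend (R : realType) (tau gamma : R) j (w : nat -> R) :
  (0 < j)%N -> j%:R < tau -> 0 < gamma -> diophantine_seq tau gamma j w ->
  exists x gamma', 0 < gamma' /\
    diophantine_seq tau gamma' j.+1 (fun i => if (i < j)%N then w i else x).
Proof.
move=> j0 jtau g0 dw; have jR : 0 < j%:R :> R by rewrite ltr0n.
have tau0 : 0 < tau by exact: lt_trans jtau.
(* Chosen so that [sigma * j.+1 - 1 = tau], the exponent that results once the distance is
   multiplied by the last coefficient; [sigma > 1] amounts to [j < tau]. *)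
pose sigma := (tau + 1) / j.+1%:R.
have sigma1 : 1 < sigma by rewrite ltr_pdivlMr ?ltr0n// mul1r -natr1 ltrD2r.
have [Z Z0 ZP] := riemann_sum_le sigma1.
(* Makes the bound on the measure of the bad set equal to 1/2. *)
pose gamma0 := (4 * (2 * Z) ^+ j * Z)^-1.
have P0 : 0 < (2 * Z) ^+ j by rewrite exprn_gt0 ?mulr_gt0.
have gamma00 : 0 < gamma0 by rewrite invr_gt0 !mulr_gt0.
have [|x xP] := @exists_not_bad R sigma gamma0 Z j w gamma00 Z0 ZP.
  have -> : 2 * gamma0 * (2 * Z) ^+ j * Z = 2^-1.
    by rewrite /gamma0; field; rewrite !gt_eqF// ?mulr_gt0.
  by rewrite invf_lt1// ltr1n.
exists x, (Num.min gamma gamma0); split; first by rewrite lt_min g0.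
move=> k [i ij ki0]; rewrite !big_ord_recr/= ltnn.
have wE : \sum_(i < j) (if (i < j)%N then w i else x) * (k i)%:~R =
    \sum_(i < j) w i * (k i)%:~R.
  by apply: eq_bigr => a _; rewrite ltn_ord.
rewrite wE; have [kj0|kj0] := eqVneq (k j) 0.
  rewrite kj0 mulr0 normr0 !addr0; apply: le_trans (dw k _).
    by rewrite ler_wpM2r ?invr_ge0 ?powR_ge0// ge_min lexx.
  exists i => //; move: ij; rewrite ltnS leq_eqVlt => /predU1P[ij|//].
  by move: ki0; rewrite ij kj0.
set S := \sum_(i < j) `|(k i)%:~R : R|.
pose M := `|k j|%N; have M0 : (0 < M)%N by rewrite absz_gt0.
have ME : `|(k j)%:~R : R| = M%:R by rewrite -intr_norm -abszE.
pose k' (a : 'I_j) : int := Num.sg (k j) * k a.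
have := xP k' M.-1; rewrite prednK// => xk.
have absk' a : `|k' a|%N = `|k a|%N.
  by rewrite abszM absz_sg kj0 mul1n.
have E : `|\sum_(i < j) w i * (k i)%:~R + x * (k j)%:~R| =
    M%:R * `|x + (\sum_(i < j) w i * (k' i)%:~R) / M%:R|.
  pose sg : R := Num.sg (k j)%:~R.
  have sg2 : sg * sg = 1 by rewrite -expr2 sqr_sg intr_eq0 kj0.
  have sg1 : `|sg| = 1 by rewrite normr_sg intr_eq0 kj0.
  have -> : \sum_(i < j) w i * (k' i)%:~R = sg * \sum_(i < j) w i * (k i)%:~R.
    rewrite mulr_sumr; apply: eq_bigr => a _.
    by rewrite /k' intrM /sg intr_sg mulrCA.
  have -> : (k j)%:~R = sg * M%:R by rewrite -ME mulr_sg_norm.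
  have Mn0 : M%:R != 0 :> R by rewrite pnatr_eq0 -lt0n.
  set S1 := \sum_(i < j) _.
  transitivity `|M%:R * (x + sg * S1 / M%:R)|; last by rewrite normrM normr_nat.
  transitivity (`|sg| * `|S1 + x * (sg * M%:R)|); first by rewrite sg1 mul1r.
  rewrite -normrM; congr (`|_|).
  transitivity (sg * S1 + (sg * sg) * x * M%:R); first by ring.
  by rewrite sg2; field.
rewrite E; apply: le_trans (ler_wpM2l (ler0n _ _) xk).
have M1 : 1 <= M%:R :> R by rewrite ler1n.
have S0 : 0 <= S by exact: sumr_ge0.
rewrite ME; set T := S + M%:R; have T0 : 0 < T by rewrite ltr_wpDl// (lt_le_trans ltr01).
have le_powRN (a b s : R) : 0 < a -> a <= b -> 0 <= s -> b `^ (- s) <= a `^ (- s).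
  move=> a0 ab s0; have b0 := lt_le_trans a0 ab.
  by rewrite !powRN lef_pV2 ?posrE ?powR_gt0// ge0_ler_powR ?nnegrE ?(ltW a0) ?(ltW b0).
have sigma0 : 0 <= sigma by rewrite ltW// (lt_trans ltr01).
(* Each [|k i| + 1] is at most [T = S + M] because [M >= 1]. *)
have prodT : T `^ (- (sigma * j%:R)) <= \prod_i (`|k' i|%N.+1)%:R `^ (- sigma).
  rewrite -mulNr powRrM powR_mulrn ?powR_ge0// -[j in _ ^+ j]card_ord -prodr_const.
  apply: ler_prod => a _; rewrite powR_ge0/= le_powRN ?ltr0n// absk' -natr1 lerD//.
  by rewrite natr_absz intr_norm /S (bigD1 a)//= lerDl sumr_ge0.
have MT : T `^ (- (sigma - 1)) <= M%:R `^ (- (sigma - 1)).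
  by rewrite le_powRN ?subr_ge0 ?(ltW sigma1) ?lerDr// (lt_le_trans ltr01).
have -> : M%:R * (gamma0 * \prod_i (`|k' i|%N.+1)%:R `^ (- sigma) * M%:R `^ (- sigma)) =
    gamma0 * (\prod_i (`|k' i|%N.+1)%:R `^ (- sigma) * M%:R `^ (- (sigma - 1))).
  have -> : M%:R `^ (- (sigma - 1)) = M%:R `^ (- sigma) * M%:R.
    rewrite opprB addrC powRD ?powRr1// pnatr_eq0 -lt0n M0 implybT//.
  ring.
apply: (@le_trans _ _ (gamma0 / T `^ tau)).
  by rewrite ler_wpM2r ?invr_ge0 ?powR_ge0// ge_min lexx orbT.
rewrite ler_wpM2l ?(ltW gamma00)//.
apply: le_trans (ler_pM (powR_ge0 _ _) (powR_ge0 _ _) prodT MT).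
rewrite -powRD ?(gt_eqF T0) ?implybT// -powRN.
have -> : - (sigma * j%:R) - (sigma - 1) = - tau.
  have : sigma * j.+1%:R = tau + 1 by rewrite /sigma divfK// pnatr_eq0.
  rewrite -natr1; lra.
by [].
Qed.

Lemma diophantine_pair (R : realType) (tau : R) : 1 < tau ->
  diophantine_seq tau 12^-1 2 (fun i => if i == 0%N then 1 else calpha tau).
Proof.
move=> tau1 k [i i2 ki0]; rewrite !big_ord_recr !big_ord0/= !add0r mul1r.
have tau0 : 0 < tau by exact: lt_trans tau1.
set a := k 0%N; set b := k 1%N.
have absz1 (z : int) : z != 0 -> 1 <= `|z%:~R : R|.
  by move=> z0; rewrite -intr_norm -[1]/(1%:~R) ler_int -gtz0_ge1 normr_gt0.
have [b0|b0] := eqVneq b 0.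
  have a0 : a != 0.
    move: i2 ki0; case: i => [|[|i]]// _; by rewrite -/b b0 eqxx.
  rewrite b0 mulr0 normr0 !addr0; have a1 := absz1 _ a0.
  apply: (@le_trans _ _ 1) => //; rewrite ler_pdivrMr ?powR_gt0 ?(lt_le_trans ltr01)//.
  rewrite mul1r; apply: (@le_trans _ _ 1); first by rewrite invf_le1// ler1n.
  have := @ler_powR R _ a1 0 tau; rewrite powRr0; apply; exact: ltW.
have q0 : 0 < `|b| by rewrite normr_gt0.
have := calpha_badly_approximable tau1 (- (Num.sg b * a)) q0.
have b1 := absz1 _ b0.
have -> : `|(`|b|%:~R * calpha tau - (- (Num.sg b * a))%:~R : R)| =
    `|a%:~R + calpha tau * b%:~R|.
  have sg1 : `|Num.sg b%:~R : R| = 1 by rewrite normr_sg intr_eq0 b0.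
  transitivity (`|Num.sg b%:~R : R| * `|a%:~R + calpha tau * b%:~R|);
    last by rewrite sg1 mul1r.
  rewrite -normrM; congr (`|_|).
  by rewrite intrN opprK intrM intr_sg intr_norm normrEsg; ring.
apply: le_trans; rewrite invfM intr_norm ler_wpM2l ?invr_ge0//.
rewrite lef_pV2 ?posrE ?powR_gt0 ?(lt_le_trans ltr01 b1)//; last first.
  by rewrite ltr_wpDl// (lt_le_trans ltr01).
by rewrite ge0_ler_powR ?nnegrE ?addr_ge0 ?lerDr ?(ltW tau0).
Qed.

Lemma exists_diophantine (R : realType) (d : nat) (tau : R) (i0 i1 : 'I_d) :
  (2 <= d)%N -> d%:R - 1 < tau -> i0 = 0%N :> nat -> i1 = 1%N :> nat ->
  exists omega : 'rV[R]_d,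
    [/\ diophantine tau omega, omega 0 i0 = 1 & omega 0 i1 = calpha tau].
Proof.
move=> d2 dtau i0E i1E.
have tau1 : 1 < tau by apply: le_lt_trans dtau; rewrite lerBrDr -[1 + 1]/(2%:R) ler_nat.
have [w [gamma [g0 wP w0 w1]]] : exists w gamma,
    [/\ 0 < gamma, diophantine_seq tau gamma d w, w 0%N = 1 & w 1%N = calpha tau].
  have : forall j, (2 <= j <= d)%N -> exists w gamma,
    [/\ 0 < gamma, diophantine_seq tau gamma j w, w 0%N = 1 & w 1%N = calpha tau].
    elim=> [//|j IH]; rewrite leq_eqVlt => /andP[/predU1P[<-|j2] jd].
      exists (fun i => if i == 0%N then 1 else calpha tau), 12^-1.
      by split => //; exact: diophantine_pair.
    have {}j2 : (2 <= j)%N by [].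
    have [|w [gamma [g0 wP w0 w1]]] := IH; first by rewrite j2 ltnW.
    have jtau : j%:R < tau.
      by apply: le_lt_trans dtau; rewrite lerBrDr natr1 ler_nat.
    have [x [gamma' [g0' wP']]] := diophantine_extend (ltnW j2) jtau g0 wP.
    exists (fun i => if (i < j)%N then w i else x), gamma'; split => //.
      by rewrite (ltnW j2).
    by rewrite ifT.
  by apply; rewrite d2 leqnn.
exists (\row_i w i); split; last 2 first.
- by rewrite mxE i0E.
- by rewrite mxE i1E.
exists gamma => // k k0.
pose kk (i : nat) : int := if insub i is Some a then k 0 a else 0.
have kkE (i : 'I_d) : kk i = k 0 i by rewrite /kk valK.
have [i ki] : exists i, k 0 i != 0.
  apply/existsP; apply: contraNT k0 => /existsPn h0; apply/eqP/rowP => i.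
  by rewrite mxE; apply/eqP; have := h0 i; rewrite negbK.
have := wP kk; rewrite /dot.
have -> : \sum_(i < d) `|(kk i)%:~R : R| = \sum_i `|of_int R k 0 i|.
  by apply: eq_bigr => a _; rewrite kkE mxE.
have -> : \sum_(i < d) w i * (kk i)%:~R =
    \sum_i (\row_i w i) 0 i * of_int R k 0 i.
  by apply: eq_bigr => a _; rewrite kkE !mxE.
by apply; exists (nat_of_ord i); rewrite ?kkE.
Qed.

(** * The Hamiltonian and its orbits *)

Section QuadraticRoot.
Variable R : realType.
Implicit Types f x b a : R.

Definition qdisc f x b := b ^+ 2 - 4 * f * x.
(* the root of [a * b - a ^ 2 * f = x] that tends to [x / b] as [f] tends to
   [0] *)
Definition qroot f x b := 2 * x / (b + Num.sqrt (qdisc f x b)).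

(** [qroot] is the conjugate form of the quadratic formula: it does not divide by [f], which may
    vanish. *)
Lemma qroot_eq f x b : 0 < b -> 0 < qdisc f x b ->
  let a := qroot f x b in
  a * b - a ^+ 2 * f = x /\ Num.sqrt (qdisc f x b) = b - 2 * a * f.
Proof.
move=> b0 D0 a; set s := Num.sqrt _.
have s0 : 0 < s by rewrite sqrtr_gt0.
have s2 : s ^+ 2 = b ^+ 2 - 4 * f * x by rewrite sqr_sqrtr// ltW.
have bs : b + s != 0 by rewrite gt_eqF// addr_gt0.
have aE : a * (b + s) = 2 * x by rewrite /a /qroot -/s divfK.
have sE : s = b - 2 * a * f.
  apply: (mulIf bs); rewrite mulrBl.
  have -> : 2 * a * f * (b + s) = 2 * f * (a * (b + s)) by ring.
  rewrite aE; have : s * (b + s) = s ^+ 2 + s * b by ring.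
  move=> ->; rewrite s2; ring.
split => //; have : a * (b + s) = 2 * (a * b - a ^+ 2 * f) by rewrite {1}sE; ring.
by rewrite aE => /mulfI -> //; rewrite pnatr_eq0.
Qed.

(** The discriminant is the square of [b - 2 * a * f], and the sign of this quantity selects the
    branch. *)
Lemma qroot_unique f x b a : 0 < b -> 0 < b - 2 * a * f ->
  a * b - a ^+ 2 * f = x ->
  [/\ qroot f x b = a, Num.sqrt (qdisc f x b) = b - 2 * a * f & 0 < qdisc f x b].
Proof.
move=> b0 s0 xE.
have dE : qdisc f x b = (b - 2 * a * f) ^+ 2 by rewrite /qdisc -xE; ring.
have sE : Num.sqrt (qdisc f x b) = b - 2 * a * f.
  by rewrite dE sqrtr_sqr gtr0_norm.
split => //; last by rewrite dE exprn_gt0.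
rewrite /qroot sE -xE; field.
by rewrite gt_eqF//; move: s0 b0; lra.
Qed.

Lemma is_derive_inv (V : normedModType R) (f : V -> R) (p v : V) (f' : R) :
  f p != 0 -> is_derive p v f f' ->
  is_derive p v (fun y => (f y)^-1) (- (f p) ^- 2 * f').
Proof.
move=> fp [df <-]; split; first exact: derivableV.
by rewrite deriveV.
Qed.

(** Implicit differentiation: [a' * (b - 2 * a * f) = x' - a * b' + a ^ 2 * f'], where the factor of
    [a'] is the square root of the discriminant. *)
Lemma is_derive_qroot (V : normedModType R) (f x b : V -> R) (p v : V)
    (f' x' b' : R) :
  0 < b p -> 0 < qdisc (f p) (x p) (b p) ->
  is_derive p v f f' -> is_derive p v x x' -> is_derive p v b b' ->
  let a := qroot (f p) (x p) (b p) in
  is_derive p v (fun y => qroot (f y) (x y) (b y))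
    ((x' - a * b' + a ^+ 2 * f') / Num.sqrt (qdisc (f p) (x p) (b p))).
Proof.
move=> b0 D0 df dx db a; set s := Num.sqrt _.
have [xE sE] := qroot_eq b0 D0; rewrite -/s -/a in xE sE.
have s0 : 0 < s by rewrite sqrtr_gt0.
have bs : 0 < b p + s by rewrite addr_gt0.
have dD : is_derive p v (fun y => qdisc (f y) (x y) (b y))
    (2 * b p * b' - 4 * (f' * x p + f p * x')).
  have H1 := is_deriveM db db; have H2 := is_deriveM df dx.
  have H3 := is_deriveB H1 (is_deriveZ 4 H2).
  apply: (near_eq_is_derive _ (is_derive_eq H3 _)).
    by apply: nearW => y; rewrite /qdisc !fctE /= expr2 -mulrA.
  rewrite -![_ *: _]/(_ * _); ring.
have dS := is_derive_sqrt (f := fun y => qdisc (f y) (x y) (b y)) D0 dD.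
have dbS := is_deriveD db dS.
have dV := is_derive_inv (f := b \+ (fun y => Num.sqrt (qdisc (f y) (x y) (b y))))
  (lt0r_neq0 bs) dbS.
have dR := is_deriveM (is_deriveZ 2 dx) dV.
apply: (near_eq_is_derive _ (is_derive_eq dR _)).
  by apply: nearW => y; rewrite /qroot !fctE.
have scE (k y : R) : k *: y = k * y by [].
rewrite !scE /= !scE -/s -xE.
have s0' : b p - 2 * a * f p != 0 by rewrite -sE gt_eqF.
rewrite sE; field.
rewrite s0' /=.
by move: bs; rewrite sE => /lt0r_neq0.
Qed.

End QuadraticRoot.

(** * The Hamiltonian and its gradient *)

Section Model.
Variables (R : realType) (d : nat) (i0 i1 : 'I_d) (omega : 'rV[R]_d) (rad : R).
Variables (P Q : nat -> int) (e eta : nat -> R) (s : R).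
Hypotheses (i01 : i0 != i1) (rad_gt0 : 0 < rad) (s_gt0 : 0 < s) (s_le1 : s <= 1).
Hypotheses (P_ge0 : forall n, 0 <= P n) (P_le : forall n, P n <= Q n)
  (Q_gt0 : forall n, 0 < Q n) (e_ge0 : forall n, 0 <= e n).

Local Notation V := 'rV[R]_d.

(** This value keeps [blin] between 1/2 and 3/2 on the ball of radius [rad]. *)
Definition kap : R := (2 * rad)^-1.
Definition kint n : 'rV[int]_d :=
  \row_i (if i == i0 then - P n else if i == i1 then Q n else 0).
Definition kvec n : V := of_int R (kint n).
Definition freq n : V := (2 * pi) *: kvec n.
Definition fbound n : R := 4 * pi * (Q n)%:~R.
Definition phi : V -> R := trig_series freq e 0.
Definition dphi i : V -> R :=
  trig_series freq (fun n => e n * freq n 0 i) (0 + pi / 2).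
Definition gradphi theta : V := \row_i dphi i theta.
Definition xlin (I : V) : R := dot omega I.
Definition blin (I : V) : R := 1 + kap * I 0 i1.
Definition Ham theta I : R := qroot (phi theta) (xlin I) (blin I).
(** Equal to [b - 2 * a * phi], the factor by which the change of time rescales the vector field. *)
Definition sdisc theta I : R :=
  Num.sqrt (qdisc (phi theta) (xlin I) (blin I)).
(* direction in which the angles move on the energy level [a] *)
Definition uvec (a : R) : V := omega - (a * kap) *: delta_mx 0 i1.
Definition ampsum : R := tsum e.
Definition onorm : R := \sum_i `|omega 0 i|.

Hypothesis e_moment2 : moment_summable fbound (1 + (1 + s)) e.
Hypothesis ampsum_small : 32 * onorm * rad * ampsum <= 1.

Lemma kap_gt0 : 0 < kap. Proof. by rewrite invr_gt0 mulr_gt0. Qed.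

Lemma Q_ge1 n : 1 <= (Q n)%:~R :> R.
Proof. by rewrite -[1]/(1%:~R) ler_int -gtz0_ge1. Qed.

Lemma P_bounds n : 0 <= ((P n)%:~R : R) <= (Q n)%:~R.
Proof. by rewrite ler0z ler_int P_ge0 P_le. Qed.

Lemma pi_bounds : 2 <= (pi : R) <= 4.
Proof.
have := pihalf_lt2 R; rewrite pi_ge2 ltr_pdivrMr//; lra.
Qed.

Lemma dot_kvec n y :
  dot (kvec n) y = (Q n)%:~R * y 0 i1 - (P n)%:~R * y 0 i0.
Proof.
rewrite /dot (bigD1 i0)//= (bigD1 i1)/=; last by rewrite eq_sym.
rewrite big1 => [|i /andP[ii0 ii1]]; last first.
  by rewrite !mxE (negbTE ii0) (negbTE ii1) mul0r.
by rewrite !mxE !eqxx [i1 == i0]eq_sym (negbTE i01) intrN; ring.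
Qed.

Lemma dotZ (c : R) (x y : V) : dot (c *: x) y = c * dot x y.
Proof. by rewrite /dot mulr_sumr; apply: eq_bigr => i _; rewrite mxE mulrA. Qed.

Lemma dotC (x y : V) : dot x y = dot y x.
Proof. by apply: eq_bigr => i _; rewrite mulrC. Qed.

Lemma kvec_le n i : `|kvec n 0 i| <= (Q n)%:~R.
Proof.
have /andP[p0 pq] := P_bounds n; rewrite !mxE; case: ifP => _.
  by rewrite intrN normrN ger0_norm.
have Q0 : 0 <= (Q n)%:~R :> R by exact: le_trans ler01 (Q_ge1 n).
by case: ifP => _; rewrite ?normr0// ger0_norm.
Qed.

Lemma fbound_ge1 n : 1 <= fbound n.
Proof.
have q1 := Q_ge1 n; have /andP[p2 _] := pi_bounds; rewrite /fbound; nra.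
Qed.

Lemma freq_fbound n : \sum_i `|freq n 0 i| <= fbound n.
Proof.
have /andP[p0 pq] := P_bounds n; have q1 := Q_ge1 n.
have /andP[p2 _] := pi_bounds.
rewrite (bigD1 i0)//= (bigD1 i1)/=; last by rewrite eq_sym.
rewrite big1 => [|i /andP[ii0 ii1]]; last first.
  by rewrite !mxE (negbTE ii0) (negbTE ii1) mulr0 normr0.
rewrite !mxE !eqxx [i1 == i0]eq_sym (negbTE i01) intrN mulrN normrN addr0.
rewrite !ger0_norm ?mulr_ge0 ?(le_trans ler01 q1)// ?(le_trans _ p2)//.
by rewrite /fbound; nra.
Qed.

Lemma e_moment : moment_summable fbound (1 + s) e.
Proof.
by apply: (moment_summable_le fbound_ge1 _ e_moment2); rewrite lerDr.
Qed.

Lemma e_summable : abs_summable e.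
Proof.
by apply: (moment_summable0 fbound_ge1 _ e_moment); rewrite addr_ge0// ltW.
Qed.

Lemma phi_le theta : `|phi theta| <= ampsum.
Proof.
apply: le_trans (trig_bounded _ _ _ e_summable) _; rewrite /ampsum.
by under eq_fun do rewrite ger0_norm//.
Qed.

Lemma xlin_le I : `|xlin I| <= onorm * `|I|.
Proof.
apply: le_trans (ler_norm_sum _ _ _) _; rewrite /onorm mulr_suml.
by apply: ler_sum => i _; rewrite normrM ler_wpM2l// entry_le_norm.
Qed.

Lemma onorm_ge0 : 0 <= onorm. Proof. exact: sumr_ge0. Qed.

Lemma blin_bounds I : `|I| < rad -> 2^-1 <= blin I <= 3 / 2.
Proof.
move=> Ir; have := le_lt_trans (entry_le_norm I i1) Ir.
rewrite ltr_norml => /andP[lo up].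
have kr : kap * rad = 2^-1 by rewrite /kap; field; rewrite gt_eqF.
have k0 := kap_gt0; rewrite /blin; apply/andP; split.
  have : kap * - rad <= kap * I 0 i1 by rewrite ler_wpM2l ?ltW.
  by rewrite mulrN kr; lra.
have : kap * I 0 i1 <= kap * rad by rewrite ler_wpM2l ?ltW.
by rewrite kr; lra.
Qed.

Lemma phi_xlin_le theta I : `|I| < rad -> `|phi theta * xlin I| <= 32^-1.
Proof.
move=> Ir; rewrite normrM.
apply: (@le_trans _ _ (ampsum * (onorm * rad))).
  rewrite ler_pM ?phi_le//; apply: le_trans (xlin_le I) _.
  by rewrite ler_wpM2l ?onorm_ge0 ?ltW.
by move: ampsum_small; lra.
Qed.

(** On the ball [b ^ 2] lies between 1/4 and 9/4, and [4 * |phi * x|] is at most 1/8. *)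
Lemma disc_bounds theta I : `|I| < rad ->
  8^-1 <= qdisc (phi theta) (xlin I) (blin I) <= 4.
Proof.
move=> Ir; have /andP[b1 b2] := blin_bounds Ir.
have := phi_xlin_le theta Ir; rewrite ler_norml => /andP[f1 f2].
have b3 : 4^-1 <= blin I ^+ 2 by rewrite expr2; nra.
have b4 : blin I ^+ 2 <= 9 / 4 by rewrite expr2; nra.
rewrite /qdisc -mulrA; apply/andP; split; lra.
Qed.

Lemma sdisc_bounds theta I : `|I| < rad -> 4^-1 <= sdisc theta I <= 2.
Proof.
move=> Ir; have /andP[D1 D2] := disc_bounds theta Ir.
have -> : 4^-1 = Num.sqrt (16^-1) :> R.
  have -> : 16^-1 = 4^-1 ^+ 2 :> R by rewrite expr2; field.
  by rewrite sqrtr_sqr ger0_norm.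
have -> : 2 = Num.sqrt 4 :> R.
  have -> : 4 = 2 ^+ 2 :> R by rewrite expr2; ring.
  by rewrite sqrtr_sqr ger0_norm.
by rewrite !ler_wsqrtr//; lra.
Qed.

Lemma Ham_eq theta I : `|I| < rad -> let a := Ham theta I in
  a * blin I - a ^+ 2 * phi theta = xlin I /\
  sdisc theta I = blin I - 2 * a * phi theta.
Proof.
move=> Ir; apply: qroot_eq.
  by have /andP[b1 _] := blin_bounds Ir; apply: lt_le_trans b1; rewrite invr_gt0.
have /andP[D1 _] := disc_bounds theta Ir.
by apply: lt_le_trans D1; rewrite invr_gt0.
Qed.

Lemma Ham_le theta I : `|I| < rad -> `|Ham theta I| <= 4 * onorm * `|I|.
Proof.
move=> Ir; have /andP[b1 _] := blin_bounds Ir.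
have s0 : 0 <= sdisc theta I by exact: sqrtr_ge0.
have bs : 2^-1 <= blin I + sdisc theta I by lra.
have bs0 : 0 < blin I + sdisc theta I by lra.
rewrite /Ham /qroot -/(sdisc _ _) normrM normfV (gtr0_norm bs0).
rewrite ler_pdivrMr// normrM ger0_norm//.
have := xlin_le I; have X0 : 0 <= onorm * `|I| by rewrite mulr_ge0 ?onorm_ge0.
nra.
Qed.

Lemma phi_diff theta : differentiable phi theta.
Proof.
by have [] := trig_is_diff s_gt0 s_le1 fbound_ge1 freq_fbound 0 theta e_moment.
Qed.

Lemma derive_phi theta v : 'D_v phi theta = \sum_i v 0 i * dphi i theta.
Proof.
by have [_ ->] := trig_is_diff s_gt0 s_le1 fbound_ge1 freq_fbound 0 theta e_moment.
Qed.

Lemma is_derive_phi theta v :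
  is_derive theta v phi (\sum_i v 0 i * dphi i theta).
Proof.
rewrite -derive_phi; apply/derivableP/diff_derivable; exact: phi_diff.
Qed.

Lemma is_derive_xlin (I v : V) : is_derive I v xlin (xlin v).
Proof.
have H i : is_derive I v (omega 0 i \*: (fun I : V => I 0 i)) (omega 0 i *: v 0 i).
  by apply: is_deriveZ; exact: is_derive_coord.
have := is_derive_sum H; congr (is_derive _ _ _ _).
by apply/funext => y; rewrite fct_sumE.
Qed.

Lemma is_derive_blin (I v : V) : is_derive I v blin (kap * v 0 i1).
Proof.
have H := is_deriveD (is_derive_cst (1 : R) I v) (is_deriveZ kap (is_derive_coord I v i1)).
by rewrite add0r in H.
Qed.

Lemma is_derive_Ham_action theta I i : `|I| < rad ->
  is_derive I (delta_mx 0 i) (Ham theta)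
    ((sdisc theta I)^-1 * uvec (Ham theta I) 0 i).
Proof.
move=> Ir.
have /andP[b1 _] := blin_bounds Ir; have /andP[D1 _] := disc_bounds theta Ir.
have b0 : 0 < blin I by apply: lt_le_trans b1; rewrite invr_gt0.
have D0 : 0 < qdisc (phi theta) (xlin I) (blin I).
  by apply: lt_le_trans D1; rewrite invr_gt0.
apply: is_derive_eq.
  exact: (is_derive_qroot (f := fun=> phi theta) b0 D0 (is_derive_cst _ _ _)
    (is_derive_xlin I (delta_mx 0 i)) (is_derive_blin I (delta_mx 0 i))).
rewrite mulr0 addr0 mulrC; congr (_ * _).
have -> : xlin (delta_mx 0 i) = omega 0 i.
  rewrite /xlin /dot (bigD1 i)//= big1 => [|j ji]; last first.
    by rewrite !mxE (negbTE ji) mulr0.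
  by rewrite !mxE !eqxx mulr1 addr0.
by rewrite !mxE !eqxx /= -/(Ham theta I) mulrA [i1 == i]eq_sym.
Qed.

Lemma grad_action theta I : `|I| < rad ->
  gradient (Ham theta) I = (sdisc theta I)^-1 *: uvec (Ham theta I).
Proof.
move=> Ir; apply/rowP => i.
by rewrite mxE [RHS]mxE /partial; have [] := is_derive_Ham_action theta i Ir.
Qed.

(** At [I = 0] the energy vanishes, so [uvec] is [omega] and [sdisc] is 1: the action gradient is
    exactly [omega]. *)
Lemma Ham_O_I2 : O_I2 (fun theta I => Ham theta I - dot omega I).
Proof.
have x0 : xlin 0 = 0 by rewrite /xlin /dot big1// => i _; rewrite mxE mulr0.
move=> theta; have H0 : Ham theta 0 = 0.
  by rewrite /Ham /qroot x0 mulr0 mul0r.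
split; first by rewrite H0 -/(xlin 0) x0 subrr.
have r0 : `|0 : V| < rad by rewrite normr0.
apply/rowP => i; rewrite !mxE /partial.
have [_ E] := is_deriveB (is_derive_Ham_action theta i r0)
  (is_derive_xlin 0 (delta_mx 0 i)).
rewrite [LHS]E H0 /sdisc /qdisc x0 mulr0 subr0 /blin mxE mulr0 addr0 expr1n.
rewrite sqrtr1 invr1 mul1r /uvec mul0r scale0r subr0 /xlin /dot (bigD1 i)//= big1.
  by rewrite !mxE !eqxx mulr1 addr0 subrr.
by move=> j ji; rewrite !mxE (negbTE ji) mulr0.
Qed.

Lemma grad_angle theta I : `|I| < rad ->
  gradient (fun theta => Ham theta I) theta =
  ((sdisc theta I)^-1 * Ham theta I ^+ 2) *: gradphi theta.
Proof.
move=> Ir; apply/rowP => i; rewrite !mxE /partial.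
have /andP[b1 _] := blin_bounds Ir; have /andP[D1 _] := disc_bounds theta Ir.
have b0 : 0 < blin I by apply: lt_le_trans b1; rewrite invr_gt0.
have D0 : 0 < qdisc (phi theta) (xlin I) (blin I).
  by apply: lt_le_trans D1; rewrite invr_gt0.
have [_ ->] := is_derive_qroot (x := fun=> xlin I) (b := fun=> blin I) b0 D0
  (is_derive_phi theta (delta_mx 0 i)) (is_derive_cst _ _ _) (is_derive_cst _ _ _).
rewrite mulr0 subrr add0r -/(Ham theta I) -/(sdisc theta I).
rewrite (bigD1 i)//= big1 => [|j ji]; last by rewrite !mxE (negbTE ji) mul0r.
by rewrite !mxE !eqxx mul1r addr0; ring.
Qed.

(** * Resonant levels and drift on an energy level *)

Hypothesis eta_gt0 : forall n, 0 < eta n.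
Hypothesis eta_res : forall n,
  dot (kvec n) omega = kap * (Q n)%:~R * eta n.
Hypothesis eta_sep : forall m n, (m < n)%N -> 4 * eta n <= eta m.
Hypothesis ampsum_kap : 400 * ampsum <= kap.

Lemma dot_kvec_uvec m a :
  dot (kvec m) (uvec a) = kap * (Q m)%:~R * (eta m - a).
Proof.
rewrite /uvec dotB eta_res dot_kvec !mxE !eqxx (negbTE i01) /=; ring.
Qed.

(** Distinct levels differ by a factor at least 4; the tight case is [m > n], where
    [eta m <= eta n / 4] and [a >= 3 / 4 * eta n]. *)
Lemma eta_far m n a : m != n -> `|a - eta n| <= eta n / 4 ->
  eta n / 2 <= `|eta m - a|.
Proof.
move=> mn; rewrite ler_norml => /andP[a1 a2].
have em := eta_gt0 m; have en := eta_gt0 n.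
have [h|h|h] := ltngtP m n; last by rewrite h eqxx in mn.
  apply: le_trans (ler_norm _); have := eta_sep h; lra.
by rewrite distrC; apply: le_trans (ler_norm _); have := eta_sep h; lra.
Qed.

(* Fourier coefficients of the primitive of [dphi i], without its [n]-th
   mode, along the direction [uvec a] *)
Definition cprim (n : nat) (a : R) (i : 'I_d) (m : nat) : R :=
  if m == n then 0
  else e m * kvec m 0 i / (kap * (Q m)%:~R * (eta m - a)).

Definition prim n a i : V -> R := trig_series freq (cprim n a i) 0.

(** The entry of [kvec m] is at most [Q m], which cancels the [Q m] of the divisor. The division
    thus costs a factor of order [1 / eta n] uniformly in [m], and no derivatives. *)
Lemma cprim_le n a i m : `|a - eta n| <= eta n / 4 ->
  `|cprim n a i m| <= 2 / (kap * eta n) * e m.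
Proof.
move=> an; rewrite /cprim; have en := eta_gt0 n; have k0 := kap_gt0.
case: eqVneq => [_|mn].
  by rewrite normr0 mulr_ge0// divr_ge0// mulr_ge0 ?ltW.
have far := eta_far mn an; have Q1 := Q_ge1 m.
have Q0 : 0 < (Q m)%:~R :> R by exact: lt_le_trans Q1.
rewrite normrM normfV !normrM (ger0_norm (e_ge0 m)) (gtr0_norm k0) (gtr0_norm Q0).
have eta0 : 0 < `|eta m - a| by apply: lt_le_trans far; rewrite divr_gt0.
rewrite ler_pdivrMr ?mulr_gt0//.
have -> : 2 / (kap * eta n) * e m * (kap * (Q m)%:~R * `|eta m - a|) =
    e m * ((Q m)%:~R * (2 / eta n * `|eta m - a|)).
  by field; rewrite !gt_eqF.
rewrite ler_wpM2l//; apply: le_trans (kvec_le m i) _.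
by rewrite ler_peMr ?(ltW Q0)// mulrAC ler_pdivlMr// mul1r; lra.
Qed.

Lemma cprim_moment n a i : `|a - eta n| <= eta n / 4 ->
  moment_summable fbound (1 + s) (cprim n a i).
Proof.
move=> an; have := abs_summableZ (k := 2 / (kap * eta n)) e_moment.
rewrite /abs_summable; apply: abs_summable_le => m.
rewrite mulrA [leLHS]normrM [leRHS]normrM ler_wpM2r//.
exact: le_trans (cprim_le i m an) (ler_norm _).
Qed.

Lemma prim_le n a i theta : `|a - eta n| <= eta n / 4 ->
  `|prim n a i theta| <= 2 / (kap * eta n) * ampsum.
Proof.
move=> an; rewrite -tsumZ; last exact: e_summable.
apply: tsum_le => [m|]; last exact/abs_summable_cvg/abs_summableZ/e_summable.
apply: le_trans (norm_mul_sin _ _) _; exact: cprim_le.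
Qed.

Lemma freq_uvec m a : dot (freq m) (uvec a) =
  2 * pi * (kap * (Q m)%:~R * (eta m - a)).
Proof. by rewrite /freq dotZ dot_kvec_uvec. Qed.

(** The homological equation: differentiating [prim] along [uvec a] reproduces every mode of
    [dphi i] except the [n]-th. *)
Lemma dphi_resonant n a i theta : `|a - eta n| <= eta n / 4 ->
  dphi i theta - \sum_j uvec a 0 j *
    trig_series freq (fun m => cprim n a i m * freq m 0 j) (0 + pi / 2) theta =
  e n * freq n 0 i * cos (dot (freq n) theta).
Proof.
move=> an; have s0 : 0 <= s by exact: ltW.
have cs j : abs_summable (fun m => cprim n a i m * freq m 0 j).
  apply: (moment_summable0 fbound_ge1 s0).
  by apply: (moment_summable_deriv fbound_ge1 freq_fbound); exact: cprim_moment.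
have es : abs_summable (fun m => e m * freq m 0 i).
  apply: (moment_summable0 fbound_ge1 s0).
  by apply: (moment_summable_deriv fbound_ge1 freq_fbound); exact: e_moment.
have [cs' ->] := trig_gradE 0 theta (uvec a) cs.
rewrite -tsumB//; last exact: trig_term_summable.
rewrite -(tsum_single n (e n * freq n 0 i * cos (dot (freq n) theta))).
congr tsum; apply/funext => m; rewrite add0r sinDpihalf addr0 freq_uvec /cprim.
case: eqVneq => [->|mn]; first by rewrite mul0r subr0.
have eta0 : eta m - a != 0.
  rewrite -normr_gt0; apply: lt_le_trans (eta_far mn an).
  by rewrite divr_gt0.
have Q0 : (Q m)%:~R != 0 :> R by rewrite gt_eqF// (lt_le_trans ltr01 (Q_ge1 m)).
rewrite [freq m 0 i]mxE; field.
by rewrite eta0 Q0 (gt_eqF kap_gt0).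
Qed.

Lemma is_derive_prim (n : nat) (a : R) (i : 'I_d) (th : R -> V) (t c : R) :
  `|a - eta n| <= eta n / 4 -> is_derive t 1 th (c *: uvec a) ->
  is_derive t 1 (fun t => prim n a i (th t))
    (c * (dphi i (th t) - e n * freq n 0 i * cos (dot (freq n) (th t)))).
Proof.
move=> an dth; rewrite -(@dphi_resonant n a i (th t) an) opprB addrC subrK.
have [dP DP] := trig_is_diff s_gt0 s_le1 fbound_ge1 freq_fbound 0 (th t)
  (@cprim_moment n a i an).
have := is_derive_comp dth dP; rewrite DP; congr is_derive.
rewrite mulr_sumr; apply: eq_bigr => j _.
by rewrite [in LHS]mxE mulrA.
Qed.

(** Size of the drift velocity of [I_1] due to mode [n] at [a = eta n], when the cosine is 1 and the
    time factor is 1. *)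
Definition speed n : R := eta n ^+ 2 * (2 * pi * e n * (Q n)%:~R).

Lemma speed_ge0 n : 0 <= speed n.
Proof.
have q0 := le_trans ler01 (Q_ge1 n).
by apply: mulr_ge0; [exact: sqr_ge0|rewrite !mulr_ge0// pi_ge0].
Qed.

(* Curves that follow, up to a change of time, the orbits of [Ham] on the energy
   level [a]. *)
Definition level_curve (a lmin lmax : R) (T0 T1 : R) (th I : R -> V)
    (lam : R -> R) :=
  forall t, Num.min T0 T1 <= t <= Num.max T0 T1 ->
  [/\ is_derive t 1 th (lam t *: uvec a),
      is_derive t 1 I (- ((lam t * a ^+ 2) *: gradphi (th t))) &
      lmin <= lam t <= lmax].

Lemma a2_bounds n a : `|a - eta n| <= eta n / 4 ->
  9 / 16 * eta n ^+ 2 <= a ^+ 2 <= 25 / 16 * eta n ^+ 2.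
Proof.
move=> an; have en := eta_gt0 n; move: an; rewrite ler_norml => /andP[a1 a2].
by rewrite !expr2; apply/andP; split; nra.
Qed.

Section LevelCurve.
Variables (n : nat) (a lmin lmax T : R) (th I : R -> V) (lam : R -> R).
Hypotheses (an : `|a - eta n| <= eta n / 4) (lmin0 : 0 <= lmin).
Hypothesis curve : level_curve a lmin lmax 0 T th I lam.

(** The action corrected by the non-resonant primitive; only mode [n] survives in its derivative. *)
Let W i t : R := I t 0 i + a ^+ 2 * prim n a i (th t).

Let dW i t : Num.min 0 T <= t <= Num.max 0 T ->
  is_derive t 1 (W i) (- (lam t * a ^+ 2 *
    (e n * freq n 0 i * cos (dot (freq n) (th t))))).
Proof.
move=> tT; have [dth dI _] := curve tT.
have dIi : is_derive t 1 (fun t => I t 0 i) (- (lam t * a ^+ 2 * dphi i (th t))).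
  by have := is_derive_entry i dI; rewrite !mxE.
have dP := is_deriveZ (a ^+ 2) (is_derive_prim i an dth).
apply: is_derive_eq (is_deriveD dIi dP) _.
by rewrite -[_ *: _]/(_ * _); ring.
Qed.

Let Wdiff i : `|a ^+ 2 * prim n a i (th T) - a ^+ 2 * prim n a i (th 0)| <=
  eta n / 50.
Proof.
have en := eta_gt0 n; have k0 := kap_gt0; have /andP[_ a2] := a2_bounds an.
have p1 := prim_le i (th T) an; have p2 := prim_le i (th 0) an.
rewrite -mulrBr normrM ger0_norm ?sqr_ge0//.
have pp : `|prim n a i (th T) - prim n a i (th 0)| <= 4 / (kap * eta n) * ampsum.
  apply: le_trans (ler_normB _ _) _; apply: le_trans (lerD p1 p2) _.
  rewrite le_eqVlt; apply/orP; left; apply/eqP; ring.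
apply: le_trans (ler_pM (sqr_ge0 _) (normr_ge0 _) a2 pp) _.
have -> : 25 / 16 * eta n ^+ 2 * (4 / (kap * eta n) * ampsum) =
    eta n * (25 / 4 * (ampsum / kap)) by field; rewrite !gt_eqF.
rewrite ler_wpM2l ?(ltW en)//.
(* The resulting [25 / 4 / 400 = 1 / 64] is below the announced 1/50. *)
have : ampsum / kap <= 400^-1 by rewrite ler_pdivrMr//; move: ampsum_kap; lra.
lra.
Qed.

Lemma level_curve_action i :
  `|I T 0 i - I 0 0 i| <= eta n / 50 + lmax * (25 / 16) * speed n * `|T|.
Proof.
have en := eta_gt0 n; have /andP[_ a2] := a2_bounds an.
have Q0 : 0 <= (Q n)%:~R :> R by exact: le_trans ler01 (Q_ge1 n).
have -> : I T 0 i - I 0 0 i = (W i T - W i 0) -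
    (a ^+ 2 * prim n a i (th T) - a ^+ 2 * prim n a i (th 0)).
  by rewrite /W; ring.
apply: le_trans (ler_normB _ _) _; rewrite addrC lerD ?Wdiff//.
have := @norm_increment_le _ (W i) _ 0 T (lmax * (25 / 16) * speed n) (@dW i).
rewrite subr0; apply => t tT; have [_ _ /andP[l1 l2]] := curve tT.
have l0 : 0 <= lam t by exact: le_trans l1.
rewrite normrN normrM (ger0_norm (mulr_ge0 l0 (sqr_ge0 a))).
have X : `|e n * freq n 0 i * cos (dot (freq n) (th t))| <=
    2 * pi * e n * (Q n)%:~R.
  have c1 : `|cos (dot (freq n) (th t))| <= 1 by rewrite ler_norml cos_geN1 cos_le1.
  rewrite normrM; apply: le_trans (ler_piMr _ c1) _ => //.
  rewrite mxE !normrM (ger0_norm (e_ge0 n)) (ger0_norm (pi_ge0 R)) normr_nat.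
  have -> : e n * (2 * pi * `|kvec n 0 i|) = 2 * pi * e n * `|kvec n 0 i| by ring.
  by rewrite ler_wpM2l ?kvec_le// !mulr_ge0 ?pi_ge0.
apply: le_trans (ler_pM _ _ (ler_pM l0 (sqr_ge0 a) l2 a2) X) _ => //.
  by rewrite mulr_ge0 ?sqr_ge0.
by rewrite le_eqVlt /speed; apply/orP; left; apply/eqP; ring.
Qed.

(** While the cosine stays above 1/2 the resonant term keeps its sign and [I_1] decreases; 9/32 is
    the 9/16 of [a2_bounds] times 1/2. *)
Lemma level_curve_drift : 0 <= T ->
  (forall t, 0 <= t <= T -> 2^-1 <= cos (dot (freq n) (th t))) ->
  lmin * (9 / 32) * speed n * T - eta n / 50 <= I 0 0 i1 - I T 0 i1.
Proof.
move=> T0 cosP; have en := eta_gt0 n; have /andP[a1 _] := a2_bounds an.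
have Q0 : 0 <= (Q n)%:~R :> R by exact: le_trans ler01 (Q_ge1 n).
have [||t] := @MVT_segment _ (W i1) (fun t => - (lam t * a ^+ 2 *
    (e n * freq n 0 i1 * cos (dot (freq n) (th t))))) 0 T T0.
- move=> t; rewrite in_itv/= => /andP[t1 t2]; apply: dW.
  by rewrite (min_idPl T0) (max_idPr T0) !ltW.
- apply: derivable_within_continuous => t; rewrite in_itv/= => tT.
  have [] // := @dW i1 t _.
  by rewrite (min_idPl T0) (max_idPr T0).
rewrite in_itv/= => tT; rewrite subr0 => WE.
have tT' : Num.min 0 T <= t <= Num.max 0 T by rewrite (min_idPl T0) (max_idPr T0).
have [_ _ /andP[l1 l2]] := curve tT'.
have := Wdiff i1; rewrite ler_norml => /andP[w1 w2].
have -> : I 0 0 i1 - I T 0 i1 = - (W i1 T - W i1 0) +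
    (a ^+ 2 * prim n a i1 (th T) - a ^+ 2 * prim n a i1 (th 0)).
  by rewrite /W; ring.
rewrite WE; apply: lerD; last exact: w1.
rewrite mulNr opprK ler_wpM2r//.
have l0 : 0 <= lam t by exact: le_trans l1.
have -> : lmin * (9 / 32) * speed n =
    lmin * (9 / 16 * eta n ^+ 2) * ((2 * pi * e n * (Q n)%:~R) * 2^-1).
  by rewrite /speed; field.
have e0 := e_ge0 n; have p0 := pi_ge0 R.
have h0 : 0 <= 9 / 16 * eta n ^+ 2 by rewrite mulr_ge0 ?sqr_ge0.
have h1 : 0 <= 2 * pi * e n * (Q n)%:~R by rewrite !mulr_ge0.
apply: ler_pM.
- exact: mulr_ge0.
- by rewrite mulr_ge0.
- exact: ler_pM.
have -> : e n * freq n 0 i1 = 2 * pi * e n * (Q n)%:~R.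
  by rewrite !mxE !eqxx eq_sym (negbTE i01); ring.
by rewrite ler_wpM2l ?mulr_ge0// cosP.
Qed.

Lemma level_curve_phase :
  `|dot (freq n) (th T) - dot (freq n) (th 0)| <=
    lmax * (2 * pi * (kap * (Q n)%:~R * `|a - eta n|)) * `|T|.
Proof.
have Q0 : 0 <= (Q n)%:~R :> R by exact: le_trans ler01 (Q_ge1 n).
have dg t : Num.min 0 T <= t <= Num.max 0 T ->
    is_derive t 1 (fun t => dot (freq n) (th t)) (lam t * dot (freq n) (uvec a)).
  move=> tT; have [dth _ _] := curve tT.
  have := is_derive_dot (freq n) dth; congr is_derive.
  by rewrite [LHS]dotC dotZ dotC.
have := @norm_increment_le _ _ _ 0 T
  (lmax * (2 * pi * (kap * (Q n)%:~R * `|a - eta n|))) dg.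
rewrite subr0; apply => t tT; have [_ _ /andP[l1 l2]] := curve tT.
have l0 : 0 <= lam t by exact: le_trans l1.
rewrite normrM (ger0_norm l0) freq_uvec ler_pM//.
rewrite !normrM distrC (ger0_norm Q0) (gtr0_norm kap_gt0) (gtr0_norm (pi_gt0 R)).
by rewrite ger0_norm.
Qed.

End LevelCurve.

(** * From curves on an energy level to solutions of Hamilton's equations *)

Lemma solution_derivatives (al be : R) (z : R -> V * V) t :
  hamiltonian_solution rad Ham al be z -> al < t < be ->
  let a := Ham (z t).1 (z t).2 in
  let lam := (sdisc (z t).1 (z t).2)^-1 in
  [/\ `|(z t).2| < rad,
      is_derive t 1 (fun r => (z r).1) (lam *: uvec a) &
      is_derive t 1 (fun r => (z r).2)
        (- ((lam * a ^+ 2) *: gradphi (z t).1))].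
Proof.
by move=> sol /sol[Ir]; rewrite grad_action// grad_angle.
Qed.

Lemma dot_uvec a (y : V) : dot (uvec a) y = xlin y - a * (kap * y 0 i1).
Proof.
rewrite dotC /uvec dotB dotC -/(xlin y); congr (_ - _).
rewrite dotC dotZ mulrA; congr (_ * _).
rewrite /dot (bigD1 i1)//= big1 => [|j ji]; last first.
  by rewrite !mxE (negbTE ji) mul0r.
by rewrite !mxE !eqxx mul1r addr0.
Qed.

Lemma dphi_dot theta (y : V) :
  \sum_i y 0 i * dphi i theta = dot y (gradphi theta).
Proof. by apply: eq_bigr => i _; rewrite mxE. Qed.

Lemma Ham_conserved (al be : R) (z : R -> V * V) (t1 t2 : R) :
  hamiltonian_solution rad Ham al be z -> al < t1 < be -> al < t2 < be ->
  Ham (z t1).1 (z t1).2 = Ham (z t2).1 (z t2).2.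
Proof.
move=> sol /andP[l1 r1] /andP[l2 r2]; apply/eqP; rewrite -subr_eq0 -normr_le0.
have := @norm_increment_le _ (fun t => Ham (z t).1 (z t).2) (fun=> 0) t2 t1 0.
rewrite mul0r; apply; last by move=> *; rewrite normr0.
move=> t /andP[tl tr].
have tab : al < t < be.
  rewrite (lt_le_trans _ tl) ?lt_min ?l1 ?l2//=.
  by rewrite (le_lt_trans tr)// gt_max r1 r2.
have [Ir dth dI] := solution_derivatives sol tab.
have /andP[b1 _] := blin_bounds Ir; have /andP[D1 _] := disc_bounds (z t).1 Ir.
have b0 : 0 < blin (z t).2 by apply: lt_le_trans b1; rewrite invr_gt0.
have D0 : 0 < qdisc (phi (z t).1) (xlin (z t).2) (blin (z t).2).
  by apply: lt_le_trans D1; rewrite invr_gt0.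
have df := is_derive_comp dth (phi_diff (z t).1).
have dx := is_derive_dot omega dI.
have db := is_deriveD (is_derive_cst (1 : R) t (1 : R))
  (is_deriveZ kap (is_derive_entry i1 dI)).
apply: is_derive_eq; first exact: (is_derive_qroot (V := R)
  (f := fun r => phi (z r).1) (x := fun r => xlin (z r).2)
  (b := fun r => blin (z r).2) b0 D0 df dx db).
rewrite derive_phi dphi_dot -/(Ham (z t).1 (z t).2) -/(sdisc (z t).1 (z t).2).
set a := Ham _ _; set lam := _^-1; set g := gradphi _.
rewrite add0r -/(xlin _) -[kap *: _]/(kap * _) -dot_uvec dotZ.
have -> : dot (uvec a) (- ((lam * a ^+ 2) *: g)) =
    - (lam * a ^+ 2 * dot (uvec a) g).
  by rewrite dotC -scaleNr dotZ mulNr dotC.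
set y := dot _ _.
have -> : - (lam * a ^+ 2 * y) + a ^+ 2 * (lam * y) = 0 by ring.
by rewrite mul0r.
Qed.

Lemma solution_level_curve (al be T : R) (z : R -> V * V) :
  hamiltonian_solution rad Ham al be z -> al < 0 < be -> al < T < be ->
  level_curve (Ham (z 0).1 (z 0).2) 2^-1 4 0 T (fun t => (z t).1)
    (fun t => (z t).2) (fun t => (sdisc (z t).1 (z t).2)^-1).
Proof.
move=> sol ab0 abT t /andP[tl tr].
have tab : al < t < be.
  move: ab0 abT => /andP[h1 h2] /andP[h3 h4].
  rewrite (lt_le_trans _ tl) ?lt_min ?h1 ?h3//=.
  by rewrite (le_lt_trans tr)// gt_max h2 h4.
have [Ir dth dI] := solution_derivatives sol tab.
rewrite (Ham_conserved sol ab0 tab); split => //.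
have /andP[s1 s2] := sdisc_bounds (z t).1 Ir.
have s0 : 0 < sdisc (z t).1 (z t).2 by apply: lt_le_trans s1; rewrite invr_gt0.
by rewrite lef_pV2 ?posrE// s2 -[leRHS]invrK lef_pV2 ?posrE ?invr_gt0.
Qed.

Lemma dphi_continuous i (a : R) (theta : V) (t : R) :
  {for t, continuous (fun r : R => dphi i (theta + r *: uvec a))}.
Proof.
have md : moment_summable fbound (1 + s) (fun n => e n * freq n 0 i).
  exact: (moment_summable_deriv fbound_ge1 freq_fbound).
have [dd _] := trig_is_diff s_gt0 s_le1 fbound_ge1 freq_fbound (0 + pi / 2)
  (theta + t *: uvec a) md.
have [dl _] := is_derive_comp (is_derive_affine theta (uvec a) t) dd.
exact/differentiable_continuous/derivable1_diffP.
Qed.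

(** In an auxiliary time the angles move with constant velocity [uvec a] and the action is a
    primitive. Physical time [T] has derivative [sdisc >= 1 / 4] in it, so auxiliary times up to [S]
    cover physical times up to [S / 4]. *)
Lemma exists_solution n (theta0 I0 : V) (S : R) : 0 < S ->
  let a := Ham theta0 I0 in `|a - eta n| <= eta n / 4 ->
  `|I0| + eta n / 50 + 25 / 16 * speed n * S < rad ->
  exists (al be : R) (z : R -> V * V),
    [/\ al <= - (S / 4), S / 4 <= be, hamiltonian_solution rad Ham al be z &
        z 0 = (theta0, I0)].
Proof.
move=> S0 a an Irad; have en := eta_gt0 n; have sp := speed_ge0 n.
have X1 : 0 <= eta n / 50 by rewrite divr_ge0// ltW.
have X2 : 0 <= 25 / 16 * speed n * S by rewrite mulr_ge0 ?(ltW S0)// mulr_ge0.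
have I0r : `|I0| < rad by lra.
pose th (r : R) := theta0 + r *: uvec a.
(* The margins [S + 2] here and [S + 1] for [T] are needed because [exists_primitive] asks for
   continuity on a closed interval and differentiates only inside. *)
have /choice[G GP] : forall i, exists G : R -> R, G 0 = 0 /\
    forall t : R, `|t| < S + 2 -> is_derive t 1 G (dphi i (th t)).
  move=> i; apply: exists_primitive; last by rewrite addr_gt0.
  by move=> t _; exact: dphi_continuous.
pose I (r : R) : V := I0 - a ^+ 2 *: \row_i G i r.
have dth (t : R) : is_derive t 1 th (uvec a) by exact: is_derive_affine.
have dI (t : R) : `|t| < S + 2 -> is_derive t 1 I (- (a ^+ 2 *: gradphi (th t))).
  move=> tS; apply: is_derive_row => i; rewrite !mxE.
  have dG := is_deriveB (is_derive_cst (I0 0 i) t (1 : R))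
    (is_deriveZ (a ^+ 2) ((GP i).2 t tS)).
  rewrite sub0r in dG; move: dG; congr (is_derive _ _ _ _).
  by apply/funext => r; rewrite !mxE.
have th0 : th 0 = theta0 by rewrite /th scale0r addr0.
have I00 : I 0 = I0.
  by apply/rowP => i; rewrite !mxE (GP i).1 mulr0 subr0.
have Ibound (t : R) : `|t| <= S -> `|I t| < rad.
  move=> tS; apply: le_lt_trans Irad.
  have cv : level_curve a 1 1 0 t th I (fun=> 1).
    move=> r /andP[r1 r2]; split; [by rewrite scale1r; exact: dth| |by rewrite lexx].
    rewrite mul1r; apply: dI; have := ler_norm t; have := ler_norm (- t); rewrite normrN.
    move: r1 r2; have [h|h] := leP 0 t; rewrite ltr_norml => *; apply/andP; split; lra.
  apply: norm_le_entry.
    by rewrite !addr_ge0.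
  move=> i; have := level_curve_action an ler01 cv i; rewrite I00 => h.
  have -> : I t 0 i = I0 0 i + (I t 0 i - I0 0 i) by rewrite addrC subrK.
  apply: le_trans (ler_normD _ _) _; rewrite -addrA lerD ?entry_le_norm//.
  apply: le_trans h _; rewrite mul1r lerD2l.
  by rewrite ler_wpM2l// mulr_ge0.
have energy (t : R) : `|t| <= S ->
    a * blin (I t) - a ^+ 2 * phi (th t) = xlin (I t).
  move=> tS.
  have [aE _] := Ham_eq theta0 I0r; rewrite -/a in aE.
  (* This quantity is conserved because the angular velocity is [uvec a]. Its initial value is [a],
     and that equality is the quadratic equation of the energy. *)
  suff E : dot (uvec a) (I t) + a ^+ 2 * phi (th t) =
      dot (uvec a) (I 0) + a ^+ 2 * phi (th 0).
    move: E; rewrite !dot_uvec I00 th0 -aE /blin => E.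
    have -> : xlin (I t) = (xlin (I t) - a * (kap * I t 0 i1) +
      a ^+ 2 * phi (th t)) + a * (kap * I t 0 i1) - a ^+ 2 * phi (th t) by ring.
    by rewrite E; ring.
  apply/eqP; rewrite -subr_eq0 -normr_le0.
  have := @norm_increment_le _ (fun t => dot (uvec a) (I t) + a ^+ 2 * phi (th t))
    (fun=> 0) 0 t 0; rewrite mul0r; apply; last by move=> *; rewrite normr0.
  move=> r /andP[r1 r2].
  have rS : `|r| < S + 2.
    have := ler_norm t; have := ler_norm (- t); rewrite normrN.
    move: r1 r2; have [h|h] := leP 0 t; rewrite ltr_norml => *; apply/andP; split; lra.
  have d1 := is_derive_dot (uvec a) (dI r rS).
  have d2 := is_deriveZ (a ^+ 2) (is_derive_comp (dth r) (phi_diff (th r))).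
  apply: is_derive_eq (is_deriveD d1 d2) _.
  rewrite derive_phi dphi_dot -[_ *: _ in X in _ + X]/(_ * _).
  by rewrite dotC -scaleNr dotZ mulNr [dot (gradphi _) _]dotC addNr.
(* The expected value of [sdisc] along the curve; its positivity selects the branch in
   [qroot_unique]. *)
pose g (t : R) := blin (I t) - 2 * a * phi (th t).
have gb (t : R) : `|t| <= S -> 4^-1 <= g t <= 2.
  move=> tS; have /andP[b1 b2] := blin_bounds (Ibound t tS).
  have : `|2 * a * phi (th t)| <= 4^-1.
    rewrite normrM normrM normr_nat.
    apply: (@le_trans _ _ (2 * (4 * onorm * rad) * ampsum)); last first.
      by move: ampsum_small; lra.
    rewrite ler_pM ?mulr_ge0 ?phi_le// ler_wpM2l//.
    apply: le_trans (Ham_le theta0 I0r) _.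
    by rewrite ler_wpM2l ?mulr_ge0 ?onorm_ge0// ltW.
  rewrite ler_norml => /andP[h1 h2]; rewrite /g; apply/andP; split; lra.
have HamE (t : R) : `|t| <= S -> Ham (th t) (I t) = a /\ sdisc (th t) (I t) = g t.
  move=> tS; have /andP[b1 _] := blin_bounds (Ibound t tS).
  have /andP[g1 _] := gb t tS.
  have b0 : 0 < blin (I t) by apply: lt_le_trans b1; rewrite invr_gt0.
  have g0 : 0 < g t by apply: lt_le_trans g1; rewrite invr_gt0.
  by have [] := qroot_unique b0 g0 (energy t tS).
have [T [T0 TP]] : exists T : R -> R, T 0 = 0 /\
    forall t : R, `|t| < S + 1 -> is_derive t 1 T (g t).
  apply: exists_primitive; last by rewrite addr_gt0.
  move=> t tS; apply/differentiable_continuous/derivable1_diffP.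
  have d1 := is_derive_entry i1 (dI t (le_lt_trans tS _)).
  have d2 := is_derive_comp (dth t) (phi_diff (th t)).
  have [] // := is_deriveB (is_deriveD (is_derive_cst (1 : R) t (1 : R))
    (is_deriveZ kap (d1 _))) (is_deriveZ (2 * a) d2).
  by rewrite ltrD2l ltr1n.
have TP' (t : R) : `|t| <= S -> is_derive t 1 T (g t).
  by move=> tS; apply: TP; apply: le_lt_trans tS _; rewrite ltrDl.
have gpos (t : R) : `|t| <= S -> 0 < g t.
  by move=> /gb/andP[g1 _]; apply: lt_le_trans g1; rewrite invr_gt0.
have Tinc (x y : R) : - S <= x -> x <= y -> y <= S -> (y - x) / 4 <= T y - T x.
  move=> Sx xy yS.
  have inS (t : R) : x <= t <= y -> `|t| <= S.
    by move=> /andP[t1 t2]; rewrite ler_norml; apply/andP; split; lra.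
  have [||t] := @MVT_segment _ T g x y xy.
  - by move=> t; rewrite in_itv/= => /andP[t1 t2]; apply/TP'/inS; rewrite !ltW.
  - apply: derivable_within_continuous => t; rewrite in_itv/= => txy.
    by have [] := TP' t (inS _ txy).
  rewrite in_itv/= => txy ->; rewrite mulrC ler_wpM2r ?subr_ge0//.
  by have /andP[] := gb t (inS _ txy).
have [sg sgP] := exists_inverse S0 TP' gpos.
have TS1 : S / 4 <= T S by have := Tinc 0 S; rewrite T0 !subr0; apply => //; lra.
have TS2 : T (- S) <= - (S / 4).
  have := Tinc (- S) 0; rewrite T0 sub0r opprK => h.
  have : S / 4 <= 0 - T (- S) by apply: h => //; lra.
  lra.
have sg0 : sg 0 = 0.
  have [|sS Tsg _] := sgP 0; first by apply/andP; split; lra.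
  move: sS; rewrite ltr_norml => /andP[s1 s2].
  have [h|h] := leP 0 (sg 0).
    by have := Tinc 0 (sg 0) _ h (ltW s2); rewrite Tsg T0 subr0 => h'; lra.
  by have := Tinc (sg 0) 0 (ltW s1) (ltW h) _; rewrite Tsg T0 => h'; lra.
exists (T (- S)), (T S), (fun r => (th (sg r), I (sg r))).
split => //; last by rewrite sg0 th0 I00.
move=> r /sgP[sS Tsg dsg]; have sS' := ltW sS.
have [HE sE] := HamE _ sS'.
rewrite /= grad_action ?grad_angle ?Ibound// HE sE; split => //.
  exact: is_derive_scale_comp (dth _) dsg.
have dIsg := dI (sg r) (lt_le_trans sS _).
rewrite -scalerA -scalerN; apply: is_derive_scale_comp dsg.
by apply: dIsg; rewrite lerDl.
Qed.

(** * Periodicity and Hoelder regularity of the Hamiltonian *)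

Lemma dot_freq_of_int n (k : 'rV[int]_d) :
  exists z : int, dot (freq n) (of_int R k) = pi *+ 2 * z%:~R.
Proof.
exists (Q n * k 0 i1 - P n * k 0 i0).
by rewrite /freq dotZ dot_kvec !mxE intrB !intrM mulr2n; ring.
Qed.

Lemma sin_add_period (y : R) (z : int) : sin (y + pi *+ 2 * z%:~R) = sin y.
Proof.
case: z => m; first by rewrite -pmulrn mulr_natr (periodicn (@sinD2pi R)).
rewrite NegzE intrN mulrN -[in RHS](subrK (pi *+ 2 * m.+1%:R) y).
by rewrite -pmulrn [in RHS]mulr_natr (periodicn (@sinD2pi R)) mulr_natr.
Qed.

Lemma sin_freq_translate n theta (k : 'rV[int]_d) (b : R) :
  sin (dot (freq n) (theta + of_int R k) + b) = sin (dot (freq n) theta + b).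
Proof.
have [z zE] := dot_freq_of_int n k.
by rewrite dotD zE addrAC sin_add_period.
Qed.

Lemma cos_freq_translate n theta (k : 'rV[int]_d) :
  cos (dot (freq n) (theta + of_int R k)) = cos (dot (freq n) theta).
Proof. by rewrite -!sinDpihalf sin_freq_translate. Qed.

Lemma phi_translate theta (k : 'rV[int]_d) :
  phi (theta + of_int R k) = phi theta.
Proof.
by congr tsum; apply/funext => n; rewrite sin_freq_translate.
Qed.

Lemma Ham_translate theta I (k : 'rV[int]_d) :
  Ham (theta + of_int R k) I = Ham theta I.
Proof. by rewrite /Ham phi_translate. Qed.

Let dom : set 'rV[R]_(d + d) := [set x | `|rsubmx x| < rad].

Let dom_open : open dom.
Proof.
have rc : continuous (fun x : 'rV[R]_(d + d) => `|rsubmx x|).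
  move=> x; apply: (@continuous_comp _ _ _ (@rsubmx R 1 d d) (fun y => `|y|)).
    exact/differentiable_continuous/differentiable_rsubmx.
  exact: norm_continuous.
have -> : dom = (fun x : 'rV[R]_(d + d) => `|rsubmx x|) @^-1` [set y | y < rad] by [].
by apply: open_comp; [move=> x _; exact: rc|exact: open_lt].
Qed.

Let dom_convex x y (t : R) : dom x -> dom y -> 0 <= t <= 1 ->
  dom (x + t *: (y - x)).
Proof.
rewrite /dom /= => xr yr /andP[t0 t1].
have -> : rsubmx (x + t *: (y - x)) = (1 - t) *: rsubmx x + t *: rsubmx y.
  by apply/rowP => i; rewrite !mxE; ring.
apply: le_lt_trans (ler_normD _ _) _; rewrite !normrZ !ger0_norm ?subr_ge0//.
have [->|tn0] := eqVneq t 0; first by rewrite subr0 mul1r mul0r addr0.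
have tp : 0 < t by rewrite lt0r tn0.
have -> : rad = (1 - t) * rad + t * rad by ring.
by apply: ler_ltD; [rewrite ler_wpM2l ?subr_ge0//; exact: ltW|rewrite ltr_pM2l].
Qed.

Lemma Ham_holder (l : R) : 0 <= l - (Num.truncn l)%:R <= s ->
  moment_summable fbound ((Num.truncn l)%:R + s) e ->
  holder_torus_ball l rad Ham.
Proof.
move=> ls em; split; first by move=> theta I k _; exact: Ham_translate.
rewrite -/dom; set q := Num.truncn l in ls em *.
apply: (holder_class_holder dom_open s_gt0 ls); rewrite -/q.
have coord i : holder_class dom s q (fun x => rsubmx x 0 i).
  have H : holder_class dom s q (fun x => x 0 (rshift d i)).
    apply: holder_class_coord => //; exists rad => x xD.
    have := entry_le_norm (rsubmx x) i; rewrite mxE => /le_trans; apply.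
    exact: ltW.
  by apply: eq_holder_class H => // x _; rewrite mxE.
have hx : holder_class dom s q (fun x => xlin (rsubmx x)).
  apply: holder_class_sum => // i; apply: holder_classM => //.
  exact: holder_class_cst.
have hb : holder_class dom s q (fun x => blin (rsubmx x)).
  apply: holder_classD => //; first exact: holder_class_cst.
  by apply: holder_classM => //; exact: holder_class_cst.
have hphi : holder_class dom s q (fun x => phi (lsubmx x)).
  (* On the full phase space [phi] is again a trigonometric series, with zero frequencies in the
     action coordinates. *)
  have Kb n : \sum_i `|row_mx (freq n) (0 : V) 0 i| <= fbound n.
    rewrite big_split_ord /= [X in _ + X]big1 => [|i _]; last first.
      by rewrite row_mxEr mxE normr0.
    rewrite addr0; apply: le_trans (freq_fbound n).
    by apply: ler_sum => i _; rewrite row_mxEl.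
  have := trig_holder_class s_gt0 s_le1 fbound_ge1 Kb 0 dom_open dom_convex em.
  apply: eq_holder_class => // x _; congr tsum; apply/funext => n.
  congr (_ * sin (_ + _)); rewrite /dot big_split_ord /= [X in _ + X]big1 => [|i _].
    by rewrite addr0; apply: eq_bigr => i _; rewrite row_mxEl [lsubmx x 0 i]mxE.
  by rewrite row_mxEr mxE mul0r.
have hdisc : holder_class dom s q
    (fun x => qdisc (phi (lsubmx x)) (xlin (rsubmx x)) (blin (rsubmx x))).
  have h := holder_classD dom_open (holder_classM dom_open dom_convex s_le1 hb hb)
    (holder_classM dom_open dom_convex s_le1 (holder_class_cst s dom_open q (-4))
       (holder_classM dom_open dom_convex s_le1 hphi hx)).
  apply: eq_holder_class h => // x _; rewrite /qdisc; ring.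
have hs : holder_class dom s q (fun x => sdisc (lsubmx x) (rsubmx x)).
  apply: (holder_class_sqrt dom_open dom_convex s_le1 _ _ hdisc (c := 8^-1)) => //.
  by move=> x xD; have /andP[] := disc_bounds (lsubmx x) xD.
have hbs := holder_classD dom_open hb hs.
have hV := holder_classV dom_open dom_convex s_le1 _ _ hbs (c := 2^-1).
have h := holder_classM dom_open dom_convex s_le1
  (holder_classM dom_open dom_convex s_le1 (holder_class_cst s dom_open q 2) hx)
  (hV _ _).
apply: eq_holder_class (h _ _) => //.
move=> x xD; have /andP[b1 _] := blin_bounds xD.
by apply: le_trans b1 _; rewrite lerDl sqrtr_ge0.
Qed.

(** * Orbits that start close to a resonant level *)

Definition philip : R := tsum (fun m => e m * fbound m).

Lemma fbound_summable : abs_summable (fun m => e m * fbound m).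
Proof.
have h : moment_summable fbound 1 e.
  by apply: (moment_summable_le fbound_ge1 _ e_moment); rewrite lerDl ltW.
apply: abs_summable_le h => m; have f0 := le_trans ler01 (fbound_ge1 m).
by rewrite powRr1// ger0_norm ?mulr_ge0.
Qed.

Lemma phi_lip theta : `|phi theta| <= philip * `|theta|.
Proof.
rewrite mulrC -tsumZ; last exact: fbound_summable.
apply: tsum_le => [m|]; last exact/abs_summable_cvg/abs_summableZ/fbound_summable.
rewrite addr0 normrM ger0_norm// mulrCA ler_wpM2l//.
have := sin_lipschitz 0 (dot (freq m) theta); rewrite sin0 !subr0 => /le_trans.
by apply; rewrite mulrC; exact: (dot_le freq_fbound).
Qed.

Section Orbits.
Variables (n : nat) (tn c : R).
Hypotheses (omega0 : omega 0 i0 = 1) (tn_gt0 : 0 < tn) (c_gt0 : 0 < c).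
(** The 20 is large enough for the drift, [1 / 2 * 9 / 32 * 20 > 2 + 1 / 4 + 1 / 50]. The 200 leaves
    room in the ball for the excursion [25 / 16 * 5 * 20 = 156.25] levels allowed in
    [orbit_defined]. The 1/16 keeps the initial phase below 1/4. *)
Hypotheses (speed_tn : speed n * tn = 20 * eta n) (eta_rad : 200 * eta n < rad)
  (Q_eta : (Q n)%:~R * eta n <= 16^-1).

(** Lipschitz constant of the energy at the base point, read off from
    [a = x - a * kap * I_1 + a ^ 2 * phi] with [|a| <= 4 * onorm * rad]. *)
Definition enlip : R :=
  onorm + 4 * onorm * rad * kap + (4 * onorm * rad) ^+ 2 * philip.

(** The first condition keeps the energy within [eta n / 4] of the level; the second keeps the phase
    shift below 1/4 up to time [tn]. *)
Hypotheses (c_enlip : enlip <= c * tn) (c_phase : 8 * pi * kap * enlip <= c).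

(** With angle 0 this point lies exactly on the level [eta n]: the sines vanish, [b = 1] since
    [I_1 = 0], and [omega 0 i0 = 1]. The phase of mode [n] is 0 there. *)
Definition I_init : V := eta n *: delta_mx 0 i0.

Lemma norm_I_init : `|I_init| = eta n.
Proof.
have en := eta_gt0 n; apply/eqP; rewrite eq_le; apply/andP; split.
  apply: norm_le_entry => [|i]; first exact: ltW.
  rewrite !mxE eqxx /=; case: eqP => _; last by rewrite mulr0 normr0 ltW.
  by rewrite mulr1 gtr0_norm.
by have := entry_le_norm I_init i0; rewrite !mxE !eqxx mulr1 gtr0_norm.
Qed.

Variable p : V * V.
Hypothesis p_near :
  phase_dist p (0, I_init) < `|I_init| / 4 * expR (- (c * `|tn|)).

Let rr : R := eta n / 4 * expR (- (c * tn)).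

Let rr_gt0 : 0 < rr.
Proof. by rewrite mulr_gt0 ?expR_gt0// divr_gt0. Qed.

Let rr_le : rr <= eta n / 4.
Proof.
rewrite ler_piMr ?divr_ge0 ?(ltW (eta_gt0 n))// -expR0 ler_expR.
by rewrite oppr_le0 mulr_ge0// ltW.
Qed.

Let p_action : `|p.2 - I_init| < rr.
Proof.
move: p_near; rewrite /phase_dist norm_I_init (gtr0_norm tn_gt0) -/rr gt_max.
by move=> /andP[].
Qed.

Let p_angle : exists k : 'rV[int]_d, `|p.1 + of_int R k| < rr.
Proof.
move: p_near; rewrite /phase_dist norm_I_init (gtr0_norm tn_gt0) -/rr gt_max.
move=> /andP[+ _]; rewrite /torus_dist => /inf_lt[].
  by exists `|p.1 - 0 + of_int R 0|, 0.
by move=> _ [k _ <-] /=; rewrite subr0 => kr; exists k.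
Qed.

Let p2_norm : `|p.2| <= eta n + rr.
Proof.
have -> : p.2 = I_init + (p.2 - I_init) by rewrite addrC subrK.
apply: le_trans (ler_normD _ _) _; rewrite norm_I_init lerD2l.
exact: ltW p_action.
Qed.

Let p2_rad : `|p.2| < rad.
Proof. have := eta_gt0 n; move: p2_norm rr_le eta_rad; lra. Qed.

Let a := Ham p.1 p.2.

Let a_enlip : `|a - eta n| <= enlip * rr.
Proof.
have [k kr] := p_angle; set th1 := p.1 + of_int R k in kr.
have aE : a = Ham th1 p.2 by rewrite /a /th1 Ham_translate.
have [rE _] := Ham_eq th1 p2_rad; rewrite -aE in rE.
have a_le : `|a| <= 4 * onorm * rad.
  apply: le_trans (Ham_le p.1 p2_rad) _.
  by rewrite ler_wpM2l ?mulr_ge0 ?onorm_ge0// ltW.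
have xE : xlin p.2 - eta n = xlin (p.2 - I_init).
  rewrite /xlin dotB; congr (_ - _).
  rewrite dotC /I_init dotZ dotC /dot (bigD1 i0)//= big1 => [|i ii0]; last first.
    by rewrite !mxE (negbTE ii0) mulr0.
  by rewrite mxE !eqxx omega0 !mulr1 addr0 mulr1.
have yE : p.2 0 i1 = (p.2 - I_init) 0 i1.
  by rewrite !mxE [i1 == i0]eq_sym (negbTE i01) mulr0 subr0.
have -> : a - eta n = xlin (p.2 - I_init) - a * (kap * (p.2 - I_init) 0 i1) +
    a ^+ 2 * phi th1.
  by rewrite -xE -yE -rE /blin; ring.
have kp := kap_gt0.
have y1 := entry_le_norm (p.2 - I_init) i1.
have x1 := xlin_le (p.2 - I_init).
have ph0 : 0 <= philip.
  apply: le_trans (normr_ge0 (tsum (fun m => e m * fbound m))) _.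
  apply: tsum_le => [m|]; last exact: abs_summable_cvg fbound_summable.
  by rewrite ger0_norm// mulr_ge0// (le_trans ler01 (fbound_ge1 m)).
apply: le_trans (ler_normD _ _) _; rewrite /enlip mulrDl; apply: lerD.
  apply: le_trans (ler_normB _ _) _; rewrite mulrDl; apply: lerD.
    by apply: le_trans x1 _; rewrite ler_wpM2l ?onorm_ge0// ltW.
  rewrite -[leRHS]mulrA normrM; apply: ler_pM => //.
  rewrite normrM gtr0_norm// ler_wpM2l ?(ltW kp)//.
  exact: le_trans y1 (ltW p_action).
rewrite normrM normrX -mulrA; apply: ler_pM => //.
  by rewrite lerXn2r ?nnegrE// !mulr_ge0 ?onorm_ge0// ltW.
apply: le_trans (phi_lip _) _; rewrite ler_wpM2l//; exact: ltW.
Qed.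

Let enlip_exp : enlip * expR (- (c * tn)) <= 1.
Proof.
rewrite expRN ler_pdivrMr ?expR_gt0// mul1r; apply: le_trans c_enlip _.
by apply: le_trans (expR_ge1Dx _); rewrite lerDr.
Qed.

Let a_eta : `|a - eta n| <= eta n / 4.
Proof.
apply: le_trans a_enlip _; rewrite /rr mulrCA ler_piMr//.
by rewrite divr_ge0// ltW.
Qed.

Lemma orbit_defined t : `|t| <= tn -> flow_defined rad Ham t p.
Proof.
move=> ttn; have en := eta_gt0 n.
(* A quarter of [5 * tn] exceeds [tn], so the open interval of existence contains the closed one. *)
have S0 : 0 < 5 * tn by rewrite mulr_gt0.
have [|al [be [z [al1 be1 sol z0]]]] := exists_solution S0 a_eta.
  have -> : 25 / 16 * speed n * (5 * tn) = 125 / 16 * (speed n * tn) by ring.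
  by rewrite speed_tn; move: p2_norm rr_le eta_rad; lra.
move: ttn; rewrite ler_norml => /andP[t1 t2].
exists (z t), al, be, z; split => //.
- by apply/andP; split; lra.
- by apply/andP; split; lra.
by rewrite z0; case: p.
Qed.

(** Stated for every [q] related to [p], hence valid for the value that [flow] selects. In units of
    [eta n]: at most [5 / 4] initially, 1/50 of oscillation, and [4 * 25 / 16 * 20 / 1000 = 1 / 8]
    of drift. *)
Lemma orbit_short t q : flow_rel rad Ham t p q -> `|t| <= tn / 1000 ->
  `|q.2| < 3 / 2 * eta n.
Proof.
move=> [al [be [z [ab0 abt sol z0 <-]]]] tt; have en := eta_gt0 n.
have cv := solution_level_curve sol ab0 abt; rewrite z0 in cv.
have sp := speed_ge0 n.
apply: (@le_lt_trans _ _ (145 / 100 * eta n)); last by lra.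
apply: norm_le_entry => [|i]; first by rewrite mulr_ge0// ltW.
have half0 : 0 <= 2^-1 :> R by rewrite invr_ge0.
have := level_curve_action a_eta half0 cv i; rewrite z0 => h.
have -> : (z t).2 0 i = p.2 0 i + ((z t).2 0 i - p.2 0 i) by rewrite addrC subrK.
apply: le_trans (ler_normD _ _) _.
have h1 := le_trans (entry_le_norm p.2 i) p2_norm.
have h2 : speed n * `|t| <= 20 * eta n / 1000.
  by rewrite -speed_tn -mulrA ler_wpM2l.
have -> : 145 / 100 * eta n = (eta n + eta n / 4) + (2 / 10) * eta n by field.
apply: lerD; first by move: rr_le; lra.
apply: le_trans h _; rewrite -mulrA; lra.
Qed.

Lemma orbit_long q : flow_rel rad Ham tn p q -> 2 * eta n <= `|q.2|.
Proof.
move=> [al [be [z [ab0 abt sol z0 <-]]]]; have en := eta_gt0 n.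
have q0 := le_trans ler01 (Q_ge1 n); have /andP[p2 p4] := pi_bounds.
have cv T : 0 <= T <= tn -> level_curve a 2^-1 4 0 T (fun t => (z t).1)
    (fun t => (z t).2) (fun t => (sdisc (z t).1 (z t).2)^-1).
  move=> /andP[T0 T1]; have := @solution_level_curve al be T z sol ab0.
  rewrite z0; apply; move: ab0 abt => /andP[? ?] /andP[? ?].
  by apply/andP; split; lra.
have kp := kap_gt0.
have half0 : 0 <= 2^-1 :> R by rewrite invr_ge0.
(* The cosine starts above [1 - 1 / 4], by the size of the initial angle modulo the lattice, and
   loses at most another 1/4 since the energy is exponentially close to resonance. *)
have phase T : 0 <= T <= tn -> 2^-1 <= cos (dot (freq n) (z T).1).
  move=> T01; have /andP[T0 T1] := T01.
  have := level_curve_phase n half0 (cv T T01); rewrite z0 (ger0_norm T0) => h.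
  have [k kr] := p_angle.
  have := cos_lipschitz 0 (dot (freq n) (p.1 + of_int R k)).
  rewrite cos_freq_translate cos0 subr0.
  move=> /le_trans/(_ (dot_le freq_fbound n _)) h0.
  have h1 : fbound n * `|p.1 + of_int R k| <= 4^-1.
    apply: (@le_trans _ _ (fbound n * (eta n / 4))).
      rewrite ler_wpM2l ?(le_trans ler01 (fbound_ge1 n))//.
      exact: le_trans (ltW kr) rr_le.
    have -> : fbound n * (eta n / 4) = pi * ((Q n)%:~R * eta n).
      by rewrite /fbound; field.
    have -> : 4^-1 = 4 * 16^-1 :> R by field.
    by apply: ler_pM; rewrite ?pi_ge0// mulr_ge0// ltW.
  have h2 : 4 * (2 * pi * (kap * (Q n)%:~R * `|a - eta n|)) * T <= 4^-1.
    have h3 : `|a - eta n| * T <= enlip * (eta n / 4) / c.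
      (* The exponentially small radius is used here: it beats the length [tn] of the drift. *)
      have h4 : expR (- (c * tn)) * tn <= c^-1.
        rewrite expRN mulrC ler_pdivrMr ?expR_gt0// mulrC ler_pdivlMr// mulrC.
        by apply: le_trans (expR_ge1Dx _); rewrite lerDr.
      have l0 : 0 <= enlip.
        have := le_trans (normr_ge0 _) a_enlip.
        by rewrite pmulr_lge0.
      apply: le_trans (ler_pM (normr_ge0 _) T0 a_enlip T1) _.
      rewrite /rr; have -> : enlip * (eta n / 4 * expR (- (c * tn))) * tn =
        enlip * (eta n / 4) * (expR (- (c * tn)) * tn) by ring.
      by rewrite ler_wpM2l// mulr_ge0// divr_ge0// ltW.
    have -> : 4 * (2 * pi * (kap * (Q n)%:~R * `|a - eta n|)) * T =
      8 * pi * kap * (Q n)%:~R * (`|a - eta n| * T) by ring.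
    apply: (@le_trans _ _ (8 * pi * kap * (Q n)%:~R * (enlip * (eta n / 4) / c))).
      by rewrite ler_wpM2l// !mulr_ge0// ?ltW// pi_gt0.
    have -> : 8 * pi * kap * (Q n)%:~R * (enlip * (eta n / 4) / c) =
      ((8 * pi * kap * enlip) / c) * (((Q n)%:~R * eta n) / 4).
      by field; rewrite gt_eqF.
    have h5 : 8 * pi * kap * enlip / c <= 1 by rewrite ler_pdivrMr// mul1r.
    have h6 : 0 <= (Q n)%:~R * eta n by rewrite mulr_ge0// ltW.
    apply: (@le_trans _ _ (1 * (((Q n)%:~R * eta n) / 4))).
      by rewrite ler_wpM2r// divr_ge0.
    by rewrite mul1r; move: Q_eta; lra.
  have := le_trans (cos_lipschitz (dot (freq n) p.1) (dot (freq n) (z T).1))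
    (le_trans h h2).
  move: (le_trans h0 h1); rewrite !ler_norml => /andP[x1 _] /andP[x2 _].
  lra.
have tn1 : 0 <= tn <= tn by rewrite (ltW tn_gt0) lexx.
have := level_curve_drift a_eta half0 (cv tn tn1) (ltW tn_gt0) phase.
rewrite z0 /= => h.
apply: le_trans (entry_le_norm (z tn).2 i1); rewrite ler_normr; apply/orP; right.
have y1 : p.2 0 i1 <= eta n / 4.
  have -> : p.2 0 i1 = (p.2 - I_init) 0 i1.
    by rewrite !mxE [i1 == i0]eq_sym (negbTE i01) mulr0 subr0.
  apply: le_trans (ler_norm _) _; apply: le_trans (entry_le_norm _ _) _.
  exact: le_trans (ltW p_action) rr_le.
move: h; have -> : 2^-1 * (9 / 32) * speed n * tn = 9 / 64 * (speed n * tn) by field.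
rewrite speed_tn; lra.
Qed.

End Orbits.

End Model.

(** * Choice of the parameters *)

Section Choice.
Variables (R : realType) (tau kappa l T0 eps : R).
Hypotheses (tau_gt1 : 1 < tau) (kappa_gt0 : 0 < kappa) (l_gt1 : 1 < l)
  (T0_gt0 : 0 < T0) (eps_gt0 : 0 < eps).

Local Notation q n := ((cden tau n)%:~R : R).
Local Notation p n := ((cnum tau n)%:~R : R).

Definition drift_exp : R := 1 + (l - 1) / (tau + 1) + eps.
Definition res_level n : R := (q n * calpha tau - p n) / (kappa * q n).
(* chosen so that the resonant mode [n] moves the action by [20 * res_level n]
   during the time [T0 / res_level n `^ drift_exp] *)
Definition amp n : R :=
  20 * res_level n `^ drift_exp / (2 * pi * res_level n * q n * T0).

Lemma den_ge_pow n : 4 ^+ n <= q n.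
Proof.
elim: n => [|n IH]; first by rewrite expr0 (qR_ge1 tau_gt1).
rewrite exprS; apply: le_trans (qR_ge4 tau_gt1 n).
by rewrite ler_wpM2l.
Qed.

Lemma res_level_gt0 n : 0 < res_level n.
Proof.
have /andP[a1 _] := calpha_approx tau_gt1 n.
rewrite divr_gt0 ?mulr_gt0 ?(qR_gt0 tau_gt1)//; apply: lt_le_trans a1.
by rewrite invr_gt0 (qR_gt0 tau_gt1).
Qed.

Lemma eta_le n : res_level n <= 2 / kappa / (q n * q n.+1).
Proof.
have /andP[_ a2] := calpha_approx tau_gt1 n.
have q0 := qR_gt0 tau_gt1 n; have q1 := qR_gt0 tau_gt1 n.+1.
rewrite /res_level ler_pdivrMr ?mulr_gt0//; apply: le_trans a2 _.
by rewrite le_eqVlt; apply/orP; left; apply/eqP; field; rewrite !gt_eqF.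
Qed.

Lemma eta_ge n : kappa^-1 / (q n * q n.+1) <= res_level n.
Proof.
have /andP[a1 _] := calpha_approx tau_gt1 n.
have q0 := qR_gt0 tau_gt1 n; have q1 := qR_gt0 tau_gt1 n.+1.
rewrite /res_level ler_pdivlMr ?mulr_gt0//; apply: le_trans a1.
by rewrite le_eqVlt; apply/orP; left; apply/eqP; field; rewrite !gt_eqF.
Qed.

Lemma eta_step n : 4 * res_level n.+1 <= res_level n.
Proof.
apply: le_trans (eta_ge n); have q0 := qR_gt0 tau_gt1 n.
have q1 := qR_gt0 tau_gt1 n.+1; have q2 := qR_gt0 tau_gt1 n.+2.
apply: (@le_trans _ _ (4 * (2 / kappa / (q n.+1 * q n.+2)))).
  by rewrite ler_wpM2l// eta_le.
have -> : 4 * (2 / kappa / (q n.+1 * q n.+2)) =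
    kappa^-1 / (q n * q n.+1) * (8 * q n / q n.+2).
  by field; rewrite !gt_eqF.
rewrite ler_piMr//; first by rewrite divr_ge0 ?invr_ge0 ?ltW// mulr_gt0.
rewrite ler_pdivrMr// mul1r; have := qR_ge4 tau_gt1 n.
have := qR_ge4 tau_gt1 n.+1; lra.
Qed.

Lemma res_level_sep m n : (m < n)%N -> 4 * res_level n <= res_level m.
Proof.
elim: n => [//|n IH]; rewrite ltnS leq_eqVlt => /predU1P[->|/IH h].
  exact: eta_step.
have := eta_step n; have := res_level_gt0 n; have := res_level_gt0 n.+1; lra.
Qed.

Lemma eta_le_den n : res_level n <= 2 / kappa * q n `^ (- (tau + 1)).
Proof.
apply: le_trans (eta_le n) _; have q0 := qR_gt0 tau_gt1 n.
have q1 := qR_gt0 tau_gt1 n.+1.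
rewrite ler_wpM2l ?divr_ge0 ?(ltW kappa_gt0)//.
rewrite powRN lef_pV2 ?posrE ?mulr_gt0 ?powR_gt0//.
have -> : q n `^ (tau + 1) = q n * q n `^ tau.
  by rewrite powRD ?powRr1 ?(ltW q0) ?(gt_eqF q0) ?implybT// mulrC.
by rewrite ler_wpM2l ?(ltW q0)//; have /andP[] := qR_growth tau_gt1 n.
Qed.

Lemma eta_small N n : res_level (N + n) <= 2 / kappa / 4 ^+ N.
Proof.
apply: le_trans (eta_le _) _; rewrite ler_wpM2l ?divr_ge0 ?(ltW kappa_gt0)//.
have q0 := qR_ge1 tau_gt1 (N + n).+1; have q1 := den_ge_pow (N + n).
rewrite lef_pV2 ?posrE ?mulr_gt0 ?exprn_gt0 ?(qR_gt0 tau_gt1)//.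
have h : 4 ^+ N <= q (N + n).
  apply: le_trans q1; rewrite exprD ler_peMr ?exprn_ge0//.
  by rewrite exprn_ege1// ler1n.
by apply: le_trans h _; rewrite ler_peMr// (le_trans ler01 (qR_ge1 tau_gt1 _)).
Qed.

Lemma den_eta_small N n : q (N + n) * res_level (N + n) <= 2 / kappa / 4 ^+ N.
Proof.
have q0 := qR_gt0 tau_gt1 (N + n); have q1 := qR_gt0 tau_gt1 (N + n).+1.
apply: (@le_trans _ _ (2 / kappa / q (N + n).+1)).
  apply: le_trans (ler_wpM2l (ltW q0) (eta_le _)) _.
  by rewrite le_eqVlt; apply/orP; left; apply/eqP; field; rewrite !gt_eqF.
rewrite ler_wpM2l ?divr_ge0 ?(ltW kappa_gt0)//.
rewrite lef_pV2 ?posrE ?exprn_gt0//; apply: le_trans (den_ge_pow _).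
by rewrite -addnS exprD ler_peMr ?exprn_ge0//; apply: exprn_ege1; rewrite ler1n.
Qed.

Let delta : R := eps * (tau + 1).
Definition amp_const : R :=
  20 / (2 * pi * T0) * (2 / kappa) `^ (drift_exp - 1).

Let delta_gt0 : 0 < delta.
Proof. by rewrite mulr_gt0// addr_gt0// (lt_trans ltr01). Qed.

Lemma amp_const_ge0 : 0 <= amp_const.
Proof. by rewrite mulr_ge0 ?powR_ge0// divr_ge0// !mulr_ge0 ?pi_ge0// ltW. Qed.

Lemma amp_ge0 n : 0 <= amp n.
Proof.
have q0 := qR_gt0 tau_gt1 n; have e0 := res_level_gt0 n.
rewrite /amp; apply: divr_ge0; first by rewrite mulr_ge0 ?powR_ge0.
move: (res_level n) e0 => y y0.
by rewrite !mulr_ge0 ?pi_ge0 ?(ltW y0) ?(ltW q0) ?(ltW T0_gt0).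
Qed.

(** The exponent count: the level is of order [q ^ (- (tau + 1))] and the amplitude of order
    [res_level ^ (drift_exp - 1) / q], and [(tau + 1) * (drift_exp - 1) + 1 = l + delta]. *)
Lemma amp_le n : amp n <= amp_const * q n `^ (- (l + delta)).
Proof.
have q0 := qR_gt0 tau_gt1 n; have e0 := res_level_gt0 n.
have t1 : 0 < tau + 1 by rewrite addr_gt0// (lt_trans ltr01).
have d0 : 0 <= drift_exp - 1.
  have X0 : 0 <= (l - 1) / (tau + 1).
    by rewrite divr_ge0 ?subr_ge0 ?(ltW l_gt1) ?(ltW t1).
  rewrite /drift_exp; move: (_ / _) X0 => X X0; move: eps_gt0; lra.
have E : res_level n `^ drift_exp = res_level n `^ (drift_exp - 1) * res_level n.
  rewrite -[in RHS](powRr1 (ltW e0)) -powRrM mul1r -powRD ?subrK//.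
  by rewrite (gt_eqF e0) implybT.
have -> : amp n = 20 / (2 * pi * T0) * (res_level n `^ (drift_exp - 1) / q n).
  have aux (x y z : R) : 0 < x -> 0 < y ->
      20 * (z * x) / (2 * pi * x * y * T0) = 20 / (2 * pi * T0) * (z / y).
    move=> x0 y0; move: pi (pi_gt0 R) => w w0.
    by field; rewrite !gt_eqF.
  by rewrite /amp E aux.
rewrite /amp_const -[leRHS]mulrA ler_wpM2l//.
  by rewrite divr_ge0// !mulr_ge0 ?pi_ge0// ltW.
rewrite ler_pdivrMr//.
apply: (@le_trans _ _ ((2 / kappa * q n `^ (- (tau + 1))) `^ (drift_exp - 1))).
  rewrite ge0_ler_powR ?nnegrE ?(ltW e0) ?eta_le_den//.
  by rewrite mulr_ge0 ?powR_ge0// divr_ge0// ltW.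
rewrite powRM ?powR_ge0 ?divr_ge0 ?(ltW kappa_gt0)//.
rewrite -mulrA ler_wpM2l ?powR_ge0// -powRrM.
rewrite -[X in _ <= _ * X](powRr1 (ltW q0)) -powRD ?(gt_eqF q0) ?implybT//.
rewrite le_eqVlt; apply/orP; left; apply/eqP; congr (_ `^ _).
rewrite /drift_exp /delta; field; rewrite gt_eqF//.
Qed.

(* The factor [eps] in the drift time leaves room for [delta / 2] extra
   derivatives. *)
Lemma amp_moment N (m : R) : m <= l + delta / 2 ->
  moment_summable (fbound R (fun n => cden tau (N + n))) m
    (fun n => amp (N + n)).
Proof.
move=> ml; set C := amp_const * (4 * pi) `^ m.
(* Ratio of a geometric majorant, available since the denominators are at least [4 ^ n]. *)
pose x : R := 4 `^ (- (delta / 2)).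
have x0 : 0 < x by rewrite powR_gt0.
have x1 : x < 1.
  rewrite /x powRN invf_lt1 ?powR_gt0//.
  have := @gt0_ltr_powR R (delta / 2).
  rewrite divr_gt0// => /(_ isT 1 4); rewrite !nnegrE powR1; apply => //.
  by rewrite ltr1n.
apply: (@abs_summable_le _ _ (geometric C x)); last first.
  by apply: is_cvg_geometric_series; rewrite ger0_norm// ltW.
move=> n /=; have q0 := qR_gt0 tau_gt1 (N + n); have q1 := qR_ge1 tau_gt1 (N + n).
have p40 : 0 <= 4 * pi :> R by rewrite mulr_ge0 ?pi_ge0.
rewrite /fbound powRM// ?(ltW q0)// ger0_norm; last first.
  by apply: mulr_ge0; [exact: amp_ge0|rewrite mulr_ge0 ?powR_ge0].
apply: (@le_trans _ _ (amp_const * q (N + n) `^ (- (l + delta)) *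
    ((4 * pi) `^ m * q (N + n) `^ m))).
  by rewrite ler_wpM2r ?amp_le// mulr_ge0 ?powR_ge0.
have -> : amp_const * q (N + n) `^ (- (l + delta)) *
    ((4 * pi) `^ m * q (N + n) `^ m) =
    C * (q (N + n) `^ (- (l + delta)) * q (N + n) `^ m) by rewrite /C; ring.
have C0 : 0 <= C by rewrite mulr_ge0 ?amp_const_ge0 ?powR_ge0.
rewrite (ler_wpM2l C0)// -powRD ?(gt_eqF q0) ?implybT//.
apply: (@le_trans _ _ (q (N + n) `^ (- (delta / 2)))).
  by rewrite ler_powR//; lra.
have -> : x ^+ n = (4 ^+ n) `^ (- (delta / 2)).
  rewrite -(powR_mulrn n (ltW x0)) -(powR_mulrn n (ler0n R 4)) -!powRrM.
  by rewrite [n%:R * _]mulrC.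
rewrite !powRN lef_pV2 ?posrE ?powR_gt0 ?exprn_gt0//.
rewrite ge0_ler_powR ?nnegrE ?exprn_ge0 ?(ltW q0) ?divr_ge0 ?(ltW delta_gt0)//.
apply: le_trans (den_ge_pow _); rewrite exprD ler_peMl ?exprn_ge0//.
by rewrite exprn_ege1// ler1n.
Qed.

Lemma amp_sum N : ampsum (fun n => amp (N + n)) <= 2 * amp_const / 4 ^+ N.
Proof.
have x1 : `|4^-1 : R| < 1 by rewrite ger0_norm// invf_lt1// ltr1n.
have cg := @is_cvg_geometric_series R (amp_const / 4 ^+ N) 4^-1 x1.
have q_inv n : q n `^ (- (l + delta)) <= (4 ^+ n)^-1.
  rewrite powRN lef_pV2 ?posrE ?powR_gt0 ?exprn_gt0 ?(qR_gt0 tau_gt1)//.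
  apply: le_trans (den_ge_pow n) _; apply: le1r_powR; first exact: (qR_ge1 tau_gt1).
  by have := delta_gt0; have := l_gt1; lra.
have le_g n : `|amp (N + n)| <= geometric (amp_const / 4 ^+ N) 4^-1 n.
  rewrite ger0_norm ?amp_ge0//=; apply: le_trans (amp_le _) _.
  rewrite -[leRHS]mulrA ler_wpM2l ?amp_const_ge0// exprVn -invfM -exprD.
  exact: q_inv.
apply: le_trans (ler_norm _) _; apply: le_trans (tsum_le le_g cg) _.
have /cvg_lim E := @cvg_geometric_series R (amp_const / 4 ^+ N) 4^-1 x1.
rewrite /tsum E// ler_pdivrMr; last by rewrite subr_gt0 invf_lt1// ltr1n.
have : 0 <= amp_const / 4 ^+ N by rewrite divr_ge0 ?amp_const_ge0 ?exprn_ge0.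
set y := amp_const / 4 ^+ N => y0.
have -> : 2 * amp_const / 4 ^+ N = 2 * y by rewrite /y mulrA.
have -> : 2 * y * (1 - 4^-1) = 3 / 2 * y by field.
lra.
Qed.

End Choice.

Lemma exists_pow4_ge (R : realType) (X : R) : exists N : nat, X <= 4 ^+ N.
Proof.
exists (Num.bound `|X|); apply: le_trans (ler_norm X) _.
apply: le_trans (ltW (archi_boundP (normr_ge0 X))) _.
by rewrite -natrX ler_nat ltnW// ltn_expl.
Qed.

Lemma ln_le_expRN1 (R : realType) (x : R) : 0 < x -> x <= expR (-1) ->
  1 <= `|ln x|.
Proof.
move=> x0 xe; have : ln x <= -1 by rewrite -(expRK (-1)) ler_ln ?posrE ?expR_gt0.
by move=> h; rewrite -normrN; apply: le_trans (ler_norm _); rewrite lerNr.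
Qed.

Lemma flow_relP (R : realType) (d : nat) (r : R) (H : 'rV[R]_d -> 'rV[R]_d -> R)
    t p : flow_defined r H t p -> flow_rel r H t p (flow r H t p).
Proof. by move=> [q pq]; exact: (xgetPex p (ex_intro _ q pq)). Qed.

Lemma flow_rel_dom (R : realType) (d : nat) (r : R)
    (H : 'rV[R]_d -> 'rV[R]_d -> R) t p q : flow_rel r H t p q -> `|q.2| < r.
Proof. by move=> [a [b [z [_ abt /(_ t abt)[zr _ _] _ <-]]]]. Qed.

Theorem corollary1 (R : realType) (d : nat) (rad tau l T0 eps : R)
    (hd : (2 <= d)%N) (hrad : 0 < rad)
    (htau : d%:R - 1 < tau) (hl : (2 * d + 1)%:R < l)
    (hT0 : 0 < T0) (heps : 0 < eps) :
  exists (H f : 'rV[R]_d -> 'rV[R]_d -> R) (omega : 'rV[R]_d)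
         (theta_ I_ : nat -> 'rV[R]_d) (C1 c : R),
    let rho n := `|I_ n| in
    let t_ n := T0 / rho n `^ (1 + (l - 1) / (tau + 1) + eps) in
    [/\ holder_torus_ball l rad H,
        forall theta I, `|I| < rad -> H theta I = dot omega I + f theta I,
        O_I2 f &
        diophantine tau omega] /\
    [/\ forall n, 0 < rho n < rad,
        forall n, rho n != 1 &
        rho n @[n --> \oo] --> 0] /\
    [/\ 0 < C1, 0 < c &
      forall (n : nat) (p : 'rV[R]_d * 'rV[R]_d),
        phase_dist p (theta_ n, I_ n)
          < `|rho n| / 4 * expR (- (c * `|t_ n|)) ->
        (forall t : R,
           `|t| < C1 / (rho n `^ (1 + (l - 1) / (tau + 1))
                        * `|ln (rho n)| `^ (l - 1)) ->
           flow_defined rad H t p /\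
           `|(flow rad H t p).2| < 3 / 2 * rho n) /\
        ((forall t : R, 0 <= t <= t_ n -> flow_defined rad H t p) /\
         2 * rho n <=
           sup [set `|(flow rad H t p).2| | t in [set t | 0 <= t <= t_ n]])].
Proof.
have d0 : (0 < d)%N by exact: ltnW.
pose i0 : 'I_d := Ordinal d0; pose i1 : 'I_d := Ordinal hd.
have i01 : i0 != i1 by [].
have tau_gt1 : 1 < tau.
  by apply: le_lt_trans htau; rewrite lerBrDr -[1 + 1]/(2%:R) ler_nat.
have l_gt5 : 5 < l.
  by apply: le_lt_trans hl; rewrite ler_nat addn1 ltnS (leq_mul2l 2 2 d).
have l_gt1 : 1 < l by lra.
have [omega [dio w0 w1]] :=
  @exists_diophantine R d tau i0 i1 hd htau erefl erefl.
pose kp : R := kap rad; have kp0 : 0 < kp by exact: kap_gt0.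
pose pw := drift_exp tau l eps.
pose A1 := amp_const tau kp l T0 eps.
have A10 : 0 <= A1 by exact: amp_const_ge0.
pose w : R := onorm omega; have ww : 0 <= w by exact: onorm_ge0.
have ex0 : 0 < expR (-1) :> R by exact: expR_gt0.
(* Lower bounds for [4 ^ N]. The first two make [ampsum] small relative to [kap] and to [omega] and
   [rad]. The next three give [eta n <= rad / 201], [Q n * eta n <= 1 / 16], and
   [eta n <= exp (- 1)], so that the logarithm has size at least 1. The last gives [eta n <= T0]. *)
pose X1 := 800 * A1 / kp; pose X2 := 64 * w * rad * A1.
pose X3 := 2 / kp / (rad / 201); pose X4 := 2 / kp / 16^-1.
pose X5 := 2 / kp / expR (-1); pose X6 := 2 / kp / T0.
have kp2 : 0 < 2 / kp by rewrite divr_gt0.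
have X10 : 0 <= X1.
  by apply: divr_ge0 (ltW kp0); apply: mulr_ge0 A10; exact: ler0n.
have X20 : 0 <= X2.
  apply: mulr_ge0 A10; apply: mulr_ge0 (ltW hrad); apply: mulr_ge0 ww.
  exact: ler0n.
have r201 : 0 < rad / 201 by apply: divr_gt0 hrad _; exact: ltr0Sn.
have X30 : 0 <= X3 by exact: ltW (divr_gt0 kp2 r201).
have X40 : 0 <= X4 by apply: ltW; exact: divr_gt0.
have X50 : 0 <= X5 by apply: ltW; exact: divr_gt0.
have X60 : 0 <= X6 by apply: ltW; exact: divr_gt0.
have [N XN] := exists_pow4_ge (X1 + X2 + X3 + X4 + X5 + X6).
pose P n := cnum tau (N + n); pose Q n := cden tau (N + n).
pose eta n : R := res_level tau kp (N + n); pose e n : R := amp tau kp l T0 eps (N + n).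
have N0 : 0 < 4 ^+ N :> R by rewrite exprn_gt0.
have small h : 0 < h -> 2 / kp / h <= 4 ^+ N -> 2 / kp / 4 ^+ N <= h.
  by move=> h0; rewrite !ler_pdivrMr// [h * _]mulrC.
have eta0 n : 0 < eta n by exact: res_level_gt0.
have eta_lt h n : 0 < h -> 2 / kp / h <= 4 ^+ N -> eta n <= h.
  by move=> h0 hN; apply: le_trans (small h h0 hN); exact: eta_small.
have eta_rad n : 200 * eta n < rad.
  have h : eta n <= rad / 201 by apply: eta_lt => //; rewrite -/X3; lra.
  by have := eta0 n; lra.
have Q_eta n : (Q n)%:~R * eta n <= 16^-1.
  apply: le_trans (den_eta_small tau_gt1 kp0 N n) _; apply: small => //.
  by rewrite -/X4; lra.
have eta_exp n : eta n <= expR (-1) by apply: eta_lt => //; rewrite -/X5; lra.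
have eta_T0 n : eta n <= T0 by apply: eta_lt => //; rewrite -/X6; lra.
have ex1 : expR (-1) < 1 :> R by rewrite -[ltRHS]expR0 ltr_expR; lra.
have eta1 n : eta n < 1 by exact: le_lt_trans ex1.
have es := amp_sum tau_gt1 kp0 l_gt1 hT0 heps N.
rewrite -/A1 -/e in es.
have e0 n : 0 <= e n by exact: amp_ge0.
have kap_es : 400 * ampsum e <= kap rad.
  rewrite -/kp; apply: (@le_trans _ _ (400 * (2 * A1 / 4 ^+ N))).
    by apply: ler_wpM2l es; exact: ler0n.
  have : X1 <= 4 ^+ N by lra.
  rewrite /X1 mulrA (ler_pdivrMr _ _ N0) (ler_pdivrMr _ _ kp0).
  by move: (4 ^+ N) => y; lra.
have w_es : 32 * w * rad * ampsum e <= 1.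
  apply: (@le_trans _ _ (32 * w * rad * (2 * A1 / 4 ^+ N))).
    apply: ler_wpM2l es; apply: mulr_ge0 (ltW hrad); apply: mulr_ge0 ww.
    exact: ler0n.
  rewrite mulrA (ler_pdivrMr _ _ N0) mul1r.
  have -> : 32 * w * rad * (2 * A1) = X2 by rewrite /X2; ring.
  lra.
pose q := Num.truncn l; have /andP[ql lq] := truncn_itv (le_trans ler01 (ltW l_gt1)).
pose del : R := eps * (tau + 1).
have del0 : 0 < del by rewrite mulr_gt0// addr_gt0// (lt_trans ltr01).
(* Positive even when [l] is an integer, at least the fractional part of [l], and such that [q + s]
   stays within the range of [amp_moment]. *)
pose s : R := Num.min 1 (l - q%:R + del / 2).
have s0 : 0 < s.
  by rewrite lt_min ltr01/= ltr_wpDl ?subr_ge0// divr_gt0.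
have s1 : s <= 1 by rewrite ge_min lexx.
have ls : 0 <= l - q%:R <= s.
  rewrite subr_ge0 ql /s le_min lerDl divr_ge0 ?(ltW del0)// andbT.
  by move: lq; rewrite -natr1 -/q; lra.
have qs : q%:R + s <= l + del / 2.
  have : s <= l - q%:R + del / 2 by rewrite ge_min lexx orbT.
  lra.
have q2 : 2 <= q%:R :> R by move: lq; rewrite -natr1 -/q; lra.
have mom m : m <= l + del / 2 -> moment_summable (fbound R Q) m e.
  by move=> ml; exact: (amp_moment tau_gt1 kp0 l_gt1 hT0 heps).
have em : moment_summable (fbound R Q) (1 + (1 + s)) e by apply: mom; lra.
have Q0 n : 0 < Q n by exact: (cden_gt0 tau_gt1).
have PQ n : 0 <= P n <= Q n by exact: (cnum_bounds tau_gt1).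
have P0 n : 0 <= P n by have /andP[] := PQ n.
have PQ' n : P n <= Q n by have /andP[] := PQ n.
have res n : dot (kvec R i0 i1 P Q n) omega = kap rad * (Q n)%:~R * eta n.
  rewrite dot_kvec// w0 w1 mulr1 -/kp /eta /res_level -/(Q n) -/(P n).
  have QR : 0 < (Q n)%:~R :> R by rewrite ltr0z.
  by rewrite [RHS]mulrC divfK// gt_eqF// mulr_gt0.
have sep m n : (m < n)%N -> 4 * eta n <= eta m.
  by move=> mn; apply: (res_level_sep tau_gt1 kp0); rewrite ltn_add2l.
pose tn n : R := T0 / eta n `^ pw.
have pw1 : 1 <= pw.
  have : 0 <= (l - 1) / (tau + 1).
    by rewrite divr_ge0 ?subr_ge0 ?(ltW l_gt1)// addr_ge0// ltW// (lt_trans ltr01).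
  by rewrite /pw /drift_exp => h; rewrite -addrA lerDl addr_ge0// ltW.
(* Since [eta n < 1 <= pw], one has [eta n ^ pw <= eta n <= T0]. This lets one constant [c],
   independent of [n], satisfy [L <= c * tn n]. *)
have tn1 n : 1 <= tn n.
  rewrite ler_pdivlMr ?powR_gt0// mul1r; apply: le_trans (eta_T0 n).
  by apply: ge1r_powR => //; rewrite eta0 ltW.
have tn0 n : 0 < tn n by exact: lt_le_trans (tn1 n).
have sp n : speed Q e eta n * tn n = 20 * eta n.
  have QR : 0 < (Q n)%:~R :> R by rewrite ltr0z.
  have pe : 0 < eta n `^ pw by rewrite powR_gt0.
  have aux (u x y v : R) : 0 < u -> 0 < x -> 0 < y -> 0 < v ->
      x ^+ 2 * (2 * v * (20 * u / (2 * v * x * y * T0)) * y) * (T0 / u) = 20 * x.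
    by move=> u0 x0 y0 v0; field; rewrite !gt_eqF.
  exact: aux pe (eta0 n) QR (pi_gt0 R).
pose L := enlip omega rad Q e.
pose c : R := `|L| + 8 * pi * kp * `|L| + 1.
have pk : 0 <= 8 * pi * kp :> R.
  by apply: mulr_ge0 (ltW kp0); apply: mulr_ge0 (pi_ge0 R).
have pkL : 0 <= 8 * pi * kp * `|L| by exact: mulr_ge0.
have c1 : 0 <= `|L| + 8 * pi * kp * `|L| by exact: addr_ge0.
have c0 : 0 < c by exact: ltr_wpDl.
have cL n : L <= c * tn n.
  apply: (@le_trans _ _ c); last by rewrite ler_peMr// ltW.
  apply: le_trans (ler_norm L) _; rewrite /c -addrA lerDl.
  exact: addr_ge0.
have cP : 8 * pi * kap rad * L <= c.
  apply: (@le_trans _ _ (8 * pi * kp * `|L|)).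
    by apply: ler_wpM2l => //; exact: ler_norm.
  by rewrite /c addrAC lerDr; exact: addr_ge0.
exists (Ham i0 i1 omega rad P Q e).
exists (fun theta I => Ham i0 i1 omega rad P Q e theta I - dot omega I), omega.
exists (fun=> 0), (I_init i0 eta), (T0 / 1000), c.
move=> rho t_.
have rhoE n : rho n = eta n by exact: norm_I_init.
have tE n : t_ n = tn n by rewrite /t_ rhoE.
split.
  split; [|by move=> theta I _; rewrite addrC subrK| |exact: dio].
    apply: (Ham_holder i01 hrad s0 s1 P0 PQ' Q0 e0 em w_es ls).
    by apply: mom; exact: qs.
  exact: (Ham_O_I2 i0 i1 P hrad s0 Q0 e0 em w_es).
split.
  split => [n|n|].
  - rewrite rhoE eta0/=; apply: le_lt_trans (eta_rad n).
    by apply: (ler_peMl (ltW (eta0 n))); rewrite ler1n.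
  - by rewrite rhoE lt_eqF.
  have lt41 : `|4^-1 : R| < 1 by rewrite ger0_norm// invf_lt1// ltr1n.
  have cg := @cvg_geometric R (2 / kp / 4 ^+ N) 4^-1 lt41.
  apply: (squeeze_cvgr _ (cvg_cst 0) cg); apply: nearW => n.
  rewrite rhoE (ltW (eta0 n))/=.
  have -> : 2 / kp / 4 ^+ N * 4^-1 ^+ n = 2 / kp / 4 ^+ (N + n).
    by rewrite exprVn exprD invfM mulrA.
  by have := eta_small tau_gt1 kp0 (N + n) 0; rewrite addn0.
split; [by apply: divr_gt0 hT0 _; exact: ltr0Sn|exact: c0|].
move=> n p; rewrite rhoE tE => pn.
have pn' : phase_dist p (0, I_init i0 eta n) <
    `|I_init i0 eta n| / 4 * expR (- (c * `|tn n|)).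
  by rewrite norm_I_init//; move: pn; rewrite (ger0_norm (ltW (eta0 n))).
have defd t := orbit_defined i01 hrad s0 s1 P0 PQ' Q0 e0 em w_es eta0 res sep
  kap_es w0 (tn0 n) c0 (sp n) (eta_rad n) (cL n) pn' (t := t).
split.
  move=> t tC.
  have lnl : 1 <= `|ln (eta n)| `^ (l - 1).
    have := @ler_powR R _ (ln_le_expRN1 (eta0 n) (eta_exp n)) 0 (l - 1).
    by rewrite powRr0; apply; rewrite subr_ge0 ltW.
  (* The logarithmic factor is at least 1, and [eta n < 1] makes the power with the extra [eps] the
     smaller one. *)
  have tt : `|t| <= tn n / 1000.
    apply: le_trans (ltW tC) _; rewrite /tn [leRHS]mulrAC.
    apply: ler_wpM2l; first by apply: divr_ge0 (ltW hT0) _; exact: ler0n.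
    rewrite lef_pV2 ?posrE ?mulr_gt0 ?powR_gt0 ?(lt_le_trans ltr01 lnl)//; last first.
      by rewrite (lt_le_trans ltr01)// ln_le_expRN1.
    apply: (@le_trans _ _ (eta n `^ (1 + (l - 1) / (tau + 1)))).
      have en01 : 0 < eta n <= 1 by rewrite eta0 (ltW (eta1 n)).
      by apply: (ger_powR en01); rewrite /pw /drift_exp lerDl (ltW heps).
    by rewrite ler_peMr ?powR_ge0.
  have tdef : flow_defined rad (Ham i0 i1 omega rad P Q e) t p.
    apply: defd; apply: le_trans tt _; apply: (ler_piMr (ltW (tn0 n))).
    by rewrite (invf_le1 (ltr0Sn _ _)) ler1n.
  split => //.
  exact: (orbit_short i01 hrad s0 s1 P0 PQ' Q0 e0 em w_es eta0 res sep
    kap_es w0 (tn0 n) c0 (sp n) (eta_rad n) (cL n) pn' (flow_relP tdef) tt).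
have defd' t : 0 <= t <= tn n -> flow_defined rad (Ham i0 i1 omega rad P Q e) t p.
  by move=> /andP[t0 t1]; apply: defd; rewrite ger0_norm.
split => //.
have tnn : 0 <= tn n <= tn n by rewrite (ltW (tn0 n)) lexx.
apply: (@le_trans _ _ `|(flow rad (Ham i0 i1 omega rad P Q e) (tn n) p).2|).
  exact: (orbit_long i01 hrad s0 s1 P0 PQ' Q0 e0 em w_es eta0 res sep
    kap_es w0 (tn0 n) c0 (sp n) (eta_rad n) (Q_eta n) (cL n) cP pn'
    (flow_relP (defd' _ tnn))).
apply: ub_le_sup; last by exists (tn n).
(* Orbits remain in the domain, so [rad] bounds the set from above, as [sup] requires. *)
exists rad => _ [t tI <-]; apply: ltW; apply: flow_rel_dom.
exact/flow_relP/defd'.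
Qed.
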